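(* Let $\tau$ be large and let $\kappa=\kappa(\tau)$ denote the unique real solution of $\mathcal{L}'(\kappa)=\log\tau+\gamma$. Then $$\Phi_{\mathbb{X}}(\tau)= \frac{\mathbb{E}\left(L(1,\mathbb{X})^{\kappa}\right)(e^{\gamma}\tau)^{-\kappa}}{\kappa \sqrt{2\pi \mathcal{L}''(\kappa)}}\left(1+O\left(\sqrt{\frac{\log \kappa}{\kappa}} \right)\right).$$ Moreover, for any $0\leq \lambda\leq 1/\kappa$ we have $$\Phi_{\mathbb{X}}\big(e^{-\lambda}\tau\big)=\Phi_{\mathbb{X}}(\tau)\big(1+O(\lambda \kappa)\big).$$
   Context: For a prime $p$ put $c(p)=1+\left(\frac{-1}{p}\right)$. Let $\{\mathbb{X}(p)\}_p$ be independent random variables indexed by primes, where $\mathbb{X}(2)=\pm1$ each with probability $\alpha_2=\beta_2=1/2$ ($\gamma_2=0$), and for odd $p$, $\mathbb{X}(p)$ takes the value $1$ with probability $\alpha_p=\frac12\left(1-\frac{c(p)+1}{p}\right)\left(1-\frac{c(p)}{p^2}\right)^{-1}$, the value $-1$ with probability $\beta_p=\frac12\left(1-\frac{c(p)-1}{p}\right)\left(1-\frac{c(p)}{p^2}\right)^{-1}$, and $0$ with probability $\gamma_p=1-\alpha_p-\beta_p$. Put $L(1,\mathbb{X})=\prod_p\left(1-\frac{\mathbb{X}(p)}{p}\right)^{-1}$ (almost surely convergent), and $\Phi_{\mathbb{X}}(\tau)=\mathbb{P}(L(1,\mathbb{X})>e^{\gamma}\tau)$, $\gamma$ Euler's constant.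 For real $r$ let $E_p(r)=\alpha_p(1-1/p)^{-r}+\beta_p(1+1/p)^{-r}+\gamma_p$ and $\mathcal{L}(r)=\log\mathbb{E}(L(1,\mathbb{X})^r)=\sum_p\log E_p(r)$. The function $r\mapsto\mathcal{L}'(r)$ is strictly increasing on the reals and tends to $\infty$, so for large $\tau$ the equation $\mathcal{L}'(r)=\log\tau+\gamma$ has a unique solution. *)

(* Defs.v *)
From HB Require Import structures.
From mathcomp Require Import all_boot all_order all_algebra finmap.
From mathcomp Require Import all_classical all_reals all_analysis.
Set Implicit Arguments.
Unset Strict Implicit.
Unset Printing Implicit Defensive.
Import Order.TTheory GRing.Theory Num.Theory.
Import numFieldNormedType.Exports.
Local Open Scope classical_set_scope.
Local Open Scope ring_scope.

Definition euler_gamma (R : realType) : R :=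
  limn (fun n : nat => \sum_(1 <= k < n.+1) (k%:R : R)^-1 - ln (n%:R : R)).
Arguments euler_gamma {R}.

(* Only meaningful for p an odd prime. *)
Definition legendre (a : int) (p : nat) : int :=
  if (p %| a)%Z then 0
  else if [exists x : 'I_p, (x%:Z ^+ 2 == a %[mod p])%Z] then 1 else -1.

Definition cp (R : realType) (p : nat) : R := 1 + (legendre (-1) p)%:~R.
Arguments cp {R} p.

Definition alphap (R : realType) (p : nat) : R :=
  if p == 2%N then 2^-1
  else 2^-1 * (1 - (cp p + 1) / p%:R) * (1 - cp p / p%:R ^+ 2)^-1.
Arguments alphap {R} p.

Definition betap (R : realType) (p : nat) : R :=
  if p == 2%N then 2^-1
  else 2^-1 * (1 - (cp p - 1) / p%:R) * (1 - cp p / p%:R ^+ 2)^-1.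
Arguments betap {R} p.

Definition gammap (R : realType) (p : nat) : R := 1 - alphap p - betap p.
Arguments gammap {R} p.

Section RandomEulerProduct.
Context {R : realType} {d : measure_display} {T : measurableType d}.
Variable P : probability T R.

(* Mutual independence of the subfamily of X indexed by D. *)
Definition independent_RVs (I : choiceType) (D : set I)
    (X : I -> {RV P >-> R}) : Prop :=
  forall (J : {fset I}) (A : I -> set R),
    [set` J] `<=` D -> (forall i, i \in J -> measurable (A i)) ->
    P (\bigcap_(i in [set` J]) (X i @^-1` A i))
    = (\prod_(i <- J) fine (P (X i @^-1` A i)))%:E.

(* Families are indexed by nat, but only the values at primes are ever
   constrained or used. *)
Definition random_model (X : nat -> {RV P >-> R}) : Prop :=
  independent_RVs [set p | prime p] X /\
  forall p, prime p ->
    [/\ P (X p @^-1` [set 1]) = (alphap p)%:E,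
        P (X p @^-1` [set -1]) = (betap p)%:E
      & P (X p @^-1` [set 0]) = (gammap p)%:E].

Variable X : nat -> {RV P >-> R}.

(* The product converges only almost surely and conditionally, hence it is
   taken over primes in increasing order; where it diverges, limn returns an
   irrelevant default value. *)
Definition L1 (w : T) : R :=
  limn (fun N : nat =>
    \prod_(0 <= p < N | prime p) (1 - X p w / p%:R)^-1).

Definition PhiX (tau : R) : R :=
  fine (P [set w | expR euler_gamma * tau < L1 w]).

Definition momentL1 (r : R) : R := fine 'E_P[fun w => L1 w `^ r].

Definition calL (r : R) : R := ln (momentL1 r).

End RandomEulerProduct.

(* Main.v *)
Require Import Defs.
From HB Require Import structures.
From mathcomp Require Import all_boot all_order all_algebra finmap.
From mathcomp Require Import all_classical all_reals all_analysis.
From mathcomp Require Import measurable_realfun complex.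
From mathcomp Require Import zify ring lra.
Set Implicit Arguments.
Unset Strict Implicit.
Unset Printing Implicit Defensive.
Import Order.TTheory GRing.Theory Num.Theory.
Import numFieldNormedType.Exports.
Local Open Scope classical_set_scope.
Local Open Scope ring_scope.

(* Put Y = ln L(1,X), m = ln tau + gamma = L'(kappa), and let E_kappa be the
   expectation tilted by e^{kappa Y}.  Then
     Phi(tau) = E(e^{kappa Y}) e^{-kappa m} E_kappa(e^{-kappa (Y-m)} 1_{Y>m}),
   and under the tilted law Y has mean m and variance
   sigma^2 = L''(kappa), of exact order 1/(kappa ln kappa).  The tilted factors
   at the primes p of size about u = max(kappa,|t|) are non-degenerate, and
   Chebyshev's bounds provide u / ln u of them, so the characteristic function
   decays like exp(-c t^2/(u ln u)); comparing the other factors with Gaussians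
   gives, with S^2 = kappa ln kappa,
     |E_kappa cos(t(Y-m)+th) - e^{-sigma^2 t^2/2} cos th|
        <= C (S/kappa) / (1+(t/S)^2).
   The right-hand side has integral O(ln kappa), whereas the Gaussian density
   at 0 is 1/(sigma sqrt(2 pi)), of order sqrt(kappa ln kappa): the ratio is
   O(sqrt(ln kappa/kappa)).  Smoothing with narrow Gaussians and Fourier
   inversion turn this into an estimate of the tilted Laplace transform, which
   is the first claim, and into a bound O(lambda/sigma) for the tilted mass of
   an interval of length lambda, which is the second. *)

(** * Chebyshev estimates *)

(** The product converges only conditionally, so no estimate is made on [L1] itself. All
    quantitative work is done on the finite sums over [primes_in 0 N], with bounds free of N, and is
    carried to the limit by almost sure convergence together with uniformly bounded exponential
    moments. These moments stay bounded because the nonzero values of a log-factor are 1/p and -1/p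
    up to O(p^-2), with weights that differ by O(1/p): every factor is 1 + O(p^-2). The error in the
    characteristic function has to be integrable in t. The cubic Taylor comparison is affordable
    only for |t| <= k; beyond k the decay alone is used, of the form exp(-c sqrt|t|), which beats
    every power of t. The one-sided exponential behind the tail jumps at 0, so its Fourier transform
    is not integrable; the Gaussian smoothing is harmless because its error bound does not depend on
    its width. The constants are chosen before the probability space, since all bounds involve
    [euler_law] alone. That kappa is large comes from an explicit upper bound for L' at a fixed
    point and from monotonicity, not from asymptotics of L'. *)

Section ChebyshevNat.
Local Open Scope nat_scope.

Definition primes_in (a b : nat) : seq nat := [seq p <- index_iota a b | prime p].

Lemma mem_primes_in a b p : (p \in primes_in a b) = [&& prime p, a <= p & p < b].
Proof. by rewrite mem_filter mem_index_iota. Qed.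

Lemma primes_in_uniq a b : uniq (primes_in a b).
Proof. by rewrite filter_uniq // iota_uniq. Qed.

Lemma primes_in_cat a b c : a <= b <= c ->
  primes_in a c = primes_in a b ++ primes_in b c.
Proof.
move=> /andP[ab bc]; rewrite /primes_in -filter_cat; congr seq.filter.
by rewrite /index_iota -[in iota b _](subnKC ab) -iotaD; congr iota; lia.
Qed.

Lemma bin_le_exp2 n k : 'C(n, k) <= 2 ^ n.
Proof.
elim: n k => [|n IH] [|k]; rewrite ?bin0 ?bin0n ?expn_gt0 //.
by rewrite binS expnS mul2n -addnn leq_add.
Qed.

Lemma exp2_le_central_bin n : 2 ^ n <= 'C(n.*2, n).
Proof.
elim: n => [|n IH]; first by rewrite bin0.
rewrite doubleS binS expnS mul2n -addnn.
have -> : 'C(n.*2.+1, n) = 'C(n.*2.+1, n.+1).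
  by rewrite -[RHS]bin_sub; [congr 'C(_, _); lia | lia].
have : 'C(n.*2, n) <= 'C(n.*2.+1, n.+1) by rewrite binS leq_addl.
lia.
Qed.

Lemma prod_primes_dvdn (s : seq nat) m : uniq s -> all prime s ->
  (forall p, p \in s -> p %| m) -> \prod_(p <- s) p %| m.
Proof.
elim: s m => [|p s IH] m /=; first by rewrite big_nil dvd1n.
move=> /andP[ps us] /andP[pp al] H; rewrite big_cons Gauss_dvd.
  rewrite H ?mem_head //=; apply: IH => // q qs; apply: H.
  by rewrite in_cons qs orbT.
rewrite big_seq; apply: (big_ind (coprime p)) => [|x y Hx Hy|q qs]; first exact: coprimen1.
  by rewrite coprimeMr Hx.
rewrite prime_coprime // dvdn_prime2 //; last by move/allP: al => /(_ q qs).
by apply: contra ps => /eqP ->.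
Qed.

Lemma prime_dvd_fact p n : prime p -> (p %| n`!) = (p <= n).
Proof.
move=> pp; apply/idP/idP => [|pn]; last by rewrite dvdn_fact // prime_gt0.
elim: n => [|n IH]; first by rewrite fact0 Euclid_dvd1.
by rewrite factS Euclid_dvdM // => /orP[/dvdn_leq -> //|/IH]; lia.
Qed.

Lemma prime_ndvd_fact p n : prime p -> n < p -> ~~ (p %| n`!).
Proof. by move=> pp np; rewrite prime_dvd_fact // -ltnNge. Qed.

(** A prime in (n, 2n] divides (2n)! but not n!, hence divides the central binomial coefficient,
    which is at most 2^(2n). *)
Lemma prod_primes_le_exp4 n : \prod_(p <- primes_in n.+1 n.*2.+1) p <= 4 ^ n.
Proof.
have -> : 4 ^ n = 2 ^ n.*2 by rewrite -mul2n expnM.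
apply: leq_trans (bin_le_exp2 _ n); apply: dvdn_leq.
  by rewrite bin_gt0; lia.
apply: prod_primes_dvdn; first exact: primes_in_uniq.
  by apply/allP => p; rewrite mem_primes_in => /andP[].
move=> p; rewrite mem_primes_in => /and3P[pp np p2n].
have nn : n <= n.*2 by lia.
have := bin_fact nn; have -> : n.*2 - n = n by lia.
move=> E; have : p %| n.*2`! by rewrite prime_dvd_fact //; lia.
rewrite -E Euclid_dvdM // => /orP[//|].
by rewrite Euclid_dvdM // orbb (negPf (prime_ndvd_fact pp np)).
Qed.

Lemma divn_double_le n q : 0 < q -> n.*2 %/ q <= (n %/ q).*2 + (q <= n.*2).
Proof.
move=> q0; have [le|lt] := leqP q n.*2; last by rewrite divn_small //; lia.
have := divn_eq n q; have := ltn_pmod n q0.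
set a := n %/ q; set r := n %% q => hr E.
by rewrite -ltnS ltn_divLR //; nia.
Qed.

(** By Legendre's formula the exponent of p is the sum over k of floor(2n/p^k) - 2 floor(n/p^k);
    each term is at most 1 and vanishes once p^k > 2n. *)
Lemma logn_central_bin p n : prime p -> 0 < n ->
  p ^ logn p 'C(n.*2, n) <= n.*2.
Proof.
move=> pp n0; have p1 := prime_gt1 pp.
suff : logn p 'C(n.*2, n) <= trunc_log p n.*2.
  by move=> H; apply: (leq_trans (leq_pexp2l _ H)); rewrite ?trunc_logP //; lia.
have nn : n <= n.*2 by lia.
have := congr1 (logn p) (bin_fact nn); have -> : n.*2 - n = n by lia.
rewrite !lognM ?muln_gt0 ?fact_gt0 ?bin_gt0 ?nn // !logn_fact //.
have -> : \sum_(1 <= k < n.+1) n %/ p ^ k = \sum_(1 <= k < n.*2.+1) n %/ p ^ k.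
  rewrite [RHS](@big_cat_nat _ _ _ n.+1) //=.
  rewrite [X in _ = _ + X]big_nat_cond [X in _ = _ + X]big1 ?addn0 // => k /andP[/andP[nk _] _].
  by apply: divn_small; apply: (leq_trans nk); apply: ltnW; exact: ltn_expl.
have : \sum_(1 <= k < n.*2.+1) n.*2 %/ p ^ k <=
   (\sum_(1 <= k < n.*2.+1) n %/ p ^ k).*2 + trunc_log p n.*2.
  have tl : trunc_log p n.*2 < n.*2.+1.
    rewrite ltnS; apply: leq_trans (_ : p ^ trunc_log p n.*2 <= _).
      by apply: ltnW; exact: ltn_expl.
    by apply: trunc_logP; lia.
  have -> : trunc_log p n.*2 = \sum_(1 <= k < n.*2.+1) (k <= trunc_log p n.*2).
    rewrite (@big_cat_nat _ _ _ (trunc_log p n.*2).+1) //=.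
    rewrite [X in _ = _ + X]big_nat_cond [X in _ = _ + X]big1; last first.
      by move=> k /andP[/andP[h _] _]; rewrite leqNgt h.
    rewrite addn0 big_nat_cond (eq_bigr (fun=> 1)).
      rewrite -big_nat_cond sum_nat_const_nat. by rewrite muln1 subSS subn0.
    by move=> k /andP[/andP[_ h] _]; rewrite -ltnS h.
  rewrite -[(\sum_(_ <= _ < _) _).*2]addnn -!big_split /=; apply: leq_sum => k _.
  rewrite addnn; apply: (leq_trans (divn_double_le _ _)); first by rewrite expn_gt0; lia.
  rewrite leq_add2l; case: (leqP (p ^ k) n.*2) => //= h.
  by rewrite (trunc_log_max p1 h).
lia.
Qed.

(** Each prime power of the factorization is at most 2n and only primes up to 2n occur; against
    [exp2_le_central_bin] this bounds the number of primes from below. *)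
Lemma central_bin_le n : 0 < n ->
  'C(n.*2, n) <= n.*2 ^ size (primes_in 0 n.*2.+1).
Proof.
move=> n0; have C0 : 0 < 'C(n.*2, n) by rewrite bin_gt0; lia.
rewrite {1}(prod_prime_decomp C0) prime_decompE big_map /=.
apply: (@leq_trans (\prod_(p <- primes 'C(n.*2, n)) n.*2)).
  rewrite big_seq [X in _ <= X]big_seq; apply: leq_prod => p.
  by rewrite mem_primes => /andP[pp _]; exact: logn_central_bin.
rewrite big_const_seq count_predT iter_muln_1 leq_pexp2l //; first by lia.
apply: uniq_leq_size; first exact: primes_uniq.
move=> p; rewrite mem_primes mem_primes_in => /and3P[pp _ d]; rewrite pp /= ltnS.
have := prime_dvd_fact n.*2 pp => <-.
have nn : n <= n.*2 by lia.
by rewrite -(bin_fact nn) dvdn_mulr.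
Qed.

End ChebyshevNat.

Section Chebyshev.
Context {R : realType}.
Implicit Types (n m p : nat).

Lemma ln_le_sub1 (x : R) : 0 < x -> ln x <= x - 1.
Proof.
move=> x0; have := @le_ln1Dx R (x - 1); rewrite subrKC; apply; lra.
Qed.

Lemma ln2_ge_half : 2^-1 <= ln (2 : R).
Proof.
by have := @ln_le_sub1 (2^-1) ltac:(lra); rewrite lnV ?posrE; lra.
Qed.

Lemma ln_nat_ge0 n : 0 <= ln (n%:R : R).
Proof.
case: n => [|n]; first by rewrite ln0.
by rewrite ln_ge0 // ler1n.
Qed.

Lemma ler_ln_nat n m : (0 < n)%N -> (n <= m)%N -> ln (n%:R : R) <= ln m%:R.
Proof.
by move=> n0 nm; rewrite ler_ln ?posrE ?ltr0n ?ler_nat //; lia.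
Qed.

Lemma le_sum_cat (s1 s2 : seq nat) (F : nat -> R) : (forall i, 0 <= F i) ->
  \sum_(i <- s1) F i <= \sum_(i <- s1 ++ s2) F i.
Proof. by move=> F0; rewrite big_cat /= lerDl sumr_ge0. Qed.

Lemma le_sum_primes_in (F : nat -> R) a b c : (forall i, 0 <= F i) ->
  (b <= c)%N -> \sum_(i <- primes_in a b) F i <= \sum_(i <- primes_in a c) F i.
Proof.
move=> F0 bc; have [ab|ba] := leqP a b.
  by rewrite (@primes_in_cat a b c) ?ab // le_sum_cat.
rewrite /primes_in /index_iota (_ : (b - a = 0)%N) /= ?big_nil ?sumr_ge0 //; lia.
Qed.

Lemma ln_prod_nat (s : seq nat) : all (leq 1) s ->
  ln ((\prod_(p <- s) p)%N%:R : R) = \sum_(p <- s) ln p%:R.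
Proof.
elim: s => [|p s IH] /=; first by rewrite !big_nil ln1.
move=> /andP[p0 al]; rewrite !big_cons natrM lnM ?IH // posrE ltr0n //.
by rewrite big_seq prodn_cond_gt0 // => i /(allP al).
Qed.

Lemma all_primes_in_gt0 a b : all (leq 1) (primes_in a b).
Proof.
by apply/allP => p; rewrite mem_primes_in => /andP[/prime_gt0].
Qed.

Lemma theta_le n : \sum_(p <- primes_in 0 n.+1) ln (p%:R : R) <= 4 * n%:R.
Proof.
elim/ltn_ind: n => n IH.
have [n2|n3] := leqP n 2.
  have : \sum_(p <- primes_in 0 n.+1) ln (p%:R : R) <= \sum_(p <- primes_in 0 3) 1 *+ (n == 2%N).
    case: n {IH} n2 => [|[|[|//]]] _; rewrite /primes_in /= ?big_nil ?sumr_ge0 //.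
    rewrite !big_seq1 /=.
    by have := @ln_le_sub1 2 ltac:(lra); lra.
  move=> /le_trans; apply; rewrite /primes_in /= big_seq1.
  case: n {IH} n2 => [|[|[|//]]] _ /=; lra.
(* The primes in (c, 2c] contribute at most c ln 4 <= 2c, the induction gives 4c for the others, and
   6c <= 3n + 3 <= 4n because n >= 3. *)
pose c := uphalf n.
have c1 : (c < n)%N by rewrite /c; lia.
have c2 : (n <= c.*2 <= n.+1)%N by rewrite /c; lia.
apply: (@le_trans _ _ (\sum_(p <- primes_in 0 c.*2.+1) ln (p%:R : R))).
  by apply: le_sum_primes_in; [exact: ln_nat_ge0 | lia].
rewrite (@primes_in_cat 0 c.+1); last by lia.
rewrite big_cat /= -(ln_prod_nat (all_primes_in_gt0 c.+1 _)).
have H1 := IH _ c1.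
have H2 : ln ((\prod_(p <- primes_in c.+1 c.*2.+1) p)%N%:R : R) <= 2 * c%:R.
  apply: (@le_trans _ _ (ln ((4 ^ c)%N%:R : R))).
    apply: ler_ln_nat; last exact: prod_primes_le_exp4.
    by rewrite big_seq prodn_cond_gt0 // => i /(allP (all_primes_in_gt0 _ _)).
  have -> : (4 ^ c = 2 ^ c.*2)%N by rewrite -mul2n expnM.
  rewrite natrX lnXn ?ltr0n // -[_ *+ c.*2]mulr_natr -muln2 natrM.
  have := @ln_le_sub1 2 ltac:(lra); have : 0 <= c%:R :> R by rewrite ler0n.
  nra.
have : (6 * c%:R <= 4 * n%:R :> R) by rewrite -!natrM ler_nat; lia.
lra.
Qed.

(** A substitute for Stirling's formula: passing from n to n + 1 adds n (ln (n+1) - ln n), which is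
    at most 1. *)
Lemma sum_ln_ratio n : \sum_(1 <= k < n.+1) (ln (n%:R : R) - ln k%:R) <= n%:R.
Proof.
elim: n => [|n IH]; first by rewrite big_nil.
rewrite big_nat_recr //= subrr addr0.
have [->|n0] := posnP n; first by rewrite big_nil ler0n.
have -> : \sum_(1 <= k < n.+1) (ln (n.+1%:R : R) - ln k%:R) =
  \sum_(1 <= k < n.+1) (ln (n%:R : R) - ln k%:R) + n%:R * (ln n.+1%:R - ln n%:R).
  rewrite [X in _ = _ + X](_ : _ = \sum_(1 <= k < n.+1) (ln (n.+1%:R : R) - ln n%:R)).
    by rewrite -big_split /=; apply: eq_bigr => k _; lra.
  by rewrite sumr_const_nat subn1 /= -[RHS]mulr_natl.
have n0' : 0 < n%:R :> R by rewrite ltr0n.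
have H : ln (n.+1%:R : R) - ln n%:R <= n%:R^-1.
  rewrite -ln_div ?posrE ?ltr0n //.
  apply: le_trans (ln_le_sub1 _) _; first by rewrite divr_gt0 ?ltr0n.
  by rewrite -[n.+1]addn1 natrD mulrDl divff ?gt_eqF // mul1r; lra.
have : n%:R * (ln (n.+1%:R : R) - ln n%:R) <= 1.
  by rewrite -[leRHS](@divff _ (n%:R : R)) ?gt_eqF // ler_wpM2l // ltW.
rewrite -natr1 => h; lra.
Qed.

(** Writing ln n = ln p + ln (n/p) replaces partial summation: the first part is Chebyshev's theta,
    the second is extended from primes to all integers up to n at a cost of at most n. *)
Lemma pi_le n : (size (primes_in 0 n.+1))%:R * ln (n%:R : R) <= 5 * n%:R.
Proof.
have -> : (size (primes_in 0 n.+1))%:R * ln (n%:R : R) =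
  \sum_(p <- primes_in 0 n.+1) (ln (p%:R : R)) +
  \sum_(p <- primes_in 0 n.+1) (ln (n%:R : R) - ln p%:R).
  rewrite -big_split /= (eq_bigr (fun=> ln (n%:R : R))); last by move=> *; lra.
  by rewrite big_const_seq count_predT iter_addr_0 mulr_natl.
have := theta_le n.
suff : \sum_(p <- primes_in 0 n.+1) (ln (n%:R : R) - ln p%:R) <= n%:R by lra.
apply: le_trans (sum_ln_ratio n).
rewrite big_filter /index_iota subn0 /= big_cons /= subn1 /=.
rewrite big_mkcond /= big_seq [leRHS]big_seq; apply: ler_sum => p.
rewrite mem_iota => /andP[p1 p2].
by case: ifP => // _; rewrite subr_ge0 ler_ln_nat //; lia.
Qed.

(** In p ln n = p ln p + p ln (n/p) the first term is at most n ln p and the second at most n - p;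
    [theta_le] then gives 4 n^2 + n^2. *)
Lemma sum_primes_le n : (0 < n)%N ->
  (\sum_(p <- primes_in 0 n.+1) p%:R) * ln (n%:R : R) <= 5 * n%:R ^+ 2.
Proof.
move=> n0; have n0' : 0 < n%:R :> R by rewrite ltr0n.
rewrite mulr_suml.
apply: (@le_trans _ _ (n%:R * (\sum_(p <- primes_in 0 n.+1) ln (p%:R : R)) +
   \sum_(p <- primes_in 0 n.+1) n%:R)).
  rewrite mulr_sumr -big_split /= big_seq [leRHS]big_seq; apply: ler_sum => p.
  rewrite mem_primes_in => /and3P[pp _ pn].
  have p0 : 0 < p%:R :> R by rewrite ltr0n prime_gt0.
  have pn' : p%:R <= n%:R :> R by rewrite ler_nat.
  have -> : ln (n%:R : R) = ln p%:R + ln (n%:R / p%:R).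
    by rewrite ln_div ?posrE //; lra.
  rewrite mulrDr lerD // ?ler_wpM2r ?ln_nat_ge0 //.
  have := @ln_le_sub1 (n%:R / p%:R) ltac:(by rewrite divr_gt0).
  move=> /(ler_wpM2l (ltW p0)); rewrite mulrBr mulrCA divff ?gt_eqF // !mulr1 => h; lra.
rewrite big_const_seq count_predT iter_addr_0 -[n%:R *+ _]mulr_natr.
have : (size (primes_in 0 n.+1))%:R <= n%:R :> R.
  rewrite ler_nat size_filter /index_iota subn0 /=.
  by rewrite -[leqRHS](size_iota 1 n) count_size.
have := theta_le n; nra.
Qed.

(** A dyadic block (m, 2m] contributes at most 4 (2m) / m^2 = 8/m by [theta_le]; the factor 1 - 2^-j
    is the partial geometric sum that the induction on j reproduces. *)
Lemma sum_lnp_sq_dyadic k j : (0 < k)%N ->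
  \sum_(p <- primes_in k.+1 (2 ^ j * k).+1) (ln (p%:R : R) / p%:R ^+ 2)
  <= 16 / k%:R * (1 - 2 ^- j).
Proof.
move=> k0; have k0' : 0 < k%:R :> R by rewrite ltr0n.
elim: j => [|j IH].
  rewrite expn0 mul1n expr0 invr1 subrr mulr0.
  by rewrite /primes_in /index_iota subnn big_nil.
pose m := (2 ^ j * k)%N.
have m0 : (0 < m)%N by rewrite muln_gt0 expn_gt0 k0.
have m0' : 0 < m%:R :> R by rewrite ltr0n.
rewrite (@primes_in_cat k.+1 m.+1); last by rewrite /m expnS; nia.
rewrite big_cat /=.
have : \sum_(p <- primes_in m.+1 (2 ^ j.+1 * k).+1) (ln (p%:R : R) / p%:R ^+ 2) <= 8 / m%:R.
  apply: (@le_trans _ _ (m%:R ^- 2 *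
      \sum_(p <- primes_in m.+1 (2 ^ j.+1 * k).+1) ln (p%:R : R))).
    rewrite mulr_sumr big_seq [leRHS]big_seq; apply: ler_sum => p.
    rewrite mem_primes_in => /and3P[pp mp _].
    rewrite mulrC ler_wpM2r ?ln_nat_ge0 // lef_pV2 ?posrE ?exprn_gt0 ?ltr0n ?m0 ?(prime_gt0 pp) //.
    by rewrite lerXn2r ?nnegrE ?ler0n // ler_nat ltnW.
  apply: (@le_trans _ _ (m%:R ^- 2 * (4 * (m.*2)%:R))).
    rewrite ler_wpM2l ?invr_ge0 ?exprn_ge0 // ?ler0n //.
    apply: le_trans (theta_le _).
    have -> : m.*2 = (2 ^ j.+1 * k)%N by rewrite /m expnS -mul2n mulnA.
    rewrite [leRHS](_ : _ = \sum_(p <- primes_in 0 m.+1 ++ primes_in m.+1 (2 ^ j.+1 * k).+1) ln (p%:R : R)).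
      by rewrite big_cat /= lerDr sumr_ge0 // => i _; exact: ln_nat_ge0.
    by rewrite -primes_in_cat // /m expnS; nia.
  by rewrite -muln2 natrM le_eqVlt; apply/orP; left; apply/eqP; field; rewrite gt_eqF.
have -> : 8 / m%:R = 16 / k%:R * (2 ^- j - 2 ^- j.+1) :> R.
  rewrite /m natrM natrX exprS.
  have : 2 ^+ j != 0 :> R by rewrite expf_neq0.
  by move=> h; field; rewrite h /= gt_eqF.
move: IH; rewrite -/m; set x := 16 / _ => IH; rewrite !mulrBr in IH *; lra.
Qed.

Lemma sum_inv_sq_primes_le k n : (0 < k)%N ->
  (\sum_(p <- primes_in k.+1 n) p%:R ^- 2) * ln (k%:R : R) <= 16 / k%:R.
Proof.
move=> k0; have k0' : 0 < k%:R :> R by rewrite ltr0n.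
have F0 i : 0 <= ln (i%:R : R) / i%:R ^+ 2 by rewrite divr_ge0 ?ln_nat_ge0.
have n2 : (n <= (2 ^ n * k).+1)%N by have := @ltn_expl 2 n isT; nia.
apply: (@le_trans _ _ (\sum_(p <- primes_in k.+1 (2 ^ n * k).+1) (ln (p%:R : R) / p%:R ^+ 2))).
  apply: (@le_trans _ _ (\sum_(p <- primes_in k.+1 n) (ln (p%:R : R) / p%:R ^+ 2))); last first.
    exact: le_sum_primes_in.
  rewrite mulr_suml big_seq [leRHS]big_seq; apply: ler_sum => p.
  rewrite mem_primes_in => /and3P[pp kp _]; rewrite mulrC.
  by rewrite ler_wpM2r ?invr_ge0 ?exprn_ge0 // ler_ln_nat //; lia.
apply: le_trans (sum_lnp_sq_dyadic n k0) _.
rewrite -[leRHS]mulr1 ler_wpM2l ?divr_ge0 // ?ler0n //.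
Qed.

(** The range is wide enough for the lower bound pi(48n) ln n >= 6n, which follows from 2^(24n) <=
    (48n)^pi(48n), ln (48n) <= 2 ln n and ln 2 >= 1/2, to exceed the upper bound pi(n) ln n <=
    5n. *)
Lemma count_primes_ge_nat n : (48 <= n)%N ->
  n%:R <= (size (primes_in n.+1 (48 * n).+1))%:R * ln (n%:R : R).
Proof.
move=> n48.
have n0 : 0 < n%:R :> R by rewrite ltr0n; lia.
have ln0 : 0 <= ln (n%:R : R) by exact: ln_nat_ge0.
have H1 : 12 * n%:R <= (size (primes_in 0 (48 * n).+1))%:R * (2 * ln (n%:R : R)).
  have m0 : (0 < 24 * n)%N by lia.
  have := leq_trans (exp2_le_central_bin _) (central_bin_le m0).
  have -> : ((24 * n).*2 = 48 * n)%N by lia.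
  move=> H; apply: (@le_trans _ _ (ln ((2 ^ (24 * n))%N%:R : R))).
    rewrite natrX lnXn ?ltr0n // -[_ *+ (_ * _)%N]mulr_natr natrM.
    have := ln2_ge_half; nra.
  apply: le_trans (ler_ln_nat _ H) _; first by rewrite expn_gt0.
  rewrite natrX lnXn ?ltr0n; last by lia.
  rewrite -[_ *+ size _]mulr_natl ler_wpM2l ?ler0n //.
  rewrite natrM lnM ?posrE ?ltr0n //; last by lia.
  by have := @ler_ln_nat 48 n isT n48; lra.
have H2 := pi_le n.
have : (primes_in 0 (48 * n).+1 = primes_in 0 n.+1 ++ primes_in n.+1 (48 * n).+1).
  by rewrite -primes_in_cat //; lia.
move=> E; rewrite E size_cat natrD in H1; nra.
Qed.

Lemma count_primes_ge (u : R) : 48 <= u -> exists n : nat,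
  [/\ u <= n%:R, n%:R <= 2 * u &
      u <= (size (primes_in n.+1 (48 * n).+1))%:R * (2 * ln u)].
Proof.
move=> u48; have := @truncn_itv R u ltac:(lra).
set n := (Num.trunc u).+1 => /andP[h1 h2].
have n1 : n%:R <= u + 1 by rewrite /n -[(Num.trunc u).+1]addn1 natrD; lra.
exists n; split; [exact: ltW | lra |].
have n48 : (48 <= n)%N by rewrite -(ler_nat R); lra.
have := count_primes_ge_nat n48.
have : ln (n%:R : R) <= 2 * ln u.
  have -> : 2 * ln u = ln (u ^+ 2) by rewrite lnXn ?mulr_natl //; lra.
  rewrite ler_ln ?posrE ?exprn_gt0; nra.
have := ler0n R (size (primes_in n.+1 (48 * n).+1)); nra.
Qed.

End Chebyshev.

(** * Sums of independent ternary variables *)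

Section Elementary.
Context {R : realType}.
Implicit Types x u t : R.

Lemma sin_mvt x : exists2 c, `|c| <= `|x| & sin x = cos c * x.
Proof.
have H a b : a <= b -> exists2 c : R, c \in `[a, b] & sin b - sin a = cos c * (b - a).
  move=> ab; apply: MVT_segment => //.
  by apply: continuous_subspaceT; exact: continuous_sin.
have [x0|x0] := lerP 0 x.
  have [c] := H _ _ x0; rewrite in_itv /= sin0 !subr0 => /andP[c0 cx] E.
  by exists c => //; rewrite !ger0_norm.
have [c] := H _ _ (ltW x0); rewrite in_itv /= sin0 !sub0r => /andP[cx c0] E.
exists c; last by move: E; rewrite mulrN => /oppr_inj.
by rewrite !ler0_norm ?lerN2 // ltW.
Qed.

Lemma abs_sin_le x : `|sin x| <= `|x|.
Proof.
have [c _ ->] := sin_mvt x; rewrite normrM ler_piMl // cos_max //.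
Qed.

Lemma cosE_half x : cos x = 1 - 2 * sin (x / 2) ^+ 2.
Proof.
have E : x = (x / 2) *+ 2 by rewrite -mulr_natr divfK ?pnatr_eq0.
by rewrite {1}E cos_mulr2n cos2sin2 -mulr_natr; ring.
Qed.

Lemma cos_ge x : 1 - x ^+ 2 / 2 <= cos x.
Proof.
rewrite cosE_half; have := abs_sin_le (x / 2).
rewrite -ler_sqr ?nnegrE // !real_normK ?num_real //; lra.
Qed.

Lemma sub_sin_le x : `|sin x - x| <= `|x| ^+ 3 / 2.
Proof.
have [c cx ->] := sin_mvt x.
have -> : cos c * x - x = - ((1 - cos c) * x) by ring.
rewrite normrN normrM exprSr -mulrA -[leRHS]mulrC -mulrA [ `|x| * _]mulrC.
have c1 := cos_le1 c; have c2 := cos_ge c.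
have : `|1 - cos c| <= 2^-1 * `|x| ^+ 2.
  rewrite ger0_norm; last lra.
  move: cx; rewrite -ler_sqr ?nnegrE // [ `|c| ^+ 2]real_normK ?num_real //; lra.
by move=> h; rewrite ler_wpM2r.
Qed.

Lemma cos_taylor_ge0 x : 0 <= cos x - 1 + x ^+ 2 / 2.
Proof. have := cos_ge x; lra. Qed.

Lemma cos_taylor_le x : cos x - 1 + x ^+ 2 / 2 <= `|x| ^+ 4 / 8.
Proof.
rewrite cosE_half; set y := x / 2.
have -> : x = 2 * y by rewrite /y mulrC divfK ?pnatr_eq0.
have -> : `|2 * y| ^+ 4 / 8 = 2 * y ^+ 4.
  rewrite normrM exprMn (_ : `|y| ^+ 4 = y ^+ 4); last by rewrite -(normrX 4 y) ger0_norm ?exprn_even_ge0.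
  by rewrite ger0_norm //; field.
have -> : 1 - 2 * sin y ^+ 2 - 1 + (2 * y) ^+ 2 / 2 = - (2 * ((sin y - y) * (sin y + y))) by field.
apply: le_trans (ler_norm _) _; rewrite normrN !normrM ger0_norm // ler_wpM2l //.
have h1 := sub_sin_le y.
have h2 : `|sin y + y| <= 2 * `|y|.
  by apply: le_trans (ler_normD _ _) _; have := abs_sin_le y; lra.
apply: le_trans (ler_pM _ _ h1 h2) _; rewrite ?normr_ge0 //.
rewrite (_ : y ^+ 4 = `|y| ^+ 4); last by rewrite -(normrX 4 y) ger0_norm ?exprn_even_ge0.
by rewrite le_eqVlt; apply/orP; left; apply/eqP; field.
Qed.

Lemma cos_taylor3 x : `|cos x - 1 + x ^+ 2 / 2| <= `|x| ^+ 3.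
Proof.
rewrite ger0_norm ?cos_taylor_ge0 //.
have h1 := cos_taylor_le x; have h2 := cos_le1 x.
have E : x ^+ 2 = `|x| ^+ 2 by rewrite real_normK ?num_real.
have a0 := normr_ge0 x; rewrite E in h1 *; have [x1|x1] := lerP `|x| 1.
  apply: le_trans h1 _; rewrite exprS; have : 0 <= `|x| ^+ 3 by rewrite exprn_ge0.
  nra.
have : `|x| ^+ 2 <= `|x| ^+ 3 by rewrite [leRHS]exprS ler_peMl ?exprn_ge0 // ltW.
have : 0 <= `|x| ^+ 2 by rewrite exprn_ge0.
lra.
Qed.

Lemma one_sub_cos_ge x : `|x| <= 1 -> x ^+ 2 / 4 <= 1 - cos x.
Proof.
move=> x1; have := cos_taylor_le x.
have E : x ^+ 2 = `|x| ^+ 2 by rewrite real_normK ?num_real.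
rewrite E; have : `|x| ^+ 4 <= `|x| ^+ 2.
  by rewrite -[leLHS]/(`|x| ^+ (2 + 2)) exprD ler_piMl ?exprn_ge0 // exprn_ile1.
have : 0 <= `|x| ^+ 2 by rewrite exprn_ge0.
lra.
Qed.

Lemma expRN_le x : 0 <= x -> expR (- x) <= (1 + x)^-1.
Proof.
move=> x0; rewrite expRN lef_pV2 ?posrE ?expR_gt0 ?expR_ge1Dx //; lra.
Qed.

Lemma expRN_taylor_ge0 x : 0 <= expR (- x) - 1 + x.
Proof. have := expR_ge1Dx (- x); lra. Qed.

Lemma expRN_taylor_le1 x : 0 <= x -> expR (- x) - 1 + x <= x.
Proof. by move=> x0; have := @expR_le1 R (- x); rewrite oppr_le0 x0; lra. Qed.

Lemma expRN_taylor_le2 x : 0 <= x -> expR (- x) - 1 + x <= x ^+ 2.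
Proof.
move=> x0; have := expRN_le x0.
have : (1 + x)^-1 <= 1 - x + x ^+ 2.
  rewrite -[leLHS]mul1r ler_pdivrMr; last lra.
  have : 0 <= x ^+ 3 by rewrite exprn_ge0.
  rewrite !exprS expr0 !mulr1; lra.
lra.
Qed.

End Elementary.

(** * Comparison of products of complex numbers *)

Section ComplexProducts.
Context {R : realType}.
Local Notation normc := (@Normc.normc R).
Implicit Types z : R[i].

Lemma normc_le z : normc z <= `|complex.Re z| + `|complex.Im z|.
Proof.
case: z => x y /=; rewrite -(@ler_sqr R) ?nnegrE ?sqrtr_ge0 ?addr_ge0 //.
rewrite sqr_sqrtr ?addr_ge0 ?sqr_ge0 //.
rewrite -(real_normK (num_real x)) -(real_normK (num_real y)).
have := mulr_ge0 (normr_ge0 x) (normr_ge0 y); rewrite sqrrD -mulr_natr; lra.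
Qed.

Lemma abs_Re_le z : `|complex.Re z| <= normc z.
Proof.
case: z => x y /=; rewrite -sqrtr_sqr ler_sqrt ?lerDl ?sqr_ge0 //.
by rewrite addr_ge0 ?sqr_ge0.
Qed.

Lemma normc_ge0 z : 0 <= normc z.
Proof. by case: z => x y /=; rewrite sqrtr_ge0. Qed.

(** Exchanging the factors one at a time leaves, in each term, the product of all [e] but one; as
    that one is at least 1/2, putting it back costs a factor 2. *)
Lemma normc_prod_sub (s : seq nat) (a b : nat -> R[i]) (e : nat -> R) :
  (forall j, normc (a j) <= e j) -> (forall j, normc (b j) <= e j) ->
  (forall j, 1 <= 2 * e j) ->
  normc (\prod_(j <- s) a j - \prod_(j <- s) b j) <=
   2 * (\prod_(j <- s) e j) * \sum_(j <- s) normc (a j - b j).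
Proof.
move=> ae be e2; have e0 j : 0 <= e j by have := e2 j; lra.
have prod_le (c : nat -> R[i]) r : (forall j, normc (c j) <= e j) ->
    normc (\prod_(j <- r) c j) <= \prod_(j <- r) e j.
  move=> ce; elim: r => [|j r IH]; first by rewrite !big_nil Normc.normc1.
  by rewrite !big_cons Normc.normcM ler_pM ?normc_ge0.
elim: s => [|j s IH].
  by rewrite !big_nil subrr Normc.normc0 mulr0.
rewrite !big_cons; set A := \prod_(_ <- s) a _; set B := \prod_(_ <- s) b _.
set E := \prod_(_ <- s) e _; set S := \sum_(_ <- s) _.
have -> : a j * A - b j * B = (a j - b j) * A + b j * (A - B) by ring.
apply: le_trans (le_normcD _ _) _; rewrite !Normc.normcM.
have E0 : 0 <= E by apply: prodr_ge0.
have h1 : normc (a j - b j) * normc A <= 2 * (e j * E) * normc (a j - b j).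
  rewrite mulrC ler_wpM2r ?normc_ge0 //; apply: le_trans (prod_le _ _ ae) _.
  by rewrite -/E mulrA ler_peMl.
have h2 : normc (b j) * normc (A - B) <= e j * (2 * E * S).
  by rewrite ler_pM ?normc_ge0.
apply: le_trans (lerD h1 h2) _.
by rewrite mulrDr [leRHS]addrC addrC lerD //; lra.
Qed.

Lemma normc_prod_le (s : seq nat) (c : nat -> R[i]) (e : nat -> R) :
  (forall j, normc (c j) <= e j) ->
  normc (\prod_(j <- s) c j) <= \prod_(j <- s) e j.
Proof.
move=> ce; elim: s => [|j r IH]; first by rewrite !big_nil Normc.normc1.
by rewrite !big_cons Normc.normcM ler_pM ?normc_ge0.
Qed.

Definition cis (x : R) : R[i] := (cos x +i* sin x)%C.

Lemma cisD x y : cis (x + y) = cis x * cis y.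
Proof.
rewrite /cis cosD sinD; apply/eqP; rewrite eq_complex /=.
by apply/andP; split; apply/eqP; ring.
Qed.

Lemma normc_cis x : normc (cis x) = 1.
Proof. by rewrite /cis /= cos2Dsin2 sqrtr1. Qed.

End ComplexProducts.

(** * Expectation, tilting and characteristic function of a finite independent sum *)

Section Walk.
Context {R : realType}.
Local Notation normc := (@Normc.normc R).

Record law := Law { wa : nat -> R; wb : nat -> R; wc : nat -> R;
                    xa : nat -> R; xb : nat -> R; xc : nat -> R }.
Implicit Types (L : law) (s : seq nat) (g h : R -> R) (p : nat) (t r k : R).

Definition avg L p g := wa L p * g (xa L p) + wb L p * g (xb L p) + wc L p * g (xc L p).

(* [EN L s g] is the expectation of [g] at the sum over [p] in [s] of independent
   variables with values [xa L p], [xb L p], [xc L p] and weights [wa L p],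
   [wb L p], [wc L p]. *)
Fixpoint EN L s g : R :=
  if s is p :: s' then avg L p (fun x => EN L s' (fun y => g (y + x))) else g 0.

Definition mean L p := avg L p id.
Definition var L p := avg L p (fun x => (x - mean L p) ^+ 2).
Definition mgf L p r := avg L p (fun x => expR (r * x)).
Definition chf L p t : R[i] := (avg L p (fun x => cos (t * x)) +i* avg L p (fun x => sin (t * x)))%C.

Definition tilt L k := Law
  (fun p => wa L p * expR (k * xa L p) / mgf L p k)
  (fun p => wb L p * expR (k * xb L p) / mgf L p k)
  (fun p => wc L p * expR (k * xc L p) / mgf L p k) (xa L) (xb L) (xc L).

Definition is_law L := forall p,
  [/\ 0 <= wa L p, 0 <= wb L p, 0 <= wc L p & wa L p + wb L p + wc L p = 1].

Lemma eq_EN L s g h : g =1 h -> EN L s g = EN L s h.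
Proof. by move=> gh; congr EN; apply/funext. Qed.

Lemma EN_lin L s k g h : EN L s (fun y => k * g y + h y) = k * EN L s g + EN L s h.
Proof.
elim: s g h => [|p s IH] g h //=; rewrite /avg /= !IH; ring.
Qed.

Lemma EN_cst L s k : is_law L -> EN L s (fun=> k) = k.
Proof.
move=> HL; elim: s => [|p s IH] //=; rewrite /avg !IH.
have [_ _ _ E] := HL p; rewrite -[RHS]mul1r -E; ring.
Qed.

Lemma EN_scale L s k g : EN L s (fun y => k * g y) = k * EN L s g.
Proof.
elim: s g => [|p s IH] g //=; rewrite /avg /= !IH; ring.
Qed.

Lemma le_EN L s g h : is_law L -> (forall y, g y <= h y) -> EN L s g <= EN L s h.
Proof.
move=> HL; elim: s g h => [|p s IH] g h gh //=.
have [a0 b0 c0 _] := HL p; rewrite /avg.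
by rewrite !lerD // ler_wpM2l // IH.
Qed.

Lemma mgf_gt0 L p r : is_law L -> 0 < mgf L p r.
Proof.
move=> /(_ p)[a0 b0 c0 E]; rewrite /mgf /avg.
have ha := expR_gt0 (r * xa L p); have hb := expR_gt0 (r * xb L p).
have hc := expR_gt0 (r * xc L p).
have [a1|a1] := ltrP 0 (wa L p).
  by rewrite -addrA ltr_pwDl ?mulr_gt0 ?addr_ge0 ?mulr_ge0 // ltW.
have [b1|b1] := ltrP 0 (wb L p).
  by rewrite addrAC ltr_pwDr ?mulr_gt0 ?addr_ge0 ?mulr_ge0 // ltW.
have c1 : 0 < wc L p by lra.
by rewrite ltr_pwDr ?mulr_gt0 ?addr_ge0 ?mulr_ge0 // ltW.
Qed.

Lemma EN_exp L s r : EN L s (fun y => expR (r * y)) = \prod_(p <- s) mgf L p r.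
Proof.
elim: s => [|p s IH] /=; first by rewrite big_nil mulr0 expR0.
rewrite big_cons -IH /mgf /avg.
have E x : EN L s (fun y => expR (r * (y + x))) = expR (r * x) * EN L s (fun y => expR (r * y)).
  by rewrite -EN_scale; apply: eq_EN => y; rewrite mulrDr expRD mulrC.
rewrite (E (xa L p)) (E (xb L p)) (E (xc L p)); ring.
Qed.

(** Exponential change of measure: since exp(k y) is multiplicative in the summands, tilting the sum
    amounts to tilting each summand, and independence is kept. *)
Lemma EN_tilt L s k g : is_law L ->
  EN L s (fun y => expR (k * y) * g y) = (\prod_(p <- s) mgf L p k) * EN (tilt L k) s g.
Proof.
move=> HL; elim: s g => [|p s IH] g /=; first by rewrite big_nil mulr0 expR0.
have E x : EN L s (fun y => expR (k * (y + x)) * g (y + x)) =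
   expR (k * x) * ((\prod_(p <- s) mgf L p k) * EN (tilt L k) s (fun y => g (y + x))).
  by rewrite -IH -EN_scale; apply: eq_EN => y; rewrite mulrDr expRD; ring.
rewrite big_cons /avg /= !E; have := mgf_gt0 p k HL => /gt_eqF/negbT h.
by field.
Qed.

Lemma is_law_tilt L k : is_law L -> is_law (tilt L k).
Proof.
move=> HL p; have M0 := mgf_gt0 p k HL; have [a0 b0 c0 E] := HL p.
have M0' := ltW M0.
split; rewrite /= ?divr_ge0 ?mulr_ge0 ?expR_ge0 //.
by rewrite -!mulrDl; apply: divff; exact: lt0r_neq0.
Qed.

Lemma EN_id L s c : is_law L -> EN L s (fun y => y + c) = \sum_(p <- s) mean L p + c.
Proof.
move=> HL; elim: s c => [|p s IH] c /=; first by rewrite big_nil.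
rewrite /avg.
have E x : EN L s (fun y => y + x + c) = \sum_(p <- s) mean L p + (x + c).
  by rewrite -IH; apply: eq_EN => y; rewrite addrA.
rewrite !E big_cons /mean /avg; have [_ _ _ h] := HL p.
have -> : wc L p = 1 - wa L p - wb L p by rewrite -h; ring.
ring.
Qed.

Lemma EN_sqr L s c : is_law L ->
  EN L s (fun y => (y + c) ^+ 2) = \sum_(p <- s) var L p + (\sum_(p <- s) mean L p + c) ^+ 2.
Proof.
move=> HL; elim: s c => [|p s IH] c /=; first by rewrite !big_nil !add0r.
rewrite /avg.
have E x : EN L s (fun y => (y + x + c) ^+ 2) =
   \sum_(p <- s) var L p + (\sum_(p <- s) mean L p + (x + c)) ^+ 2.
  by rewrite -IH; apply: eq_EN => y; rewrite addrA.
rewrite !E !big_cons /var /mean /avg /=; have [_ _ _ h] := HL p.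
have -> : wc L p = 1 - wa L p - wb L p by rewrite -h; ring.
ring.
Qed.

(** The free phase is what the induction shifts; later it also absorbs the centering and the
    translation in Fourier inversion. *)
Lemma EN_cos L s t th :
  EN L s (fun y => cos (t * y + th)) = complex.Re (cis th * \prod_(p <- s) chf L p t).
Proof.
elim: s th => [|p s IH] th /=.
  by rewrite big_nil mulr1 mulr0 add0r.
rewrite /avg.
have E x : EN L s (fun y => cos (t * (y + x) + th)) =
    complex.Re (cis (t * x + th) * \prod_(p <- s) chf L p t).
  by rewrite -IH; apply: eq_EN => y; rewrite mulrDr addrA.
rewrite !E big_cons !cisD /chf /avg /=.
case: (\prod_(_ <- s) _) => u v /=; ring.
Qed.

Lemma varE L p : is_law L -> var L p =
  wa L p * wb L p * (xa L p - xb L p) ^+ 2 + wa L p * wc L p * (xa L p - xc L p) ^+ 2 +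
  wb L p * wc L p * (xb L p - xc L p) ^+ 2.
Proof.
move=> HL; rewrite /var /mean /avg /=; have [_ _ _ h] := HL p.
have -> : wc L p = 1 - wa L p - wb L p by rewrite -h; ring.
ring.
Qed.

Lemma mulr_sqr_ge0 (x y z : R) : 0 <= x -> 0 <= y -> 0 <= x * y * z ^+ 2.
Proof. by move=> x0 y0; exact: mulr_ge0 (mulr_ge0 x0 y0) (sqr_ge0 z). Qed.

Lemma var_ge0 L p : is_law L -> 0 <= var L p.
Proof.
by move=> HL; have [a0 b0 c0 _] := HL p; rewrite (varE p HL) !addr_ge0 // mulr_sqr_ge0.
Qed.

(** The squared modulus is the characteristic function of the difference of two independent copies,
    which gives the pairwise shape of [varE] with 1 - cos in place of half a square. *)
Lemma normc_chf_sqr L p t : is_law L -> normc (chf L p t) ^+ 2 =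
  1 - 2 * (wa L p * wb L p * (1 - cos (t * (xa L p - xb L p))) +
           wa L p * wc L p * (1 - cos (t * (xa L p - xc L p))) +
           wb L p * wc L p * (1 - cos (t * (xb L p - xc L p)))).
Proof.
move=> HL; rewrite /chf /= sqr_sqrtr ?addr_ge0 ?sqr_ge0 // /avg !mulrBr !cosB.
have [_ _ _ h] := HL p.
rewrite [X in _ = X - 2 * _](_ : 1 = (wa L p + wb L p + wc L p) ^+ 2 :> R); last by rewrite h expr1n.
have := cos2Dsin2 (t * xa L p); have := cos2Dsin2 (t * xb L p); have := cos2Dsin2 (t * xc L p).
move: (cos _) (sin _) (cos _) (sin _) (cos _) (sin _) => C3 S3 C2 S2 C1 S1.
move=> h3 h2 h1; apply/eqP; rewrite -subr_eq0.
set A := wa L p; set B := wb L p; set C := wc L p.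
rewrite (_ : _ - _ = A ^+ 2 * (C3 ^+ 2 + S3 ^+ 2 - 1) + B ^+ 2 * (C2 ^+ 2 + S2 ^+ 2 - 1)
   + C ^+ 2 * (C1 ^+ 2 + S1 ^+ 2 - 1)); last by ring.
by rewrite h1 h2 h3 subrr !mulr0 !addr0.
Qed.

(** Only the pair [xa], [xb] is kept in [normc_chf_sqr]; 1 - cos x >= x^2/4 for |x| <= 1, and 1 - y
    <= exp(-y) makes the square root harmless. *)
Lemma normc_chf_le L p t (d := xa L p - xb L p) : is_law L -> `|t * d| <= 1 ->
  normc (chf L p t) <= expR (- (wa L p * wb L p * (t * d) ^+ 2 / 4)).
Proof.
move=> HL td; have [a0 b0 c0 _] := HL p.
rewrite -(@ler_sqr R) ?nnegrE ?normc_ge0 ?expR_ge0 // -expRM_natl (normc_chf_sqr p t HL).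
apply: le_trans (expR_ge1Dx _); have := one_sub_cos_ge td.
rewrite -/d; set x := (t * d) ^+ 2 => h.
have h1 : 0 <= wa L p * wc L p * (1 - cos (t * (xa L p - xc L p))).
  by rewrite !mulr_ge0 // subr_ge0 cos_le1.
have h2 : 0 <= wb L p * wc L p * (1 - cos (t * (xb L p - xc L p))).
  by rewrite !mulr_ge0 // subr_ge0 cos_le1.
have h3 := ler_wpM2l (mulr_ge0 a0 b0) h.
lra.
Qed.

(** The Gaussian factor gets the same majorant as the characteristic function, so that one [e]
    serves both in [EN_cos_gauss]. *)
Lemma expRN_var_le L p t (d := xa L p - xb L p) : is_law L ->
  expR (- (t ^+ 2 * var L p / 2)) <= expR (- (wa L p * wb L p * (t * d) ^+ 2 / 4)).
Proof.
move=> HL; have [a0 b0 c0 _] := HL p; rewrite ler_expR lerN2 (varE p HL) -/d.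
have h1 : 0 <= t ^+ 2 * (wa L p * wc L p * (xa L p - xc L p) ^+ 2).
  by rewrite mulr_ge0 ?sqr_ge0 // mulr_sqr_ge0.
have h2 : 0 <= t ^+ 2 * (wb L p * wc L p * (xb L p - xc L p) ^+ 2).
  by rewrite mulr_ge0 ?sqr_ge0 // mulr_sqr_ge0.
have h3 : 0 <= t ^+ 2 * (wa L p * wb L p * d ^+ 2) by rewrite mulr_ge0 ?sqr_ge0 // mulr_sqr_ge0.
rewrite exprMn; lra.
Qed.

Lemma avg_abs_le L p g : is_law L -> `|avg L p g| <= avg L p (fun x => `|g x|).
Proof.
move=> HL; have [a0 b0 c0 _] := HL p; rewrite /avg.
apply: le_trans (ler_normD _ _) _; rewrite !normrM (ger0_norm c0) lerD //.
by apply: le_trans (ler_normD _ _) _; rewrite !normrM (ger0_norm a0) (ger0_norm b0).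
Qed.

Definition spread L p (l : R) := [/\ `|xa L p - mean L p| <= l,
  `|xb L p - mean L p| <= l & `|xc L p - mean L p| <= l].

(* [l] bounds the deviations, so that [l * var] dominates the third absolute moment. *)
Lemma chf_gauss_le L p t l : is_law L -> spread L p l ->
  normc (chf L p t - cis (t * mean L p) * (expR (- (t ^+ 2 * var L p / 2)))%:C%C)
  <= 3 * (`|t| ^+ 3 * (l * var L p)).
Proof.
move=> HL [la lb lc]; have [a0 b0 c0 sum1] := HL p.
have l0 : 0 <= l := le_trans (normr_ge0 _) la.
set m := mean L p; set v := var L p; have v0 : 0 <= v := var_ge0 p HL.
pose C := avg L p (fun x => cos (t * (x - m))).
pose S := avg L p (fun x => sin (t * (x - m))).
set G := expR _.
(* Taking out the phase of the mean leaves centered values, so that the linear term of [S]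
   vanishes. *)
have -> : chf L p t - cis (t * m) * G%:C%C = cis (t * m) * ((C - G) +i* S)%C.
  have E x : t * x = t * m + t * (x - m) by ring.
  rewrite /chf /avg (E (xa L p)) (E (xb L p)) (E (xc L p)) !cosD !sinD.
  apply/eqP; rewrite eq_complex /C /S /avg /=.
  by apply/andP; split; apply/eqP; ring.
rewrite Normc.normcM normc_cis mul1r.
apply: le_trans (normc_le _) _ => /=.
have cube x : `|x - m| <= l -> `|t * (x - m)| ^+ 3 <= `|t| ^+ 3 * (l * (x - m) ^+ 2).
  move=> xl; rewrite normrM exprMn ler_wpM2l ?exprn_ge0 // exprS.
  by rewrite real_normK ?num_real // ler_wpM2r ?sqr_ge0.
have avg3 : avg L p (fun x => `|t * (x - m)| ^+ 3) <= `|t| ^+ 3 * (l * v).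
  rewrite /v /var -/m /avg.
  have := ler_wpM2l a0 (cube _ la); have := ler_wpM2l b0 (cube _ lb).
  have := ler_wpM2l c0 (cube _ lc); lra.
have t2 : t ^+ 2 = `|t| ^+ 2 by rewrite real_normK ?num_real.
have hC : `|C - (1 - t ^+ 2 * v / 2)| <= `|t| ^+ 3 * (l * v).
  have -> : C - (1 - t ^+ 2 * v / 2) =
     avg L p (fun x => cos (t * (x - m)) - 1 + (t * (x - m)) ^+ 2 / 2).
    have hc : wc L p = 1 - wa L p - wb L p by rewrite -sum1; ring.
    by rewrite /C /v /var -/m /avg hc; field.
  apply: le_trans (avg_abs_le _ _ HL) _; apply: le_trans avg3; rewrite /avg.
  by rewrite !lerD // ler_wpM2l // cos_taylor3.
have hS : `|S| <= `|t| ^+ 3 * (l * v).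
  have -> : S = avg L p (fun x => sin (t * (x - m)) - t * (x - m)).
    have : wa L p * (xa L p - m) + wb L p * (xb L p - m) + wc L p * (xc L p - m) = 0.
      rewrite (_ : _ + _ = mean L p - m * (wa L p + wb L p + wc L p)); last first.
        by rewrite /mean /avg /=; ring.
      by rewrite sum1 mulr1 subrr.
    move=> z; rewrite /S /avg; apply/eqP; rewrite -subr_eq0; apply/eqP.
    by transitivity (t * 0); [rewrite -z; ring | rewrite mulr0].
  apply: le_trans (avg_abs_le _ _ HL) _; apply: le_trans avg3; rewrite /avg.
  have H x : `|sin (t * (x - m)) - t * (x - m)| <= `|t * (x - m)| ^+ 3.
    apply: le_trans (sub_sin_le _) _; rewrite ler_pdivrMr // ler_peMr ?exprn_ge0 //; lra.
  by rewrite !lerD // ler_wpM2l // H.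
have vl : v <= l ^+ 2.
  have sq x : `|x - m| <= l -> (x - m) ^+ 2 <= l ^+ 2.
    by move=> xl; rewrite -[leLHS]real_normK ?num_real // lerXn2r ?nnegrE.
  rewrite /v /var -/m /avg -[leRHS]mul1r -sum1 2!mulrDl.
  by rewrite !lerD // ler_wpM2l // sq.
have hG : `|G - (1 - t ^+ 2 * v / 2)| <= `|t| ^+ 3 * (l * v).
  set x := t ^+ 2 * v / 2 in G *; have x0 : 0 <= x by rewrite divr_ge0 // mulr_ge0 ?sqr_ge0.
  have -> : G - (1 - x) = expR (- x) - 1 + x by rewrite /G; ring.
  rewrite ger0_norm ?expRN_taylor_ge0 //.
  have tl0 : 0 <= `|t| * l by rewrite mulr_ge0.
  have E : `|t| ^+ 3 * (l * v) = 2 * x * (`|t| * l) by rewrite /x t2; field.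
  (* If |t| l >= 1 the first-order bound x is enough; otherwise v <= l^2 gives x <= |t| l, and the
     second-order bound x^2 is enough. *)
  rewrite E; have [tl1|tl1] := lerP 1 (`|t| * l).
    apply: le_trans (expRN_taylor_le1 x0) _; nra.
  apply: le_trans (expRN_taylor_le2 x0) _.
  have xl : x <= (`|t| * l) ^+ 2 / 2.
    by rewrite /x t2 ler_wpM2r ?invr_ge0 // exprMn ler_wpM2l ?exprn_ge0.
  have : x <= `|t| * l by nra.
  nra.
have := ler_normB (C - (1 - t ^+ 2 * v / 2)) (G - (1 - t ^+ 2 * v / 2)).
rewrite (_ : C - (1 - t ^+ 2 * v / 2) - (G - (1 - t ^+ 2 * v / 2)) = C - G); last by ring.
lra.
Qed.

Lemma cis_sum s t (f : nat -> R) :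
  cis (t * \sum_(p <- s) f p) = \prod_(p <- s) cis (t * f p).
Proof.
elim: s => [|p s IH]; first by rewrite !big_nil mulr0 /cis cos0 sin0.
by rewrite !big_cons mulrDr cisD IH.
Qed.

Lemma expR_sum_var s t (f : nat -> R) :
  ((expR (- (t ^+ 2 * (\sum_(p <- s) f p) / 2)))%:C%C : R[i]) =
  \prod_(p <- s) (expR (- (t ^+ 2 * f p / 2)))%:C%C.
Proof.
elim: s => [|p s IH]; first by rewrite !big_nil mulr0 mul0r oppr0 expR0.
rewrite !big_cons -IH -rmorphM -expRD /=; congr (expR _)%:C%C; ring.
Qed.

Lemma normc_real (x : R) : 0 <= x -> normc (x%:C%C) = x.
Proof. by move=> x0; rewrite /= expr0n addr0 sqrtr_sqr ger0_norm. Qed.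

(** The first bound compares factor by factor and is efficient for moderate t; the second gives up
    all cancellation and is used for large t. *)
Lemma EN_cos_gauss L s t th (l e : nat -> R) : is_law L ->
  (forall p, spread L p (l p)) ->
  (forall p, normc (chf L p t) <= e p) ->
  (forall p, expR (- (t ^+ 2 * var L p / 2)) <= e p) ->
  (forall p, 1 <= 2 * e p) ->
  let D : R := `|EN L s (fun y => cos (t * y + th)) -
    expR (- (t ^+ 2 * (\sum_(p <- s) var L p) / 2)) *
      cos (t * (\sum_(p <- s) mean L p) + th)| in
  D <= 6 * (\prod_(p <- s) e p) * (`|t| ^+ 3 * \sum_(p <- s) l p * var L p)
  /\ D <= 2 * \prod_(p <- s) e p.
Proof.
move=> HL Hl He Hv He2 D.
pose b p : R[i] := cis (t * mean L p) * (expR (- (t ^+ 2 * var L p / 2)))%:C%C.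
have be p : normc (b p) <= e p.
  by rewrite /b Normc.normcM normc_cis mul1r normc_real ?expR_ge0.
have ED : D = `|complex.Re (cis th * (\prod_(p <- s) chf L p t - \prod_(p <- s) b p))|.
  have -> : \prod_(p <- s) b p = cis (t * \sum_(p <- s) mean L p) *
      (expR (- (t ^+ 2 * (\sum_(p <- s) var L p) / 2)))%:C%C.
    by rewrite cis_sum expR_sum_var -big_split.
  rewrite /D EN_cos; congr `|_|.
  rewrite cosD; set x := expR _; case: (\prod_(_ <- _) _) => u w /=; ring.
have : D <= normc (\prod_(p <- s) chf L p t - \prod_(p <- s) b p).
  by rewrite ED; apply: le_trans (abs_Re_le _) _; rewrite Normc.normcM normc_cis mul1r.
move=> H; split; apply: le_trans H _.
  apply: le_trans (normc_prod_sub _ He be He2) _.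
  have e0 : 0 <= \prod_(p <- s) e p by apply: prodr_ge0 => p _; have := He2 p; lra.
  rewrite (_ : 6 * _ * _ = 2 * \prod_(p <- s) e p *
     (3 * (`|t| ^+ 3 * \sum_(p <- s) l p * var L p))); last by ring.
  rewrite ler_wpM2l ?mulr_ge0 // mulr_sumr mulr_sumr.
  by apply: ler_sum => p _; exact: chf_gauss_le.
apply: le_trans (le_normcD _ _) _; rewrite normcN.
by have := normc_prod_le s He; have := normc_prod_le s be; lra.
Qed.

End Walk.

(** * The tilted Euler factors *)

Section EulerLaw.
Context {R : realType}.
Implicit Types (p : nat) (k r t : R).

Lemma cp3 : cp 3 = 0 :> R.
Proof.
rewrite /cp /legendre /=; case: existsP => [[x /eqP]|_]; last by rewrite subrr.
by case: x => [[|[|[|//]]]].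
Qed.

(** The bound p >= 5 matters: with the value 2 at p = 3 the weight [alphap] would vanish. It holds
    since -1 is not a square modulo 3. *)
Lemma cp_cases p : prime p -> p != 2 ->
  cp p = 0 :> R \/ (cp p = 2 :> R /\ (5 <= p)%N).
Proof.
move=> pp p2; have p1 := prime_gt1 pp.
have [->|p3] := eqVneq p 3; first by left; exact: cp3.
have p4 : p != 4 by apply: contraTneq pp => ->.
have p5 : (5 <= p)%N by lia.
rewrite /cp /legendre; case: ifP => [|_]; last first.
  by case: ifP => _; [right; split => // | left; rewrite /=; lra].
rewrite dvdzE /= dvdn1 => /eqP p1'; lia.
Qed.

Section OnePrime.
Variable p : nat.
Hypothesis pp : prime p.
Let u : R := p%:R^-1.

Lemma invp_bounds : 0 < u /\ u <= 2^-1.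
Proof.
rewrite /u; have p0 : 0 < p%:R :> R by rewrite ltr0n prime_gt0.
rewrite invr_gt0 p0; split => //.
by rewrite lef_pV2 ?posrE // ?ltr0n // ler_nat prime_gt1.
Qed.

Lemma weights_bounds : [/\ 5^-1 <= alphap p :> R, 4^-1 <= betap p :> R,
  0 <= gammap p :> R & `|alphap p - betap p| <= 2 * u].
Proof.
have [u0 u2] := invp_bounds; rewrite /gammap /alphap /betap.
have [_|p2] := eqVneq p 2%N.
  by rewrite subrr normr0; split; lra.
have -> : p%:R ^+ 2 = u ^- 2 by rewrite /u -exprVn invrK.
rewrite invrK -/u.
have [->|[-> p5]] := cp_cases pp p2.
  rewrite mul0r subr0 invr1; split; try lra.
  rewrite (_ : _ - _ = - u); last by field.
  by rewrite normrN ger0_norm; lra.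
have u5 : u <= 5^-1.
  by rewrite /u lef_pV2 ?posrE ?ltr0n ?ler_nat //; lia.
have q0 : 0 < 1 - 2 * u ^+ 2 by nra.
have q1 : 1 - 2 * u ^+ 2 <= 1 by nra.
have qi : 1 <= (1 - 2 * u ^+ 2)^-1 by rewrite invf_ge1.
have qm : (1 - 2 * u ^+ 2) * (1 - 2 * u ^+ 2)^-1 = 1 by rewrite divff // gt_eqF.
set q := (1 - 2 * u ^+ 2)^-1 in qi qm *.
have q2 : q <= 2 by nra.
split; try nra.
rewrite (_ : _ - _ = - (u * q)); last by field.
by rewrite normrN ger0_norm; nra.
Qed.

Let xp : R := - ln (1 - u).
Let xm : R := - ln (1 + u).

(** The sum of the two values is -ln (1 - u^2), of second order. With |alphap - betap| <= 2u this
    makes the mean of a factor O(u^2), although the values are of size u. *)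
Lemma values_bounds : [/\ u <= xp, xp <= 2 * u, - u <= xm, xm <= 0 &
  0 <= xp + xm <= 2 * u ^+ 2].
Proof.
have [u0 u2] := invp_bounds; rewrite /xp /xm.
have h1 := @le_ln1Dx R (- u) ltac:(lra).
have h2 := @le_ln1Dx R u ltac:(lra).
have inv_le (x : R) : 0 <= x -> x <= 2^-1 -> - ln (1 - x) <= 2 * x.
  move=> x0 x2; rewrite -lnV ?posrE; last lra.
  apply: le_trans (ln_le_sub1 _) _; first by rewrite invr_gt0; lra.
  have : (1 - x)^-1 <= 1 + 2 * x; last by lra.
  rewrite -[leLHS]mul1r ler_pdivrMr; nra.
split => //; try lra.
- by apply: inv_le; lra.
- by rewrite oppr_le0 ln_ge0; lra.
have -> : - ln (1 - u) - ln (1 + u) = - ln (1 - u ^+ 2).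
  by rewrite -opprD -lnM ?posrE; [congr (- ln _); ring | lra | lra].
apply/andP; split; first by rewrite oppr_ge0 ln_le0 //; nra.
by apply: inv_le; rewrite ?sqr_ge0 //; nra.
Qed.

End OnePrime.

(* Non-prime indices carry the unit mass at 0. *)
Definition euler_law : law (R := R) := Law
  (fun p => if prime p then alphap p else 0)
  (fun p => if prime p then betap p else 0)
  (fun p => if prime p then gammap p else 1)
  (fun p => if prime p then - ln (1 - p%:R^-1) else 0)
  (fun p => if prime p then - ln (1 + p%:R^-1) else 0)
  (fun=> 0).

Lemma euler_is_law : is_law euler_law.
Proof.
move=> p; rewrite /=; case: ifP => pp; last by split => //; lra.
have [a b c _] := weights_bounds pp; split => //; try lra.
by rewrite /gammap; lra.
Qed.

Lemma expR_le_quad (z : R) : expR z <= 1 + z + z ^+ 2 * expR `|z|.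
Proof.
have h : expR z - 1 <= z * expR z.
  have := expR_ge1Dx (- z); rewrite expRN => /(ler_wpM2l (expR_ge0 z)).
  rewrite divff ?gt_eqF ?expR_gt0 //; lra.
have h2 := expR_ge1Dx z.
have [z0|z0] := lerP 0 z.
  rewrite ger0_norm //; have := ler_wpM2l z0 h; rewrite expr2; lra.
have : 1 <= expR `|z| by rewrite -expR0 ler_expR.
have := sqr_ge0 z; set w := expR `|z|; rewrite expr2 => ??.
have : z * z <= z * z * w by rewrite ler_peMr.
nra.
Qed.

(** The term 6 |r| comes from the mean, at most 6/p^2 in absolute value, and the other from the
    quadratic remainder of exp for values of size at most 2/p. *)
Definition mgf_cst r : R := 6 * `|r| + 4 * r ^+ 2 * expR `|r|.

Lemma mgf_cst_ge0 r : 0 <= mgf_cst r.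
Proof.
apply: addr_ge0; first by rewrite mulr_ge0.
exact: mulr_ge0 (mulr_ge0 (ler0n _ 4) (sqr_ge0 r)) (expR_ge0 _).
Qed.

(** The exponent is summable over p only because the first-order terms cancel: the mean is (alphap -
    betap) x + betap (x + y), and both parts are O(p^-2). *)
Lemma euler_mgf_le p r : mgf euler_law p r <= expR (mgf_cst r * p%:R ^- 2).
Proof.
rewrite /mgf /avg /=; case: ifP => pp; last first.
  rewrite !mul0r !add0r mulr0 expR0 mulr1 -expR0 ler_expR.
  by rewrite mulr_ge0 ?mgf_cst_ge0 // invr_ge0 exprn_ge0.
rewrite mulr0 expR0 mulr1 -exprVn; set u := p%:R^-1.
have [u0 u2] := invp_bounds pp; rewrite -/u in u0 u2.
have [a b c ab] := weights_bounds pp; rewrite -/u in ab.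
have [h1 h2 h3 h4 h5] := values_bounds pp; rewrite -/u in h1 h2 h3 h4 h5.
set x := - ln (1 - u) in h1 h2 h3 h4 h5 *; set y := - ln (1 + u) in h1 h2 h3 h4 h5 *.
apply: le_trans (expR_ge1Dx _).
have ab1 : alphap p + betap p + gammap p = 1 :> R by rewrite /gammap; lra.
set al := alphap p in a ab ab1 *; set be := betap p in b ab ab1 *.
set ga := gammap p in c ab1 *.
clearbody al be ga x y u.
have quad z : `|z| <= 2 * u -> expR (r * z) <= 1 + r * z + 4 * r ^+ 2 * expR `|r| * u ^+ 2.
  move=> zu; apply: le_trans (expR_le_quad _) _; rewrite lerD2l.
  rewrite exprMn -[z ^+ 2]real_normK ?num_real //.
  have : `|z| ^+ 2 <= (2 * u) ^+ 2 by rewrite lerXn2r ?nnegrE //; lra.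
  have : expR `|r * z| <= expR `|r|.
    by rewrite ler_expR normrM ler_piMr //; lra.
  move=> e1 e2; have := ler_pM (sqr_ge0 _) (expR_ge0 _) e2 e1.
  move=> /(ler_wpM2l (sqr_ge0 r)); rewrite exprMn; lra.
have qx : `|x| <= 2 * u by rewrite ger0_norm; lra.
have qy : `|y| <= 2 * u by rewrite ler0_norm; lra.
have := ler_wpM2l (le_trans _ a) (quad x qx); move/(_ ltac:(lra)) => Ha.
have := ler_wpM2l (le_trans _ b) (quad y qy); move/(_ ltac:(lra)) => Hb.
have mean_le : `|al * x + be * y| <= 6 * u ^+ 2.
  rewrite (_ : _ + _ = (al - be) * x + be * (x + y)); last by ring.
  apply: le_trans (ler_normD _ _) _; rewrite !normrM.
  have := ler_pM (normr_ge0 _) (normr_ge0 _) ab qx.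
  rewrite (ger0_norm (_ : 0 <= be)) ?(ger0_norm (_ : 0 <= x + y)); try lra.
  nra.
have : r * (al * x + be * y) <= `|r| * (6 * u ^+ 2).
  by apply: le_trans (ler_norm _) _; rewrite normrM ler_wpM2l.
have : (al + be) * (4 * r ^+ 2 * expR `|r| * u ^+ 2) <= 1 * (4 * r ^+ 2 * expR `|r| * u ^+ 2).
  apply: ler_wpM2r; last lra.
  exact: mulr_ge0 (mulr_ge0 (mulr_ge0 (ler0n _ 4) (sqr_ge0 r)) (expR_ge0 _)) (sqr_ge0 u).
rewrite /mgf_cst; lra.
Qed.

Lemma prod_mgf_le (s : seq nat) r : \prod_(p <- s) mgf euler_law p r <=
  expR (mgf_cst r * \sum_(p <- s) p%:R ^- 2).
Proof.
rewrite mulr_sumr expR_sum; apply: ler_prod => p _.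
by rewrite euler_mgf_le ltW // mgf_gt0 //; exact: euler_is_law.
Qed.

Lemma sum_inv_sq_le a n : (0 < a)%N ->
  \sum_(p <- primes_in a n) p%:R ^- 2 <= 2 * a%:R^-1 :> R.
Proof.
move=> a0; rewrite big_filter big_mkcond /=.
apply: (@le_trans _ _ (\sum_(a <= i < n) (i%:R ^- 2 : R))).
  by apply: ler_sum => i _; case: ifP => // _; rewrite invr_ge0 exprn_ge0.
suff H : forall m, \sum_(a <= i < a + m) (i%:R ^- 2 : R) <= 2 * a%:R^-1 - 2 * (a + m)%:R^-1.
  have [an|na] := leqP a n; last by rewrite big_geq ?mulr_ge0 ?invr_ge0 // ltnW.
  by rewrite -(subnKC an); apply: le_trans (H _) _; rewrite gerBl mulr_ge0 ?invr_ge0.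
elim=> [|m IH]; first by rewrite addn0 big_geq // subrr.
rewrite addnS big_nat_recr ?leq_addr //=.
set b := (a + m)%N in IH *; have b1 : 1 <= b%:R :> R by rewrite ler1n /b; lia.
have h : b%:R ^- 2 <= 2 * b%:R^-1 - 2 * b.+1%:R^-1 :> R.
  rewrite -[b.+1%:R]natr1; set x : R := b%:R in b1 *.
  have -> : 2 * x^-1 - 2 * (x + 1)^-1 = 2 / (x * (x + 1)) by field; apply/andP; split; lra.
  have x0 : 0 < x by lra.
  by rewrite -[leLHS]mul1r ler_pdivrMr ?exprn_gt0 // mulrAC ler_pdivlMr ?mulr_gt0; nra.
by apply: le_trans (lerD IH h) _; rewrite addrA subrK.
Qed.

(** * Concentration and non-degeneracy of the tilted factors *)

Section Tilted.
Variable k : R.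
Hypothesis k1 : 1 <= k.
Let k0 : 0 < k. Proof. exact: lt_le_trans ltr01 k1. Qed.
Let Lk := tilt euler_law k.

Lemma tilted_is_law : is_law Lk.
Proof. exact/is_law_tilt/euler_is_law. Qed.

Section TiltedPrime.
Variable p : nat.
Hypothesis pp : prime p.
Let u : R := p%:R^-1.

Let Lkx : [/\ u <= xa Lk p, xa Lk p <= 2 * u, - u <= xb Lk p, xb Lk p <= 0 & xc Lk p = 0].
Proof.
by rewrite /Lk /= pp; have [? ? ? ? _] := values_bounds pp.
Qed.

Lemma tilted_spread : spread Lk p (3 * u).
Proof.
have [u0 u2] := invp_bounds pp; rewrite -/u in u0 u2.
have [h1 h2 h3 h4 h5] := Lkx; have [a b c s1] := tilted_is_law p.
rewrite /spread /mean /avg /=; rewrite /= in h1 h2 h3 h4 h5.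
set x := (if prime p then - ln (1 - _) else 0) in h1 h2 *.
set y := (if prime p then - ln (1 + _) else 0) in h3 h4 *.
rewrite /= in a b c s1.
set wa' := _ / _ in a s1 *; set wb' := _ / _ in b s1 *; set wc' := _ / _ in c s1 *.
have m1 : wa' * x + wb' * y + wc' * 0 <= 2 * u by nra.
have m2 : - u <= wa' * x + wb' * y + wc' * 0 by nra.
by split; rewrite ler_norml; apply/andP; split; lra.
Qed.

(** For p well below k the tilt concentrates the factor at X = 1: the weight left over is at most 1
    before normalization, and the normalizer is at least exp(k/p)/5. *)
Lemma tilted_wa_ge : 1 - wa Lk p <= 5 * expR (- (k / p%:R)).
Proof.
have [h1 h2 h3 h4 _] := values_bounds pp; have [u0 u2] := invp_bounds pp.
have [al be ga _] := weights_bounds pp.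
have M0 := mgf_gt0 p k euler_is_law.
have [_ _ _ s1] := euler_is_law p; rewrite /= pp in s1.
rewrite /Lk /=; have E : mgf euler_law p k =
    alphap p * expR (k * - ln (1 - p%:R^-1)) + betap p * expR (k * - ln (1 + p%:R^-1)) + gammap p.
  by rewrite /mgf /avg /= pp mulr0 expR0 mulr1.
rewrite E in M0 *; rewrite pp.
set x := - ln (1 - _) in h1 h2 M0 *; set y := - ln (1 + _) in h3 h4 M0 *.
have ey : expR (k * y) <= 1 by rewrite -expR0 ler_expR mulr_ge0_le0 // ltW.
have ex : expR (k / p%:R) <= expR (k * x) by rewrite ler_expR ler_wpM2l // ltW.
set X := expR (k * x) in M0 ex *; set Y := expR (k * y) in M0 ey *.
have Y0 : 0 <= Y by exact: expR_ge0.
have X0 : 0 < expR (k / p%:R) by exact: expR_gt0.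
set M := (_ + _ + _) in M0 *.
have MX : 5^-1 * expR (k / p%:R) <= M.
  have : 0 <= betap p * Y by rewrite mulr_ge0 //; lra.
  by rewrite /M; nra.
rewrite expRN.
have -> : 1 - alphap p * X / M = (betap p * Y + gammap p) / M by rewrite /M; field; rewrite gt_eqF.
rewrite ler_pdivrMr //.
have : betap p * Y + gammap p <= 1 by nra.
move=> /le_trans; apply.
rewrite mulrAC ler_pdivlMr // mul1r; lra.
Qed.

(** The variance is at most the second moment about the dominant value [xa], to which only the other
    two values contribute, each at distance at most 3u. *)
Lemma tilted_var_le : var Lk p <= 9 * u ^+ 2 * (1 - wa Lk p).
Proof.
have [u0 u2] := invp_bounds pp; rewrite -/u in u0 u2.
have [h1 h2 h3 h4 h5] := Lkx; have [a b c s1] := tilted_is_law p.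
have -> : var Lk p = wb Lk p * (xb Lk p - xa Lk p) ^+ 2 + wc Lk p * (xc Lk p - xa Lk p) ^+ 2
   - (mean Lk p - xa Lk p) ^+ 2.
  rewrite /var /mean /avg; have -> : wc Lk p = 1 - wa Lk p - wb Lk p by rewrite -s1; ring.
  by ring.
have sq x : - u <= x -> x <= 0 -> (x - xa Lk p) ^+ 2 <= 9 * u ^+ 2 by move=> *; nra.
have := sq _ h3 h4 => /(ler_wpM2l b) B.
have := sq _ _ _ => /(_ (xc Lk p)); rewrite h5 => /(_ ltac:(lra) (lexx 0)) /(ler_wpM2l c) C.
have := sqr_ge0 (mean Lk p - xa Lk p).
have -> : 1 - wa Lk p = wb Lk p + wc Lk p by rewrite -s1; ring.
lra.
Qed.

(** The product 9 * 5 * 6: 9 from [tilted_var_le], 5 from [tilted_wa_ge] and 6 from exp(-x) <= 6/x^3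
    at x = k/p. Likewise [third_cst] is 3 * 9 * 5 * 24, with exp(-x) <= 24/x^4. *)
Definition var_cst : R := 270.
Definition third_cst : R := 3240.

Lemma var_cst_ge0 : 0 <= var_cst. Proof. exact: ler0n. Qed.
Lemma third_cst_ge0 : 0 <= third_cst. Proof. exact: ler0n. Qed.

(** A majorant of the order of the variance profile near p = k, simple enough for its sum over
    primes to follow from Chebyshev's bounds: exp(-k/p) is traded for a power of p/k below k. *)
Definition var_weight : R := if (p%:R <= k) then p%:R / k ^+ 3 else p%:R ^- 2.

Lemma tilted_var_weight : var Lk p <= var_cst * var_weight.
Proof.
rewrite /var_cst.
have [u0 u2] := invp_bounds pp; rewrite -/u in u0 u2.
have p0 : 0 < p%:R :> R by rewrite ltr0n prime_gt0.
apply: le_trans tilted_var_le _.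
have [_ b c s1] := tilted_is_law p.
have q0 : 0 <= 9 * u ^+ 2 by rewrite mulr_ge0 ?sqr_ge0.
rewrite /var_weight; case: ifP => pk; last first.
  rewrite -exprVn -/u; have : 1 - wa Lk p <= 1 by have [] := tilted_is_law p; lra.
  move=> /(ler_wpM2l q0); lra.
have := tilted_wa_ge => /(ler_wpM2l q0) /le_trans; apply.
have x0 : 0 < k / p%:R by rewrite divr_gt0.
have : expR (- (k / p%:R)) <= 6 / (k / p%:R) ^+ 3.
  rewrite expRN -[leRHS]invrK lef_pV2 ?posrE ?expR_gt0 ?invr_gt0 ?divr_gt0 ?exprn_gt0 //.
  have := @expR_ge1Dxn R (k / p%:R) 2 (ltW x0).
  rewrite invfM invrK [6^-1 * _]mulrC (_ : 3`!%:R = 6 :> R) //; lra.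
move=> /(ler_wpM2l q0) h.
have -> : 270 * (p%:R / k ^+ 3) = 5 * (9 * u ^+ 2 * (6 / (k / p%:R) ^+ 3)).
  by rewrite /u; field; apply/andP; split; rewrite gt_eqF.
lra.
Qed.

Lemma tilted_third_weight : 3 * u * var Lk p <= third_cst / k * var_weight.
Proof.
rewrite /third_cst.
have [u0 u2] := invp_bounds pp; rewrite -/u in u0 u2.
have p0 : 0 < p%:R :> R by rewrite ltr0n prime_gt0.
have v0 := var_ge0 p tilted_is_law.
have [pk|pk] := lerP p%:R k; last first.
  have : u <= k^-1 by rewrite /u lef_pV2 ?posrE // ltW.
  have npk : (p%:R <= k) = false by apply/negbTE; rewrite -ltNge.
  have := tilted_var_weight; rewrite /var_cst /var_weight npk => h1 h2.
  have := ler_pM (ltW u0) v0 h2 h1.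
  have : 0 <= k^-1 * p%:R ^- 2 by rewrite mulr_ge0 ?invr_ge0 ?exprn_ge0 // ltW.
  lra.
rewrite /var_weight pk.
have := tilted_var_le => /(ler_wpM2l (ltW u0)).
have q0 : 0 <= u * (9 * u ^+ 2) by rewrite mulr_ge0 ?mulr_ge0 ?sqr_ge0 // ltW.
have := tilted_wa_ge => /(ler_wpM2l q0).
have x0 : 0 < k / p%:R by rewrite divr_gt0.
have : expR (- (k / p%:R)) <= 24 / (k / p%:R) ^+ 4.
  rewrite expRN -[leRHS]invrK lef_pV2 ?posrE ?expR_gt0 ?invr_gt0 ?divr_gt0 ?exprn_gt0 //.
  have := @expR_ge1Dxn R (k / p%:R) 3 (ltW x0).
  rewrite invfM invrK [24^-1 * _]mulrC (_ : 4`!%:R = 24 :> R) //; lra.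
move=> /(ler_wpM2l q0) h1 h2 h3.
have -> : 3240 / k * (p%:R / k ^+ 3) = 15 * (u * (9 * u ^+ 2) * (24 / (k / p%:R) ^+ 4)).
  by rewrite /u; field; apply/andP; split; rewrite gt_eqF.
rewrite mulrA in h3; lra.
Qed.

Definition ab_cst : R := expR (- 3) / 20.

Lemma ab_cst_gt0 : 0 < ab_cst. Proof. by rewrite divr_gt0 ?expR_gt0. Qed.

(** For p >= k the tilt changes the ratio of the two weights by a factor at most exp(3k/p) <= e^3,
    so both stay bounded below, by 1/5 and e^-3/4. *)
Lemma tilted_ab_ge : k <= p%:R -> ab_cst <= wa Lk p * wb Lk p.
Proof.
move=> kp; have [h1 h2 h3 h4 _] := values_bounds pp; have [u0 u2] := invp_bounds pp.
have [al be ga _] := weights_bounds pp.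
have M0 := mgf_gt0 p k euler_is_law.
have [_ _ _ s1] := euler_is_law p; rewrite /= pp in s1.
rewrite /Lk /=; have E : mgf euler_law p k =
    alphap p * expR (k * - ln (1 - p%:R^-1)) + betap p * expR (k * - ln (1 + p%:R^-1)) + gammap p.
  by rewrite /mgf /avg /= pp mulr0 expR0 mulr1.
rewrite E in M0 *; rewrite pp.
set x := - ln (1 - _) in h1 h2 M0 *; set y := - ln (1 + _) in h3 h4 M0 *.
have ey : expR (k * y) <= 1 by rewrite -expR0 ler_expR mulr_ge0_le0 // ltW.
have ex : 1 <= expR (k * x) by rewrite -expR0 ler_expR mulr_ge0 ?(ltW k0) //; lra.
have exy : expR (- 3) * expR (k * x) <= expR (k * y).
  have p0 : 0 < p%:R :> R by rewrite ltr0n prime_gt0.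
  have : k * p%:R^-1 <= 1 by rewrite ler_pdivrMr // mul1r.
  by rewrite -expRD ler_expR; nra.
set X := expR (k * x) in M0 ex exy *; set Y := expR (k * y) in M0 ey exy *.
set M := (_ + _ + _) in M0 *.
have MX : M <= X by rewrite /M; nra.
have e3 : 0 < expR (- 3) :> R by exact: expR_gt0.
have a1 : 5^-1 <= alphap p * X / M by rewrite ler_pdivlMr //; nra.
have b1 : expR (- 3) / 4 <= betap p * Y / M.
  rewrite ler_pdivlMr //; have := ler_wpM2l (ltW e3) MX.
  have := ler_wpM2r (expR_ge0 _ : 0 <= Y) be; lra.
rewrite /ab_cst; have := ler_pM _ _ a1 b1 => /(_ ltac:(lra) ltac:(lra)); lra.
Qed.

Lemma tilted_gap : u <= xa Lk p - xb Lk p /\ xa Lk p - xb Lk p <= 3 * u.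
Proof. have [? ? ? ? _] := Lkx; split; lra. Qed.

End TiltedPrime.

End Tilted.

End EulerLaw.

(** * The tilted characteristic function of a finite Euler product *)

Section CharacteristicFunction.
Context {R : realType}.
Implicit Types (p n N : nat) (k r t th : R).
Local Notation normc := (@Normc.normc R).
Local Notation c0 := (@ab_cst R).

Lemma normc_chf_le1 (L : law (R := R)) p t : is_law L -> normc (chf L p t) <= 1.
Proof.
move=> HL; have [a0 b0 c0 _] := HL p.
rewrite -(@ler_sqr R) ?nnegrE ?normc_ge0 // expr1n (normc_chf_sqr p t HL).
rewrite gerBl mulr_ge0 // !addr_ge0 // ?mulr_ge0 // subr_ge0 cos_le1 //.
Qed.

Lemma ln_gt0_ge48 k : 48 <= k -> 1 <= ln k.
Proof.
move=> k48; have := @ln2_ge_half R; have : ln (2 ^+ 2) <= ln k :> R.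
  by rewrite ler_ln ?posrE; nra.
rewrite lnXn // -mulr_natr; lra.
Qed.

Lemma sum_var_weight k N : 48 <= k ->
  \sum_(p <- primes_in 0 N) var_weight k p <= 74 / (k * ln k).
Proof.
move=> k48; have k0 : 0 < k by lra.
have lk := ln_gt0_ge48 k48; have lk0 : 0 < ln k by lra.
pose K := Num.trunc k; have /andP[Kk kK] := truncn_itv (ltW k0); rewrite -/K in Kk kK.
rewrite -natr1 in kK.
have K0 : (0 < K)%N by rewrite -(ltr0n R); lra.
have K0' : 0 < K%:R :> R by rewrite ltr0n.
have Kh : k <= 2 * K%:R by lra.
have lK : ln k <= 2 * ln (K%:R : R).
  rewrite (_ : 2 * _ = ln (K%:R ^+ 2)); last by rewrite lnXn // mulr_natl.
  by rewrite ler_ln ?posrE ?exprn_gt0 //; nra.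
have vw0 p : 0 <= var_weight k p.
  by rewrite /var_weight; case: ifP => _; rewrite ?divr_ge0 ?invr_ge0 ?exprn_ge0 // ltW.
apply: (@le_trans _ _ (\sum_(p <- primes_in 0 (maxn N K.+1)) var_weight k p)).
  by apply: le_sum_primes_in => //; rewrite leq_maxl.
rewrite (@primes_in_cat 0 K.+1) ?leq_maxr // big_cat /=.
have H1 : \sum_(p <- primes_in 0 K.+1) var_weight k p <= 10 / (k * ln k).
  rewrite (@eq_big_seq _ _ _ _ _ _ (fun p => p%:R / k ^+ 3)); last first.
    move=> p; rewrite mem_primes_in ltnS /= => /andP[_ pK].
    rewrite /var_weight ifT //; apply: le_trans Kk; by rewrite ler_nat.
  rewrite -mulr_suml ler_pdivrMr ?exprn_gt0 //.
  have := @sum_primes_le R K K0; set Q := \sum_(_ <- _) _ => H.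
  have Q0 : 0 <= Q by apply: sumr_ge0.
  have : Q * ln k <= 10 * k ^+ 2.
    apply: (@le_trans _ _ (2 * (Q * ln K%:R))); first nra.
    by apply: (@le_trans _ _ (2 * (5 * K%:R ^+ 2))); nra.
  rewrite -ler_pdivlMr // (_ : 10 / (k * ln k) * k ^+ 3 = 10 * k ^+ 2 / ln k) //.
  by field; rewrite !gt_eqF.
have H2 : \sum_(p <- primes_in K.+1 (maxn N K.+1)) var_weight k p <= 64 / (k * ln k).
  rewrite (@eq_big_seq _ _ _ _ _ _ (fun p => p%:R ^- 2)); last first.
    move=> p; rewrite mem_primes_in => /and3P[_ Kp _].
    rewrite /var_weight ifF //; apply/negbTE; rewrite -ltNge; apply: lt_le_trans kK _.
    by rewrite natr1 ler_nat.
  have := @sum_inv_sq_primes_le R K (maxn N K.+1) K0; set Q := \sum_(_ <- _) _ => H.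
  have Q0 : 0 <= Q by apply: sumr_ge0 => i _; rewrite invr_ge0 exprn_ge0.
  rewrite ler_pdivlMr ?mulr_gt0 //; rewrite ler_pdivlMr // in H.
  have QK := mulr_ge0 Q0 (ltW K0').
  apply: (@le_trans _ _ (4 * (Q * ln K%:R * K%:R))); last lra.
  have := ler_pM (ltW k0) (ltW lk0) Kh lK => /(ler_wpM2l Q0); lra.
apply: le_trans (lerD H1 H2) _; rewrite -mulrDl; lra.
Qed.

Definition varN k N : R := \sum_(p <- primes_in 0 N) var (tilt euler_law k) p.
Definition meanN k N : R := \sum_(p <- primes_in 0 N) mean (tilt euler_law k) p.

Lemma varN_le k N : 48 <= k -> varN k N <= var_cst * (74 / (k * ln k)).
Proof.
move=> k48; apply: le_trans (ler_wpM2l (@var_cst_ge0 R) (sum_var_weight N k48)).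
rewrite mulr_sumr /varN big_seq [leRHS]big_seq; apply: ler_sum => p.
by rewrite mem_primes_in => /andP[pp _]; apply: tilted_var_weight => //; lra.
Qed.

Lemma thirdN_le k N : 48 <= k ->
  \sum_(p <- primes_in 0 N) 3 * p%:R^-1 * var (tilt euler_law k) p <= third_cst * 74 / (k ^+ 2 * ln k).
Proof.
move=> k48; have k0 : 0 < k by lra.
rewrite (_ : third_cst * 74 / _ = third_cst / k * (74 / (k * ln k))); last first.
  by have := ln_gt0_ge48 k48 => ?; field; rewrite !gt_eqF //; lra.
apply: le_trans (ler_wpM2l _ (sum_var_weight N k48)); last by rewrite divr_ge0 ?third_cst_ge0 // ltW.
rewrite mulr_sumr big_seq [leRHS]big_seq; apply: ler_sum => p.
by rewrite mem_primes_in => /andP[pp _]; apply: tilted_third_weight => //; lra.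
Qed.

(** At least k/(2 ln k) primes lie between k and 96k, and each contributes at least [c0]/(96k)^2. N
    has to pass these primes, hence the threshold. *)
Lemma varN_ge k : 48 <= k -> exists N0, forall N, (N0 <= N)%N ->
  c0 / (96 ^+ 2 * 16) / (k * ln k) <= varN k N.
Proof.
move=> k48; have k0 : 0 < k by lra.
have lk := ln_gt0_ge48 k48; have lk0 : 0 < ln k by lra.
have [n [n1 n2]] := @count_primes_ge R k k48.
set B := primes_in _ _ => HB.
have n0' : (0 < n)%N by rewrite -(ltr0n R); lra.
exists (48 * n).+1 => N hN; have k1 : 1 <= k by lra.
have v0 p := var_ge0 p (tilted_is_law k).
have : \sum_(p <- B) var (tilt euler_law k) p <= varN k N.
  rewrite /varN (@primes_in_cat 0 n.+1 N); last by lia.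
  rewrite big_cat /= (@primes_in_cat n.+1 (48 * n).+1 N); last by lia.
  rewrite big_cat /= addrCA lerDl addr_ge0 // sumr_ge0 //.
apply: le_trans.
apply: (@le_trans _ _ (\sum_(p <- B) (c0 / (96 ^+ 2 * k ^+ 2)))).
  rewrite big_const_seq count_predT iter_addr_0 -[_ *+ size B]mulr_natr.
  rewrite (_ : c0 / (96 ^+ 2 * 16) / (k * ln k) = c0 / (96 ^+ 2 * k ^+ 2) * (k / (16 * ln k))); last first.
    by field; rewrite !gt_eqF.
  apply: ler_wpM2l.
    by rewrite divr_ge0 ?mulr_ge0 ?exprn_ge0 ?(ltW k0) // ltW // ab_cst_gt0.
  rewrite ler_pdivrMr ?mulr_gt0 //; have := ler0n R (size B); nra.
rewrite big_seq [leRHS]big_seq; apply: ler_sum => p; rewrite mem_primes_in => /and3P[pp np p48].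
have p0 : 0 < p%:R :> R by rewrite ltr0n prime_gt0.
have kp : k <= p%:R by apply: le_trans n1 _; rewrite ler_nat ltnW.
have ab := tilted_ab_ge k1 pp kp.
have [d1 d2] := tilted_gap k pp.
rewrite (varE p (tilted_is_law k)).
have [a0 b0 g0 _] := tilted_is_law k p.
rewrite -addrA; apply: ler_wpDr; first by rewrite addr_ge0 // mulr_sqr_ge0.
have p96 : p%:R <= 96 * k.
  apply: (@le_trans _ _ (48 * n)%:R); first by rewrite ler_nat -ltnS.
  rewrite natrM; lra.
have i0 : 0 < p%:R^-1 :> R by rewrite invr_gt0.
have i96 : (96 * k)^-1 <= p%:R^-1 by rewrite lef_pV2 ?posrE // mulr_gt0.
have -> : c0 / (96 ^+ 2 * k ^+ 2) = c0 * (96 * k)^-1 ^+ 2 by field; rewrite gt_eqF.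
have k96 : 0 <= (96 * k)^-1 by rewrite invr_ge0 mulr_ge0 // ltW.
apply: ler_pM => //; [exact/ltW/(@ab_cst_gt0 R) | by rewrite sqr_ge0 | ].
by rewrite lerXn2r ?nnegrE // ?(le_trans _ d1) ?(ltW i0) // (le_trans i96).
Qed.

(* The primes of size about [max k |t|] carry the decay in [t]. *)
Lemma charfun_decay k t (u : R := 48 * Num.max k `|t|) : 48 <= k ->
  exists N0, forall N, (N0 <= N)%N -> forall th,
  let D : R := `|EN (tilt euler_law k) (primes_in 0 N) (fun y => cos (t * y + th)) -
    expR (- (t ^+ 2 * varN k N / 2)) * cos (t * meanN k N + th)| in
  let E := expR (- (c0 / (8 * 96 ^+ 2) * (t ^+ 2 / (u * ln u)))) in
  D <= 6 * E * (`|t| ^+ 3 * (third_cst * 74 / (k ^+ 2 * ln k))) /\ D <= 2 * E.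
Proof.
move=> k48; have k0 : 0 < k by lra. have k1 : 1 <= k by lra.
(* This size of [u] makes every prime p >= u satisfy k <= p, as [tilted_ab_ge] requires, and 3|t|/p
   <= 1, as [normc_chf_le] requires. *)
have uk : 48 * k <= u by rewrite /u ler_wpM2l // le_max lexx.
have ut : 48 * `|t| <= u by rewrite /u ler_wpM2l // le_max lexx orbT.
clearbody u.
have u48 : 48 <= u by lra.
have u0 : 0 < u by lra.
have lu := ln_gt0_ge48 u48.
have [n [n1 n2]] := @count_primes_ge R u u48.
set B := primes_in _ _ => HB.
have n0' : (0 < n)%N by rewrite -(ltr0n R); lra.
have c00 := @ab_cst_gt0 R.
have n48 : (n.+1 <= (48 * n).+1)%N by rewrite ltnS leq_pmull.
exists (48 * n).+1 => N hN th D E; have nN := leq_trans n48 hN.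
(* A common lower bound for the exponents of [normc_chf_le] on the block: the product of weights is
   at least [c0] and the gap between the values is at least 1/p >= 1/(96u). *)
pose eta := c0 / 4 * (t ^+ 2 * (96 * u)^-1 ^+ 2).
have u96 : 0 <= (96 * u)^-1 by rewrite invr_ge0 mulr_ge0 // ltW.
have eta0 : 0 <= eta by rewrite mulr_ge0 ?divr_ge0 ?(ltW c00) // mulr_ge0 ?sqr_ge0.
have c01 : c0 <= 1.
  rewrite /ab_cst ler_pdivrMr // mul1r.
  have : expR (- 3) <= expR 0 :> R by rewrite ler_expR; lra.
  rewrite expR0; lra.
have t2u : t ^+ 2 * (96 * u)^-1 ^+ 2 <= 1.
  rewrite -[t ^+ 2]real_normK ?num_real // -exprMn expr_le1 ?mulr_ge0 //.
  by rewrite ler_pdivrMr ?mulr_gt0 //; clear -ut u0; have := normr_ge0 t; lra.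
have t2u0 : 0 <= t ^+ 2 * (96 * u)^-1 ^+ 2 by rewrite mulr_ge0 ?sqr_ge0.
have eta2 : eta <= 2^-1 by rewrite /eta; move: t2u t2u0 c00 c01; clear; move: (t ^+ 2 * _) c0 => x y; nra.
(* Primes outside the block get the trivial bound 1; [eta <= 1/2] keeps the others above the 1/2
   that [EN_cos_gauss] demands. *)
pose e p := if p \in B then expR (- eta) else 1.
have HL := tilted_is_law k.
have inB p : p \in B -> expR (- (wa (tilt euler_law k) p * wb (tilt euler_law k) p *
   (t * (xa (tilt euler_law k) p - xb (tilt euler_law k) p)) ^+ 2 / 4)) <= expR (- eta)
   /\ `|t * (xa (tilt euler_law k) p - xb (tilt euler_law k) p)| <= 1.
  rewrite mem_primes_in => /and3P[pp np p48].
  have p0 : 0 < p%:R :> R by rewrite ltr0n prime_gt0.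
  have up : u <= p%:R by apply: le_trans n1 _; rewrite ler_nat ltnW.
  have kp : k <= p%:R by apply: le_trans up; clear -uk k0; lra.
  have p96 : p%:R <= 96 * u.
    apply: (@le_trans _ _ (48 * n)%:R); first by rewrite ler_nat -ltnS.
    rewrite natrM; clear -n2; lra.
  have ab := tilted_ab_ge k1 pp kp.
  have [d1 d2] := tilted_gap k pp.
  set d := _ - _ in d1 d2 *.
  have i0 : 0 < p%:R^-1 :> R by rewrite invr_gt0.
  have d0 : 0 <= d by apply: le_trans d1; exact: ltW.
  have i96 : (96 * u)^-1 <= p%:R^-1 by rewrite lef_pV2 ?posrE // mulr_gt0.
  split.
    rewrite ler_expR lerN2 /eta mulrAC ler_pM2r //.
    have h : t ^+ 2 * (96 * u)^-1 ^+ 2 <= (t * d) ^+ 2.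
      rewrite exprMn ler_wpM2l ?sqr_ge0 // lerXn2r ?nnegrE //.
      exact: le_trans i96 d1.
    by rewrite [leLHS]mulrC mulrC; apply: ler_pM => //; exact: ltW.
  rewrite normrM (ger0_norm d0).
  apply: (@le_trans _ _ (`|t| * (3 * p%:R^-1))); first by rewrite ler_wpM2l.
  by rewrite mulrA ler_pdivrMr // mul1r; have := normr_ge0 t; clear -ut up; lra.
have He p : normc (chf (tilt euler_law k) p t) <= e p.
  rewrite /e; case: ifP => [/inB[h1 h2]|_]; last exact: normc_chf_le1.
  exact: le_trans (normc_chf_le HL h2) h1.
have Hv p : expR (- (t ^+ 2 * var (tilt euler_law k) p / 2)) <= e p.
  rewrite /e; case: ifP => [/inB[h1 h2]|_]; first exact: le_trans (expRN_var_le p t HL) h1.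
  by rewrite -expR0 ler_expR oppr_le0 divr_ge0 // mulr_ge0 ?sqr_ge0 // var_ge0.
have He2 p : 1 <= 2 * e p.
  rewrite /e; case: ifP => _; last by clear; lra.
  have := expR_ge1Dx (- eta); clearbody eta; clear -eta2; lra.
have Hs p : spread (tilt euler_law k) p (3 * p%:R^-1).
  have [pp|pp] := boolP (prime p); first exact: tilted_spread.
  rewrite /spread /mean /avg /= (negbTE pp) !mulr0 !addr0 subrr normr0.
  by split; rewrite mulr_ge0 // invr_ge0.
have := EN_cos_gauss (primes_in 0 N) th HL Hs He Hv He2.
have PE : \prod_(p <- primes_in 0 N) e p <= E.
  have e0 p : 0 <= e p by rewrite /e; case: ifP => _ //; exact: expR_ge0.
  have e1 p : e p <= 1 by rewrite /e; case: ifP => _ //; rewrite -expR0 ler_expR oppr_le0.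
  rewrite (@primes_in_cat 0 n.+1 N) ?nN //.
  rewrite big_cat /= (@primes_in_cat n.+1 (48 * n).+1 N) ?n48 //.
  rewrite big_cat /=.
  have pr1 s : 0 <= \prod_(p <- s) e p <= 1.
    by rewrite prodr_ge0 //= prodr_ile1 // => p _; rewrite e0 e1.
  have -> : \prod_(p <- primes_in n.+1 (48 * n).+1) e p = expR (- eta * (size B)%:R).
    rewrite (@eq_big_seq _ _ _ _ _ _ (fun=> expR (- eta))); last by move=> p; rewrite /e => ->.
    by rewrite big_const_seq count_predT -Monoid.iteropE -/(GRing.exp _ _) mulrC expRM_natl.
  have /andP[a0 a1] := pr1 (primes_in 0 n.+1).
  have /andP[b0 b1] := pr1 (primes_in (48 * n).+1 N).
  apply: (@le_trans _ _ (expR (- eta * (size B)%:R))).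
    rewrite mulrCA ler_piMr ?expR_ge0 // mulr_ile1 //.
  rewrite /E ler_expR mulNr lerN2.
  rewrite (_ : c0 / (8 * 96 ^+ 2) * _ = eta * (u / (2 * ln u))); last first.
    by rewrite /eta; field; rewrite !gt_eqF // (lt_le_trans ltr01).
  by apply: ler_wpM2l => //; rewrite ler_pdivrMr //; clear -HB lu; lra.
rewrite /= -/(varN k N) -/(meanN k N) -/D.
have E0 : 0 <= E by exact: expR_ge0.
move=> [h1 h2]; split; last by apply: le_trans h2 _; rewrite ler_wpM2l.
apply: le_trans h1 _; apply: ler_pM.
- by rewrite mulr_ge0 // prodr_ge0 // => p _; have := He2 p; move: (e p) => y hy; clear -hy; lra.
- rewrite mulr_ge0 ?exprn_ge0 // sumr_ge0 // => p _.
  by rewrite mulr_ge0 ?mulr_ge0 ?invr_ge0 // var_ge0.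
- by rewrite ler_wpM2l.
- by rewrite ler_wpM2l ?exprn_ge0 // thirdN_le.
Qed.

Definition scale k : R := Num.sqrt (k * ln k).

(** The range |t| <= k, rescaled by t = v S. The third-moment sum becomes |v|^3 S/k, and the
    Gaussian decay absorbs (1 + v^2)^3, that is, |v|^3, the denominator 1 + v^2 and some slack. *)
Lemma decay_near (c H k l S v E D : R) : 0 < c -> 0 <= H -> 0 < k -> 0 < l -> 0 < S ->
  S ^+ 2 = k * l -> 0 <= E -> E <= expR (- (c * v ^+ 2)) ->
  D <= 6 * E * (`|v * S| ^+ 3 * (H / (k ^+ 2 * l))) ->
  D <= 6 * H * (6 * expR c / c ^+ 3) * (S / k) / (1 + v ^+ 2).
Proof.
move=> cpos H0 k0 l0 S0 S2 E0 EE h1.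
have v20 := sqr_ge0 v; have v1 : 0 < 1 + v ^+ 2 by rewrite ltr_pwDl.
have Sk : 0 <= S / k by rewrite divr_ge0 // ltW.
have Q : (1 + v ^+ 2) ^+ 3 * expR (- (c * v ^+ 2)) <= 6 * expR c / c ^+ 3.
  have y0 : 0 <= c * (1 + v ^+ 2) by rewrite mulr_ge0 // ltW.
  have := @expR_ge1Dxn R _ 2 y0; rewrite (_ : 3`!%:R = 6 :> R) // => h.
  rewrite ler_pdivlMr ?exprn_gt0 //.
  have -> : expR c = expR (c * (1 + v ^+ 2)) * expR (- (c * v ^+ 2)).
    by rewrite -expRD; congr expR; ring.
  rewrite mulrAC mulrA ler_wpM2r ?expR_ge0 // -exprMn mulrC.
  move: h; move: (_ ^+ 3) (expR _) => x y; clear; lra.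
have tv : `|v * S| ^+ 3 / (k ^+ 2 * l) <= (1 + v ^+ 2) ^+ 2 * (S / k).
  rewrite normrM (ger0_norm (ltW S0)) exprMn.
  have -> : `|v| ^+ 3 * S ^+ 3 / (k ^+ 2 * l) = `|v| ^+ 3 * (S / k).
    have -> : k ^+ 2 * l = S ^+ 2 * k by rewrite S2; ring.
    by field; rewrite !gt_eqF.
  apply: ler_wpM2r => //; rewrite -[v ^+ 2]real_normK ?num_real //.
  have := normr_ge0 v; move: (`|v|) => w w0; clear -w0; nra.
apply: (le_trans h1); rewrite ler_pdivlMr //.
have -> : 6 * E * (`|v * S| ^+ 3 * (H / (k ^+ 2 * l))) * (1 + v ^+ 2) =
   6 * H * (`|v * S| ^+ 3 / (k ^+ 2 * l) * ((1 + v ^+ 2) * E)) by ring.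
rewrite -[leRHS]mulrA; apply: ler_wpM2l; first by rewrite mulr_ge0.
have := ler_wpM2r (mulr_ge0 (ltW v1) E0) tv => /le_trans; apply.
rewrite mulrAC [leLHS]mulrC [leRHS]mulrC; apply: ler_wpM2l => //.
by apply: le_trans Q; rewrite mulrA -exprSr; apply: ler_wpM2l => //; apply/exprn_ge0/ltW.
Qed.

(** The range |t| >= k, with z = sqrt t. The decay exp(-cz/2) makes E t^2 bounded; no Taylor
    comparison is needed since S^3/k >= 1 leaves room for the trivial bound D <= 2E. *)
Lemma decay_far (c k l S t z E D : R) : 0 < c -> 1 <= k -> 1 <= l -> l <= k -> 0 < S ->
  S ^+ 2 = k * l -> k <= t -> 0 < z -> z ^+ 2 = t -> E <= expR (- (c / 2 * z)) ->
  0 <= D -> D <= 2 * E ->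
  D <= 4 * (24 * 16 / c ^+ 4) * (S / k) / (1 + (t / S) ^+ 2).
Proof.
move=> cpos k1 l1 lk S0 S2 kt z0 z2 EE D0 h2.
have k0 : 0 < k by apply: lt_le_trans k1.
have v1 : 0 < 1 + (t / S) ^+ 2 by rewrite ltr_pwDl // sqr_ge0.
have C20 : 0 <= 24 * 16 / c ^+ 4 by rewrite divr_ge0 // ltW // exprn_gt0.
have E4 : E * t ^+ 2 <= 24 * 16 / c ^+ 4.
  have y0 : 0 <= c / 2 * z by rewrite mulr_ge0 ?divr_ge0 // ltW.
  have := @expR_ge1Dxn R _ 3 y0; rewrite (_ : 4`!%:R = 24 :> R) // => h.
  apply: (@le_trans _ _ (expR (- (c / 2 * z)) * t ^+ 2)).
    by rewrite ler_wpM2r ?sqr_ge0.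
  rewrite expRN mulrC ler_pdivrMr ?expR_gt0 // -z2.
  rewrite mulrAC ler_pdivlMr ?exprn_gt0 //.
  have -> : (z ^+ 2) ^+ 2 * c ^+ 4 = 16 * (c / 2 * z) ^+ 4 by field.
  move: h; move: (_ ^+ 4) (expR _) => x y; clear; lra.
have St : S ^+ 2 <= t ^+ 2 by rewrite S2; clear -k1 l1 lk kt; nra.
have vt : 1 + (t / S) ^+ 2 <= 2 * (t ^+ 2 / S ^+ 2).
  rewrite expr_div_n; have : 1 <= t ^+ 2 / S ^+ 2 by rewrite ler_pdivlMr ?exprn_gt0 // mul1r.
  move: (_ / _) => x; clear; lra.
have Sk : 1 <= S / k * S ^+ 2.
  have S48 : 1 <= S by rewrite -(@ler_pXn2r _ 2) ?nnegrE ?(ltW S0) // expr1n S2; clear -k1 l1; nra.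
  by rewrite S2 mulrA divfK ?gt_eqF // mulr_ege1.
rewrite ler_pdivlMr //.
apply: le_trans (ler_pM D0 (ltW v1) h2 vt) _.
have -> : 2 * E * (2 * (t ^+ 2 / S ^+ 2)) = 4 * (E * t ^+ 2) / S ^+ 2.
  by field; rewrite gt_eqF.
rewrite ler_pdivrMr ?exprn_gt0 // -mulrA.
apply: (@le_trans _ _ (4 * (24 * 16 / c ^+ 4))); first by rewrite ler_wpM2l.
rewrite (_ : 4 * (24 * 16 / c ^+ 4 * (S / k)) * S ^+ 2 = 4 * (24 * 16 / c ^+ 4) * (S / k * S ^+ 2)); last by rewrite !mulrA.
by rewrite ler_peMr // mulr_ge0.
Qed.

Lemma charfun_bound : exists2 C : R, 0 < C & forall k t, 48 <= k ->
  exists N0, forall N, (N0 <= N)%N -> forall th,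
  `|EN (tilt euler_law k) (primes_in 0 N) (fun y => cos (t * y + th)) -
    expR (- (t ^+ 2 * varN k N / 2)) * cos (t * meanN k N + th)|
  <= C * (scale k / k) / (1 + (t / scale k) ^+ 2).
Proof.
have [c cpos cE] : exists2 c : R, 0 < c & c0 / (8 * 96 ^+ 2) = 96 * c.
  exists (c0 / (8 * 96 ^+ 2) / 96); last by field.
  by rewrite !divr_gt0 ?ab_cst_gt0.
have [H H0 HE] : exists2 H : R, 0 <= H & third_cst * 74 = H.
  by exists (third_cst * 74) => //; rewrite mulr_ge0 // third_cst_ge0.
have C10 : 0 <= 6 * H * (6 * expR c / c ^+ 3).
  by rewrite !mulr_ge0 ?invr_ge0 ?exprn_ge0 ?expR_ge0 // ltW.
have C20 : 0 < 4 * (24 * 16 / c ^+ 4) by rewrite !mulr_gt0 ?invr_gt0 ?exprn_gt0.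
exists (6 * H * (6 * expR c / c ^+ 3) + 4 * (24 * 16 / c ^+ 4)); first exact: ltr_wpDl.
move=> k t k48; have [N0 HN] := charfun_decay t k48; exists N0 => N hN th.
have [] := HN N hN th; rewrite cE HE; set x := EN _ _ _ - _.
move: (`|x|) (normr_ge0 x) => D D0 h1 h2; clear x.
have k0 : 0 < k by clear -k48; lra.
have lk := ln_gt0_ge48 k48; have lk0 : 0 < ln k := lt_le_trans ltr01 lk.
have S0 : 0 < scale k by rewrite sqrtr_gt0 mulr_gt0.
have S2 : scale k ^+ 2 = k * ln k by rewrite sqr_sqrtr // ltW // mulr_gt0.
have Sk : 0 <= scale k / k by rewrite divr_ge0 // ltW.
have T0 : 0 <= scale k / k / (1 + (t / scale k) ^+ 2).
  by rewrite divr_ge0 // addr_ge0 // sqr_ge0.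
have ln48 (x : R) : 48 <= x -> 0 < ln (48 * x) /\ ln (48 * x) <= 2 * ln x.
  move=> x48; have x0 : 0 < x by clear -x48; lra.
  split; first by rewrite ln_gt0 //; clear -x48; lra.
  rewrite (_ : 2 * ln x = ln (x ^+ 2)); last by rewrite lnXn // mulr_natl.
  by rewrite ler_ln ?posrE ?mulr_gt0 ?exprn_gt0 // expr2 ler_wpM2r // ltW.
have [tk|kt] := lerP `|t| k; [apply: (@le_trans _ _ (6 * H * (6 * expR c / c ^+ 3) *
  (scale k / k) / (1 + (t / scale k) ^+ 2)))|apply: (@le_trans _ _ (4 * (24 * 16 / c ^+ 4) *
  (scale k / k) / (1 + (t / scale k) ^+ 2)))]; last 2 first.
- have kt' := ltW kt; have t48 : 48 <= `|t| := le_trans k48 kt'.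
  have t0 : 0 < `|t| := lt_trans k0 kt.
  have [u0 u2] := ln48 _ t48.
  have tS : (t / scale k) ^+ 2 = (`|t| / scale k) ^+ 2.
    by rewrite !expr_div_n real_normK ?num_real.
  pose z := Num.sqrt `|t|; have z0 : 0 < z by rewrite sqrtr_gt0.
  have z2 : z ^+ 2 = `|t| by rewrite sqr_sqrtr // ltW.
  rewrite tS; apply: (decay_far cpos _ lk _ S0 S2 kt' z0 z2 _ D0 h2); first by clear -k48; lra.
    by have := ln_le_sub1 k0; clear; lra.
  have lnt : ln `|t| <= 2 * z.
    by rewrite -z2 lnXn // -mulr_natl; have := ln_le_sub1 z0; clear; lra.
  rewrite max_r // ler_expR lerN2 -[t ^+ 2]real_normK ?num_real // -z2.
  move: u0 u2 lnt; rewrite -z2; move: (ln (z ^+ 2)) (ln _) => l lu u0 u2 lnt.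
  have -> : 96 * c * ((z ^+ 2) ^+ 2 / (48 * z ^+ 2 * lu)) = c * (2 * z ^+ 2 / lu).
    by field; rewrite !gt_eqF.
  rewrite -mulrA ler_wpM2l ?(ltW cpos) // ler_pdivlMr //.
  clear -u0 u2 lnt z0; nra.
- by rewrite -[leLHS]mulrA -[leRHS]mulrA ler_wpM2r // lerDr.
- have [u0 u2] := ln48 _ k48.
  rewrite max_l // in h1; rewrite (_ : `|t| = `|t / scale k * scale k|) in h1; last first.
    by rewrite divfK ?gt_eqF.
  apply: (decay_near cpos H0 k0 lk0 S0 S2 (expR_ge0 _) _ h1).
  rewrite ler_expR lerN2 expr_div_n S2.
  have -> : 96 * c * (t ^+ 2 / (48 * k * ln (48 * k))) = c * (2 * t ^+ 2 / (k * ln (48 * k))).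
    by field; rewrite !gt_eqF.
  rewrite ler_wpM2l ?(ltW cpos) // ler_pdivlMr ?mulr_gt0 //.
  have -> : t ^+ 2 / (k * ln k) * (k * ln (48 * k)) = t ^+ 2 * (ln (48 * k) / ln k).
    by field; rewrite !gt_eqF.
  by rewrite [leRHS]mulrC ler_wpM2l ?sqr_ge0 // ler_pdivrMr.
- by rewrite -[leLHS]mulrA -[leRHS]mulrA ler_wpM2r // lerDl ltW.
Qed.

End CharacteristicFunction.

(** * Fourier transform of the Gaussian *)

Section GaussianTransform.
Context {R : realType}.
Implicit Types (a x t v : R).
Notation mu := (@lebesgue_measure R).

(** Left unnormalized to play two roles: the characteristic function of the normal law of variance
    [a], and, with [a^-1], the shape of its density. *)
Definition gs a t : R := expR (- (a / 2 * t ^+ 2)).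

Lemma gs_ge0 a t : 0 <= gs a t. Proof. exact: expR_ge0. Qed.

Lemma gs_le1 a t : 0 <= a -> gs a t <= 1.
Proof.
move=> a0; rewrite -expR0 ler_expR oppr_le0.
by apply: mulr_ge0 (sqr_ge0 t); rewrite divr_ge0.
Qed.

Lemma is_derive_gs a t : is_derive t (1:R) (gs a) (- (a * t) * gs a t).
Proof.
have h := is_derive1_comp (is_derive_expR _) (is_deriveN (is_deriveM
  (is_derive_cst (a / 2 : R^o) t (1:R)) (is_deriveX 2 (is_derive_id (t : R^o) (1:R))))).
apply: (is_derive_eq h).
by rewrite /gs /GRing.scale /= !fctE /=; field.
Qed.

Lemma continuous_is_derive (f df : R -> R) :
  (forall x, is_derive x (1:R) f (df x)) -> continuous f.
Proof.
by move=> dH x; apply/differentiable_continuous/derivable1_diffP; have [] := dH x.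
Qed.

Lemma continuous_gs a : continuous (gs a).
Proof. exact: continuous_is_derive (is_derive_gs a). Qed.

Lemma measurable_gs a : measurable_fun [set: R] (gs a).
Proof. by apply: continuous_measurable_fun; exact: continuous_gs. Qed.

Lemma gs_normal a : 0 < a -> gs a = normal_fun 0 (Num.sqrt a)^-1.
Proof.
move=> a0; apply/funext => t; rewrite /gs /normal_fun subr0 exprVn sqr_sqrtr ?ltW //.
by congr expR; rewrite -mulr_natr; field; rewrite gt_eqF.
Qed.

Lemma integral_gs a : 0 < a ->
  mu.-integrable setT (EFin \o gs a) /\
  (\int[mu]_t (gs a t)%:E)%E = (Num.sqrt (2 * pi / a))%:E.
Proof.
move=> a0; pose s := (Num.sqrt a)^-1; have s0 : s != 0 by rewrite invr_eq0 gt_eqF // sqrtr_gt0.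
have p0 := normal_peak_gt0 s0.
have E : EFin \o gs a = (fun t => ((normal_peak s)^-1)%:E * (normal_pdf 0 s t)%:E)%E.
  apply/funext => t; rewrite /= normal_pdfE // gs_normal // -EFinM mulKf //.
  by rewrite gt_eqF.
split; first by rewrite E; apply: integrableZl => //; exact: integrable_normal_pdf.
rewrite -[LHS]/(\int[mu]_t ((EFin \o gs a) t))%E E integralZl //; last exact: integrable_normal_pdf.
rewrite integral_normal_pdf mule1 /normal_peak invrK; congr (Num.sqrt _)%:E.
by rewrite /s exprVn sqr_sqrtr ?ltW // -mulr_natr; field; rewrite gt_eqF.
Qed.

Lemma cvgn_integral_itv (f : R -> R) : mu.-integrable setT (EFin \o f) ->
  (\int[mu]_(x in `[(- n%:R)%R, n%:R]) (f x)%:E)%E @[n --> \oo] --> (\int[mu]_x (f x)%:E)%E.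
Proof.
move=> intf; have mf : measurable_fun setT (EFin \o f) by exact: measurable_int intf.
pose f_ (n : nat) (x : R) := ((f \_ `[- (n%:R : R), n%:R]) x)%:E.
rewrite [X in X @ _ --> _](_ : _ = fun n => (\int[mu]_x f_ n x)%E); last first.
  apply/funext => n; rewrite integral_mkcond; apply: eq_integral => x _.
  by rewrite /f_ /patch; case: ifP.
have := @dominated_convergence _ _ R mu setT measurableT f_ (EFin \o f) (fun x => `|(f x)%:E|)%E.
case => //.
- move=> n; apply/measurable_EFinP; apply/measurable_restrict => //.
  by rewrite setTI; apply: measurable_funTS; apply/measurable_EFinP.
- apply: aeW => x _; apply: cvg_near_cst.
  exists (Num.trunc `|x|).+1 => // n /= xn; rewrite /f_ patchE mem_set //= in_itv /=.
  rewrite -ler_norml; apply: le_trans (ltW (truncnS_gt _)) _.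
  by rewrite ler_nat.
- exact: integrable_abse.
- apply: aeW => x n _; rewrite /f_ patchE; case: ifP => // _.
  by rewrite /= normr0 lee_fin.
Qed.

(** The boundary-free case of integration by parts on the line: the fundamental theorem on [-n, n],
    then n tends to infinity. *)
Lemma integral_derive0 (H h : R -> R) : (forall x, is_derive x (1:R) H (h x)) ->
  continuous h -> mu.-integrable setT (EFin \o h) ->
  H n%:R @[n --> \oo] --> (0:R) -> H (- n%:R) @[n --> \oo] --> (0:R) ->
  (\int[mu]_x (h x)%:E)%E = 0%E.
Proof.
move=> dH ch ih H1 H2.
have C1 := cvgn_integral_itv ih.
suff C2 : (\int[mu]_(x in `[(- n%:R)%R, n%:R]) (h x)%:E)%E @[n --> \oo] --> 0%E.
  by rewrite -(cvg_lim (@ereal_hausdorff R) C1) (cvg_lim (@ereal_hausdorff R) C2).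
have : (H n.+1%:R - H (- n.+1%:R))%:E @[n --> \oo] --> (0 - 0 : R)%:E.
  apply: cvg_EFin; first exact: nearW.
  apply: cvgB.
    by rewrite (cvg_shiftS (fun n : nat => H n%:R)).
  by rewrite (cvg_shiftS (fun n : nat => H (- n%:R))).
rewrite subrr => H3; rewrite -cvg_shiftS.
rewrite [X in X @ _ --> _](_ : _ = fun n => (H n.+1%:R - H (- n.+1%:R))%:E) //.
apply/funext => n /=; rewrite (@continuous_FTC2 _ h H) //=.
- by rewrite -subr_gt0 opprK addr_gt0.
- exact: continuous_subspaceT.
- have dc : continuous H.
    exact: continuous_is_derive dH.
  split => [x _||]; first by have [] := dH x.
    exact/cvg_at_right_filter/dc.
  exact/cvg_at_left_filter/dc.
- by move=> x _; rewrite derive1E; have [] := dH x.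
Qed.

(** Half of the Gaussian decay pays for the factor |t|; this gives an integrable majorant for
    differentiation under the integral sign. *)
Lemma abs_le_gs a t : 0 < a -> `|t| * gs a t <= (1 + a^-1) * gs (a / 2) t.
Proof.
move=> a0; have -> : gs a t = gs (a / 2) t * gs (a / 2) t.
  by rewrite /gs -expRD; congr expR; field.
rewrite mulrA ler_wpM2r ?gs_ge0 // /gs expRN ler_pdivrMr ?expR_gt0 //.
have i0 : 0 < a^-1 by rewrite invr_gt0.
apply: (@le_trans _ _ ((1 + a^-1) * (1 + a / 2 / 2 * t ^+ 2))); last first.
  by apply: ler_wpM2l; rewrite ?addr_ge0 ?expR_ge1Dx // ltW.
have -> : (1 + a^-1) * (1 + a / 2 / 2 * t ^+ 2) =
   1 + a^-1 + a / 4 * t ^+ 2 + t ^+ 2 / 4 by field; rewrite gt_eqF.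
have -> : t ^+ 2 = `|t| ^+ 2 by rewrite real_normK ?num_real.
have := sqr_ge0 (`|t| / 2 - 1); rewrite sqrrB expr_div_n mulr1 expr1n -mulr_natr.
have : 0 <= a / 4 * `|t| ^+ 2 by rewrite mulr_ge0 ?exprn_ge0 // divr_ge0 // ltW.
lra.
Qed.

Lemma integrable_abs_gs a : 0 < a -> mu.-integrable setT (EFin \o (fun t => `|t| * gs a t)).
Proof.
move=> a0; have [ig _] := integral_gs (divr_gt0 a0 (ltr0n R 2)).
have ig2 : mu.-integrable setT (EFin \o (fun t => (1 + a^-1) * gs (a / 2) t)).
  by apply: eq_integrable (integrableZl measurableT (1 + a^-1) ig) => // t _ /=; rewrite EFinM.
apply: le_integrable ig2 => //.
  apply/measurable_EFinP; apply: measurable_funM; last exact: measurable_gs.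
  by apply: continuous_measurable_fun; exact: norm_continuous.
move=> t _ /=; rewrite lee_fin ger0_norm ?mulr_ge0 ?gs_ge0 //.
exact: le_trans (abs_le_gs t a0) (ler_norm _).
Qed.

Lemma integrable_le_gs a (f : R -> R) (c : R) : 0 < a -> measurable_fun setT f ->
  (forall t, `|f t| <= c * gs a t) -> mu.-integrable setT (EFin \o f).
Proof.
move=> a0 mf fg; have [ig _] := integral_gs a0.
have ig2 : mu.-integrable setT (EFin \o (fun t => c * gs a t)).
  by apply: eq_integrable (integrableZl measurableT c ig) => // t _ /=; rewrite EFinM.
apply: le_integrable ig2 => //; first exact/measurable_EFinP.
by move=> t _ /=; rewrite lee_fin; apply: le_trans (fg t) _; exact: ler_norm.
Qed.

Definition gsJ a x : R := \int[mu]_t (gs a t * cos (t * x)).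

Lemma is_derive_sin_scal x t : is_derive t (1:R) (fun t => sin (t * x)) (x * cos (t * x)).
Proof.
have h := is_derive1_comp (is_derive_sin _) (is_deriveM
  (is_derive_id (t : R^o) (1:R)) (is_derive_cst (x : R^o) t (1:R))).
apply: (is_derive_eq h).
by rewrite /GRing.scale /= ?fctE /=; ring.
Qed.

Lemma is_derive_cos_scal x t : is_derive x (1:R) (fun x => cos (t * x)) (- t * sin (t * x)).
Proof.
have h := is_derive1_comp (is_derive_cos _) (is_deriveM
  (is_derive_cst (t : R^o) x (1:R)) (is_derive_id (x : R^o) (1:R))).
apply: (is_derive_eq h).
by rewrite /GRing.scale /= ?fctE /=; ring.
Qed.

Lemma is_derive_gsJ0 a x : 0 < a ->
  is_derive x (1:R) (gsJ a) (\int[mu]_t (- t * gs a t * sin (t * x))).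
Proof.
move=> a0; pose f (x t : R) := gs a t * cos (t * x).
have df y t : is_derive y (1:R) (f ^~ t) (- t * gs a t * sin (t * y)).
  have h := is_deriveM (is_derive_cst (gs a t : R^o) y (1:R)) (is_derive_cos_scal y t).
  by apply: (is_derive_eq h); rewrite /GRing.scale /= ?fctE /=; ring.
have mcos y : measurable_fun setT (fun t : R => cos (t * y)).
  apply: continuous_measurable_fun.
  apply: (@continuous_is_derive _ (fun t => - y * sin (t * y))) => t.
  have h := @is_derive_cos_scal t y.
  by rewrite (_ : (fun t0 => cos (t0 * y)) = (fun t0 => cos (y * t0))) 1?(mulrC t);
    [exact: h | apply/funext => z; rewrite mulrC].
have intf y : mu.-integrable setT (EFin \o f y).
  apply: (@integrable_le_gs a _ 1) => //.
    by apply: measurable_funM => //; exact: measurable_gs.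
  move=> t; rewrite normrM mul1r ger0_norm ?gs_ge0 // ler_piMr ?gs_ge0 //.
  exact: cos_max.
have xI : `]x - 1, x + 1[%classic x by rewrite /= in_itv /= ltrBlDr ltrDl ltr01.
have intG := integrable_abs_gs a0.
have Gub y t : `]x - 1, x + 1[%classic y -> setT t -> `|partial1of2 f y t| <= `|t| * gs a t.
  move=> _ _; rewrite partial1of2E; have [_ ->] := df y t.
  rewrite !normrM normrN (ger0_norm (gs_ge0 a t)) ler_piMr ?mulr_ge0 ?gs_ge0 //.
  exact: sin_max.
have D1 := @derivable_under_integral R _ _ mu f setT measurableT x (x - 1) (x + 1) xI
  (fun y _ => intf y) (fun y t _ _ => let: DeriveDef d _ := df y t in d)
  _ (fun t => mulr_ge0 (normr_ge0 t) (gs_ge0 a t)) intG Gub.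
have D2 := @differentiation_under_integral R _ _ mu f setT measurableT x (x - 1) (x + 1) xI
  (fun y _ => intf y) (fun y t _ _ => let: DeriveDef d _ := df y t in d)
  _ (fun t => mulr_ge0 (normr_ge0 t) (gs_ge0 a t)) intG Gub.
apply: DeriveDef; first exact: D1.
rewrite -derive1E D2; apply: eq_Rintegral => t _; rewrite partial1of2E.
by have [_ ->] := df x t.
Qed.

Lemma gs_cvg0 a : 0 < a -> gs a n%:R @[n --> \oo] --> (0:R).
Proof.
move=> a0; rewrite -cvg_shiftS.
apply: (@squeeze_cvgr _ _ _ _ (fun=> 0) (fun n : nat => (2 / a) * n.+1%:R^-1)).
- apply: nearW => n; rewrite gs_ge0 /=.
  have n1 : 1 <= n.+1%:R :> R by rewrite ler1n.
  have n0 : 0 < n.+1%:R :> R by rewrite ltr0n.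
  rewrite /gs expRN -[leRHS]invrK lef_pV2 ?posrE ?expR_gt0 ?invr_gt0 ?mulr_gt0 ?invr_gt0 //.
  rewrite invfM invrK invf_div.
  apply: le_trans (expR_ge1Dx _); apply: (@le_trans _ _ (a / 2 * n.+1%:R ^+ 2)); last by rewrite lerDr.
  by rewrite ler_wpM2l ?divr_ge0 ?(ltW a0) // expr2 ler_peMl // ltW.
- exact: cvg_cst.
- rewrite -[X in _ --> X](mulr0 (2 / a)); apply: cvgM; first exact: cvg_cst.
  exact: cvg_harmonic.
Qed.

Lemma gsJ_by_parts a x : 0 < a ->
  \int[mu]_t (- t * gs a t * sin (t * x)) = - (x / a) * gsJ a x.
Proof.
move=> a0; pose H t := gs a t * (a^-1 * sin (t * x)).
pose h1 t := - t * gs a t * sin (t * x); pose h2 t := x / a * (gs a t * cos (t * x)).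
have dH t : is_derive t (1:R) H (h1 t + h2 t).
  have h := is_deriveM (is_derive_gs a t) (is_deriveM (is_derive_cst (a^-1 : R^o) t (1:R)) (is_derive_sin_scal x t)).
  by apply: (is_derive_eq h); rewrite /h1 /h2 /GRing.scale /= !fctE /=; field; rewrite gt_eqF.
have csin : continuous (fun t => sin (t * x)) by exact: continuous_is_derive (is_derive_sin_scal x).
have ccos : continuous (fun t => cos (t * x)).
  apply: (@continuous_is_derive _ (fun t => - x * sin (t * x))) => t.
  have h := @is_derive_cos_scal t x.
  by rewrite (_ : (fun t0 => cos (t0 * x)) = (fun t0 => cos (x * t0))) 1?(mulrC t);
    [exact: h | apply/funext => z; rewrite mulrC].
have c1 : continuous h1.
  move=> t; apply: cvgM; last exact: csin.
  apply: cvgM; last exact: continuous_gs.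
  by apply: cvgN; exact: cvg_id.
have c2 : continuous h2.
  move=> t; apply: cvgM; first exact: cvg_cst.
  by apply: cvgM; [exact: continuous_gs | exact: ccos].
have i1 : mu.-integrable setT (EFin \o h1).
  apply: le_integrable (integrable_abs_gs a0) => //.
    by apply/measurable_EFinP; exact: continuous_measurable_fun.
  move=> t _; rewrite /= lee_fin /h1 !normrM normrN (ger0_norm (gs_ge0 a t)) normr_id.
  by rewrite ler_piMr ?mulr_ge0 ?gs_ge0 // sin_max.
have i3 : mu.-integrable setT (EFin \o (fun t => gs a t * cos (t * x))).
  apply: (@integrable_le_gs a _ 1) => //.
    apply: measurable_funM; first exact: measurable_gs.
    exact: continuous_measurable_fun.
  move=> t; rewrite normrM mul1r ger0_norm ?gs_ge0 // ler_piMr ?gs_ge0 //.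
  exact: cos_max.
have i2 : mu.-integrable setT (EFin \o h2).
  by apply: eq_integrable (integrableZl measurableT (x / a) i3) => // t _ /=; rewrite EFinM.
have Hb t : `|H t| <= a^-1 * gs a t.
  have ai : 0 <= a^-1 by rewrite invr_ge0 ltW.
  rewrite /H !normrM (ger0_norm (gs_ge0 a t)) (ger0_norm ai) mulrCA.
  by rewrite ler_wpM2l // ler_piMr ?gs_ge0 ?sin_max.
have lim0 (f : nat -> R) : (forall n, `|f n| <= a^-1 * gs a n%:R) -> f n @[n --> \oo] --> (0:R).
  move=> fb; apply/norm_cvg0P.
  apply: (@squeeze_cvgr _ _ _ _ (fun=> 0) (fun n : nat => a^-1 * gs a n%:R)).
  - by apply: nearW => n; rewrite normr_ge0 fb.
  - exact: cvg_cst.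
  - by rewrite -[X in _ --> X](mulr0 a^-1); apply: cvgM; [exact: cvg_cst | exact: gs_cvg0].
have i12 : mu.-integrable setT (EFin \o (fun t => h1 t + h2 t)).
  by apply: eq_integrable (integrableD measurableT i1 i2) => // t _ /=; rewrite EFinD.
have := integral_derive0 dH _ i12 (lim0 _ _) (lim0 _ _).
move=> E; have : \int[mu]_t (h1 t + h2 t) = 0.
  rewrite /Rintegral E //.
  - by move=> t; apply: cvgD; [exact: c1 | exact: c2].
  - by move=> n; apply: le_trans (Hb _) _; rewrite /gs sqrrN.
rewrite RintegralD // RintegralZl // -/(gsJ a x) => /eqP; rewrite addr_eq0 => /eqP ->.
by rewrite mulNr.
Qed.

(** Differentiating under the integral and integrating by parts gives J' = -(x/a) J, so that J(x)
    exp(x^2/(2a)) has zero derivative; its value is read off at 0. *)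
Lemma gsJE a x : 0 < a -> gsJ a x = Num.sqrt (2 * pi / a) * gs a^-1 x.
Proof.
move=> a0; have J0 : gsJ a 0 = Num.sqrt (2 * pi / a).
  rewrite /gsJ; under eq_Rintegral do rewrite mulr0 cos0 mulr1.
  by rewrite /Rintegral (integral_gs a0).2.
have dQ y : is_derive y (1:R) (fun y => gsJ a y * gs (- a^-1) y) 0.
  have h := is_deriveM (is_derive_gsJ0 y a0) (is_derive_gs (- a^-1) y).
  apply: (is_derive_eq h); rewrite gsJ_by_parts // /GRing.scale /=.
  by ring.
have := is_derive_0_is_cst x 0 dQ; rewrite J0 /= /gs expr0n /= !mulr0 oppr0 expR0 mulr1 => <-.
by rewrite -[RHS]mulrA -expRD (_ : - _ + - _ = 0) ?expR0 ?mulr1 //; ring.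
Qed.

End GaussianTransform.

(** * A local limit theorem from a characteristic function bound *)

Section Rintegrals.
Context {R : realType} d (T : measurableType d) (m : {measure set T -> \bar R}).

Lemma RintE (f : T -> R) : m.-integrable setT (EFin \o f) ->
  (\int[m]_x (f x)%:E)%E = (\int[m]_x f x)%:E.
Proof. by move=> fi; rewrite /Rintegral fineK //; exact: integrable_fin_num. Qed.

Lemma integrable_bound (f g : T -> R) : measurable_fun setT f ->
  m.-integrable setT (EFin \o g) -> (forall x, `|f x| <= g x) ->
  m.-integrable setT (EFin \o f).
Proof.
move=> mf ig fg; apply: le_integrable ig => //; first exact/measurable_EFinP.
by move=> x _ /=; rewrite lee_fin; apply: le_trans (fg x) (ler_norm _).
Qed.

Lemma integrable_scale (c : R) (f : T -> R) : m.-integrable setT (EFin \o f) ->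
  m.-integrable setT (EFin \o (fun x => c * f x)).
Proof.
by move=> fi; apply: eq_integrable (integrableZl measurableT c fi) => // x _ /=; rewrite EFinM.
Qed.

Lemma integrable_sub (f g : T -> R) : m.-integrable setT (EFin \o f) ->
  m.-integrable setT (EFin \o g) -> m.-integrable setT (EFin \o (fun x => f x - g x)).
Proof.
by move=> fi gi; apply: eq_integrable (integrableB measurableT fi gi) => // x _ /=; rewrite EFinB.
Qed.

Lemma integrable_add (f g : T -> R) : m.-integrable setT (EFin \o f) ->
  m.-integrable setT (EFin \o g) -> m.-integrable setT (EFin \o (fun x => f x + g x)).
Proof.
by move=> fi gi; apply: eq_integrable (integrableD measurableT fi gi) => // x _ /=; rewrite EFinD.
Qed.

Lemma abs_Rintegral_le (f g : T -> R) : m.-integrable setT (EFin \o f) ->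
  m.-integrable setT (EFin \o g) -> (forall x, `|f x| <= g x) ->
  `|\int[m]_x f x| <= \int[m]_x g x.
Proof.
move=> fi gi fg; apply: le_trans (le_normr_Rintegral measurableT fi) _.
apply: le_Rintegral => //.
by apply: eq_integrable (integrable_abse fi).
Qed.

End Rintegrals.

Section FubiniReal.
Context {R : realType} d (T : measurableType d) (P : probability T R).
Notation mu := (@lebesgue_measure R).

(** The product majorant W(w) g(t) is integrable on the product space, which makes both iterated
    integrals meaningful. *)
Lemma fubini_dominated (f : T -> R -> R) (W : T -> R) (g : R -> R) :
  measurable_fun setT (fun z : T * R => f z.1 z.2) ->
  P.-integrable setT (EFin \o W) -> mu.-integrable setT (EFin \o g) ->
  (forall w t, `|f w t| <= W w * g t) ->
  [/\ P.-integrable setT (EFin \o (fun w => \int[mu]_t f w t)),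
      mu.-integrable setT (EFin \o (fun t => \int[P]_w f w t)) &
      \int[P]_w (\int[mu]_t f w t) = \int[mu]_t (\int[P]_w f w t)].
Proof.
move=> mf iW ig fWg.
have mf1 w : measurable_fun setT (f w).
  exact: (measurableT_comp mf (measurable_pair1 w)).
have mf2 t : measurable_fun setT (f ^~ t).
  exact: (measurableT_comp mf (measurable_pair2 t)).
have i1 w : mu.-integrable setT (EFin \o f w).
  apply: (@integrable_bound _ _ _ mu _ (fun t => W w * g t)); [exact: mf1 | exact: integrable_scale | exact: fWg].
have i2 t : P.-integrable setT (EFin \o f ^~ t).
  apply: (@integrable_bound _ _ _ P _ (fun w => g t * W w)) => //; first exact: integrable_scale.
  by move=> w; rewrite mulrC.
pose F (z : T * R) := (f z.1 z.2)%:E.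
have mF : measurable_fun setT F by exact/measurable_EFinP.
have iF : (P \x mu)%E.-integrable setT F.
  apply/integrable12ltyP => //.
  apply: (@le_lt_trans _ _ (\int[P]_w (`|W w|%:E * (\int[mu]_t `|g t|%:E))))%E.
    have ig' : mu.-integrable setT (EFin \o (fun t => `|g t|)) by exact: integrable_abse ig.
    have iW' : P.-integrable setT (EFin \o (fun t => `|W t|)) by exact: integrable_abse iW.
    apply: ge0_le_integral => //.
    - by move=> w _; exact: integral_ge0.
    - apply: (@measurable_fun_fubini_tonelli_F _ _ T _ R mu (abse \o F)) => //.
        exact: measurableT_comp.
      by move=> x; exact: abse_ge0.
    - have -> : (\int[mu]_t `|g t|%:E)%E = (\int[mu]_t `|g t|)%:E by exact: RintE ig'.
      apply/measurable_EFinP; apply: measurable_funM => //.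
      by have /measurable_int/measurable_EFinP := iW'.
    - move=> w _; rewrite -integralZl //.
      apply: ge0_le_integral => //.
      + exact: measurable_int (integrable_abse (i1 w)).
      + exact: measurable_int (integrableZl measurableT `|W w| ig').
      + move=> t _; rewrite /F /= lee_fin; apply: le_trans (fWg w t) _.
        by rewrite -normrM ler_norm.
  have -> : (\int[mu]_t `|g t|%:E)%E = (\int[mu]_t `|g t|)%:E by exact: RintE (integrable_abse ig).
  rewrite integralZr //; last exact: integrable_abse iW.
  have -> : (\int[P]_w `|W w|%:E)%E = (\int[P]_w `|W w|)%:E by exact: RintE (integrable_abse iW).
  by rewrite -EFinM ltry.
have e1 w : fubini_F mu F w = (\int[mu]_t f w t)%:E by exact: RintE (i1 w).
have e2 t : fubini_G P F t = (\int[P]_w f w t)%:E by exact: RintE (i2 t).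
split.
- by apply: eq_integrable (integrable_fubini_F iF) => // w _; rewrite e1.
- apply: (@integrable_bound _ _ _ mu _ (fun t => (\int[P]_w W w) * g t)).
  + apply/measurable_EFinP.
    by apply: eq_measurable_fun (measurable_fubini_G iF) => t _; exact: e2.
  + exact: integrable_scale.
  + move=> t; rewrite -RintegralZr //; apply: abs_Rintegral_le => //.
    by apply: eq_integrable (integrable_scale (g t) iW) => // w _ /=; rewrite mulrC.
- have := Fubini iF; rewrite /Rintegral => E.
  have -> : (\int[P]_w (\int[mu]_t f w t)%:E)%E = (\int[P]_w \int[mu]_t F (w, t))%E.
    by apply: eq_integral => w _; rewrite -e1.
  rewrite E; congr fine; apply: eq_integral => t _; rewrite -e2 //.
Qed.

End FubiniReal.

Section LocalLimit.
Context {R : realType} d (T : measurableType d) (P : probability T R).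
Notation mu := (@lebesgue_measure R).
Implicit Types (a t v x y z : R).

Definition gauss_pdf v y : R := (Num.sqrt (2 * pi * v))^-1 * gs v^-1 y.

Lemma gauss_pdf_ge0 v y : 0 <= gauss_pdf v y.
Proof. by rewrite mulr_ge0 ?gs_ge0 // invr_ge0 sqrtr_ge0. Qed.

Lemma gauss_pdf_le v y : 0 < v -> gauss_pdf v y <= (Num.sqrt (2 * pi * v))^-1.
Proof.
by move=> v0; rewrite ler_piMr ?invr_ge0 ?sqrtr_ge0 // gs_le1 // invr_ge0 ltW.
Qed.

(** Fourier inversion for the normal density, the only instance of inversion that the argument
    uses. *)
Lemma gauss_pdf_gsJ v y : 0 < v -> gauss_pdf v y = (2 * pi)^-1 * gsJ v y.
Proof.
move=> v0; rewrite gsJE // mulrA /gauss_pdf; congr (_ * _).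
have p0 : 0 < 2 * pi :> R by rewrite mulr_gt0 ?pi_gt0.
move: (2 * pi) p0 => q p0; rewrite !sqrtrM ?ltW // sqrtrV ?ltW //.
rewrite -[in X in _ = X * _](sqr_sqrtr (ltW p0)).
by field; rewrite !gt_eqF ?sqrtr_gt0.
Qed.

Lemma continuous_gauss_pdf v : continuous (gauss_pdf v).
Proof. by move=> y; apply: cvgM; [exact: cvg_cst | exact: continuous_gs]. Qed.

Lemma measurable_gauss_pdf v : measurable_fun setT (gauss_pdf v).
Proof. apply: continuous_measurable_fun; exact: continuous_gauss_pdf. Qed.

Lemma integral_gauss_pdf v z : 0 < v ->
  mu.-integrable setT (EFin \o (fun x => gauss_pdf v (z - x))) /\ \int[mu]_x gauss_pdf v (z - x) = 1.
Proof.
move=> v0; have E : (fun x => gauss_pdf v (z - x)) = normal_pdf z (Num.sqrt v).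
  apply/funext => x; rewrite normal_pdfE ?gt_eqF ?sqrtr_gt0 // /normal_pdf /gauss_pdf /gs.
  rewrite /normal_peak /normal_fun sqr_sqrtr ?ltW //; congr (_^-1 * expR _).
    by congr Num.sqrt; rewrite -mulr_natl; ring.
  by rewrite -mulr_natl; field; rewrite gt_eqF.
rewrite E; split; first exact: integrable_normal_pdf.
by rewrite /Rintegral integral_normal_pdf.
Qed.

(** The factor |y| is traded for a doubled variance, so that first absolute moments cost O(sqrt
    v). *)
Lemma abs_gauss_pdf_le v y : 0 < v -> `|y| * gauss_pdf v y <= 2 * Num.sqrt v * gauss_pdf (2 * v) y.
Proof.
move=> v0; set s := Num.sqrt v; have s0 : 0 < s by rewrite sqrtr_gt0.
have s2 : s ^+ 2 = v by rewrite sqr_sqrtr // ltW.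
rewrite /gauss_pdf.
have -> : gs v^-1 y = gs (2 * v)^-1 y * gs (2 * v)^-1 y.
  by rewrite /gs -expRD; congr expR; field; rewrite gt_eqF.
have h : `|y| * gs (2 * v)^-1 y <= Num.sqrt 2 * s.
  rewrite /gs expRN ler_pdivrMr ?expR_gt0 //.
  set r := Num.sqrt 2; have r0 : 0 < r :> R by rewrite sqrtr_gt0.
  have r2 : r ^+ 2 = 2 by rewrite sqr_sqrtr.
  have -> : (2 * v)^-1 / 2 * y ^+ 2 = (`|y| / (r * s)) ^+ 2 / 2.
    rewrite expr_div_n exprMn r2 s2 real_normK ?num_real //.
    by field; rewrite gt_eqF.
  rewrite -ler_pdivrMl ?mulr_gt0 // mulrC.
  set q := _ / _; apply: le_trans (expR_ge1Dx _).
  have := sqr_ge0 (q - 1); rewrite sqrrB mulr1 expr1n -mulr_natr; lra.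
have -> : (Num.sqrt (2 * pi * (2 * v)))^-1 = (Num.sqrt (2 * pi * v))^-1 / Num.sqrt 2.
  rewrite -invfM -sqrtrM ?mulr_ge0 ?pi_ge0 ?ltW //; congr (Num.sqrt _)^-1; ring.
set c := (Num.sqrt _)^-1; have c0 : 0 <= c by rewrite invr_ge0 sqrtr_ge0.
have r0 : 0 < Num.sqrt 2 :> R by rewrite sqrtr_gt0.
have r2 : Num.sqrt 2 ^+ 2 = 2 :> R by rewrite sqr_sqrtr.
have -> : 2 * s * (c / Num.sqrt 2 * gs (2 * v)^-1 y) = (Num.sqrt 2 * s) * (c * gs (2 * v)^-1 y).
  by rewrite -[X in X * s]r2; field; rewrite gt_eqF.
have -> : `|y| * (c * (gs (2 * v)^-1 y * gs (2 * v)^-1 y)) =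
   `|y| * gs (2 * v)^-1 y * (c * gs (2 * v)^-1 y) by ring.
by rewrite ler_wpM2r // mulr_ge0 ?gs_ge0.
Qed.

(** In the application [W] is the density exp(kY)/E(exp(kY)) of the tilted law, [Z] the centered Y,
    [s2] its tilted variance, and [B] a Cauchy-shaped majorant. *)
Variables (W Z : T -> R) (s2 eps : R) (B : R -> R).
Hypothesis mZ : measurable_fun setT Z.
Hypothesis W0 : forall w, 0 <= W w.
Hypothesis iW : P.-integrable setT (EFin \o W).
Hypothesis W1 : \int[P]_w W w = 1.
Hypothesis s20 : 0 < s2.
Hypothesis iB : mu.-integrable setT (EFin \o B).
Hypothesis Beps : \int[mu]_t B t <= 2 * pi * eps.
Hypothesis char_close : forall t th,
  `|\int[P]_w (W w * cos (t * Z w + th)) - gs s2 t * cos th| <= B t.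

Let mW : measurable_fun setT W.
Proof. by have /measurable_int/measurable_EFinP := iW. Qed.

Lemma integrable_W (f : T -> R) (c : R) : measurable_fun setT f ->
  (forall w, `|f w| <= c) -> P.-integrable setT (EFin \o (fun w => W w * f w)).
Proof.
move=> mf fc; apply: integrable_bound (integrable_scale c iW) _ => //.
  exact: measurable_funM.
by move=> w; rewrite normrM (ger0_norm (W0 w)) mulrC ler_wpM2r.
Qed.

Lemma eps_ge0 : 0 <= eps.
Proof.
have B0 t : 0 <= B t by apply: le_trans (normr_ge0 _) (char_close t 0).
have : 0 <= \int[mu]_t B t by apply: Rintegral_ge0.
have p0 : 0 < 2 * pi :> R by rewrite mulr_gt0 ?pi_gt0.
by move=> h; have := le_trans h Beps; rewrite pmulr_rge0.
Qed.

(** The smoothed law has characteristic function that of Z times [gs v], and the latter makes Fubini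
    legitimate. As [gs v <= 1], the error is at most the integral of [B] over 2 pi, uniformly in v
    and x. *)
Lemma smoothed_density v x : 0 < v ->
  `|\int[P]_w (W w * gauss_pdf v (Z w - x)) - gauss_pdf (s2 + v) x| <= eps.
Proof.
move=> v0; have p0 : 0 < 2 * pi :> R by rewrite mulr_gt0 ?pi_gt0.
pose f w t := W w * (gs v t * cos (t * (Z w - x))).
have mcos : measurable_fun setT (fun z : T * R => cos (z.2 * (Z z.1 - x))).
  apply: measurableT_comp; first by apply: continuous_measurable_fun; exact: continuous_cos.
  apply: measurable_funM => //; apply: measurable_funB => //.
  by apply: measurableT_comp.
have mf : measurable_fun setT (fun z : T * R => f z.1 z.2).
  apply: measurable_funM; first exact: measurableT_comp.
  apply: measurable_funM => //.
  by apply: measurableT_comp; first exact: measurable_gs.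
have fb w t : `|f w t| <= W w * gs v t.
  rewrite /f !normrM (ger0_norm (W0 w)) (ger0_norm (gs_ge0 v t)).
  by rewrite ler_wpM2l // ler_piMr ?gs_ge0 // cos_max.
have [ig _] := integral_gs v0.
have [_ i2 E] := fubini_dominated mf iW ig fb.
have icos u y : 0 < u -> mu.-integrable setT (EFin \o (fun t => gs u t * cos (t * y))).
  move=> u0; apply: (@integrable_le_gs _ u _ 1) => //.
    apply: measurable_funM; first exact: measurable_gs.
    apply: measurableT_comp; first by apply: continuous_measurable_fun; exact: continuous_cos.
    exact: measurable_funM.
  by move=> t; rewrite normrM mul1r (ger0_norm (gs_ge0 u t)) ler_piMr ?gs_ge0 // cos_max.
have sv0 : 0 < s2 + v by rewrite addr_gt0.
have -> : \int[P]_w (W w * gauss_pdf v (Z w - x)) = (2 * pi)^-1 * \int[mu]_t (\int[P]_w f w t).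
  rewrite -E -RintegralZl //; last by have [] := fubini_dominated mf iW ig fb.
  apply: eq_Rintegral => w _; rewrite gauss_pdf_gsJ // /f RintegralZl //; last exact: icos.
  by rewrite -/(gsJ v (Z w - x)); ring.
rewrite gauss_pdf_gsJ // -mulrBr normrM ger0_norm ?invr_ge0 ?(ltW p0) // ler_pdivrMl //.
rewrite -RintegralB //; last exact: icos.
apply: le_trans Beps; apply: abs_Rintegral_le => //.
  by apply: integrable_sub => //; exact: icos.
move=> t.
have -> : \int[P]_w f w t = gs v t * \int[P]_w (W w * cos (t * Z w + - (t * x))).
  rewrite -RintegralZl //.
    by apply: eq_Rintegral => w _; rewrite /f mulrBr; ring.
  apply: (@integrable_W _ 1) => [|w]; last exact: cos_max.
  apply: measurableT_comp; first by apply: continuous_measurable_fun; exact: continuous_cos.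
  by apply: measurable_funD => //; exact: measurable_funM.
have -> : gs (s2 + v) t * cos (t * x) = gs v t * (gs s2 t * cos (- (t * x))).
  by rewrite cosN mulrA; congr (_ * _); rewrite /gs -expRD; congr expR; field.
rewrite -mulrBr normrM (ger0_norm (gs_ge0 v t)).
have B0 : 0 <= B t by apply: le_trans (normr_ge0 _) (char_close t 0).
apply: le_trans (ler_wpM2l (gs_ge0 v t) (char_close t _)) _.
by rewrite ler_piMl // gs_le1 // ltW.
Qed.

Let N : R := (Num.sqrt (2 * pi * s2))^-1.

(* The indicator of the interval is at most a multiple of a normal density of
   variance [l ^+ 2], whose Fourier transform is explicit. *)
Lemma interval_mass x l (I : T -> R) : 0 < l -> measurable_fun setT I ->
  (forall w, 0 <= I w <= 1) -> (forall w, I w != 0 -> `|Z w - x| <= l) ->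
  \int[P]_w (W w * I w) <= 6 * l * (N + eps).
Proof.
move=> l0 mI I01 Il; have v0 : 0 < l ^+ 2 by rewrite exprn_gt0.
have p0 : 0 < 2 * pi :> R by rewrite mulr_gt0 ?pi_gt0.
have I1 w : `|I w| <= 1 by have /andP[? ?] := I01 w; rewrite ger0_norm.
(* The inverse of the normal density at distance l. The final 6 comes from e^(1/2) <= 2 and sqrt(2
   pi) <= 3. *)
set c := expR 2^-1 * Num.sqrt (2 * pi * l ^+ 2).
have q0 : 0 < Num.sqrt (2 * pi * l ^+ 2) by rewrite sqrtr_gt0 mulr_gt0.
have c0 : 0 < c by rewrite mulr_gt0 ?expR_gt0.
have Ic w : I w <= c * gauss_pdf (l ^+ 2) (Z w - x).
  have [->|/Il h] := eqVneq (I w) 0; first by rewrite mulr_ge0 ?gauss_pdf_ge0 // ltW.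
  have /andP[_ /le_trans] := I01 w; apply.
  rewrite /c /gauss_pdf mulrA -[_ * _ / _]mulrA divff ?mulr1 ?(gt_eqF q0) //.
  rewrite /gs -expRD -expR0 ler_expR subr_ge0.
  rewrite -[(Z w - x) ^+ 2]real_normK ?num_real // mulrAC -[leRHS]mul1r ler_pM2r //.
  by rewrite mulrC ler_pdivrMr // mul1r lerXn2r ?nnegrE // ltW.
have mnd : measurable_fun setT (fun w => gauss_pdf (l ^+ 2) (Z w - x)).
  apply: measurableT_comp; first exact: measurable_gauss_pdf.
  exact: measurable_funB.
have ndb w : `|gauss_pdf (l ^+ 2) (Z w - x)| <= (Num.sqrt (2 * pi * l ^+ 2))^-1.
  by rewrite ger0_norm ?gauss_pdf_ge0 // gauss_pdf_le.
have ind := integrable_W mnd ndb.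
apply: (@le_trans _ _ (c * \int[P]_w (W w * gauss_pdf (l ^+ 2) (Z w - x)))).
  rewrite -RintegralZl //; apply: le_Rintegral => //.
  - exact: integrable_W I1.
  - exact: integrable_scale.
  - by move=> w _; rewrite mulrCA ler_wpM2l.
have := smoothed_density x v0; rewrite ler_norml => /andP[_ h].
have sv0 : 0 < s2 + l ^+ 2 by rewrite addr_gt0.
have hN : \int[P]_w (W w * gauss_pdf (l ^+ 2) (Z w - x)) <= N + eps.
  rewrite lerBlDr addrC in h; apply: le_trans h _; rewrite lerD2r.
  apply: le_trans (gauss_pdf_le _ sv0) _; rewrite /N lef_pV2 ?posrE ?sqrtr_gt0 ?(mulr_gt0 p0) //.
  by apply: ler_wsqrtr; rewrite ler_pM2l // lerDl ltW.
have N0 : 0 <= N + eps by rewrite addr_ge0 ?eps_ge0 // /N invr_ge0 sqrtr_ge0.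
apply: le_trans (ler_wpM2l (ltW c0) hN) _; rewrite ler_wpM2r //.
rewrite /c sqrtrM ?(ltW p0) // sqrtr_sqr (ger0_norm (ltW l0)) mulrA ler_wpM2r ?(ltW l0) //.
have e2 : expR 2^-1 <= 2 :> R.
  have := expR_ge1Dx (- 2^-1 : R); rewrite expRN => h2.
  have e0 := expR_gt0 (2^-1 : R).
  have : 2^-1 <= (expR 2^-1)^-1 :> R by lra.
  by rewrite lef_pV2 ?posrE.
have s3 : Num.sqrt (2 * pi) <= 3 :> R.
  rewrite -(@ler_pXn2r _ 2) ?nnegrE ?sqrtr_ge0 // sqr_sqrtr ?(ltW p0) //.
  have := @pihalf_lt2 R; lra.
have := ler_pM (expR_ge0 _) (sqrtr_ge0 _) e2 s3; lra.
Qed.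

(** * The tilted law integrated against an exponential density *)

Section Laplace.
Variable k : R.
Hypothesis k0 : 0 < k.
Let h := exponential_pdf k.

Let hE x : h x = if 0 <= x then k * expR (- (k * x)) else 0.
Proof.
by rewrite /h /exponential_pdf patchE mem_setE in_itv /= andbT mulNr.
Qed.

Let h_ge0 x : 0 <= h x.
Proof. by rewrite hE; case: ifP => // _; rewrite mulr_ge0 ?expR_ge0 // ltW. Qed.

Let h_le x : h x <= k.
Proof.
rewrite hE; case: ifP => [x0|_]; last exact: ltW.
by rewrite ler_piMr ?(ltW k0) // -expR0 ler_expR oppr_le0 mulr_ge0 // ltW.
Qed.

Let ih : mu.-integrable setT (EFin \o h).
Proof. exact: integrable_exponential_pdf. Qed.

Let int_h : \int[mu]_x h x = 1.
Proof. by rewrite /Rintegral integral_exponential_pdf. Qed.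

Let mh : measurable_fun setT h.
Proof. by have /measurable_int/measurable_EFinP := ih. Qed.

(** On one side of 0 the density has Lipschitz constant k^2. Across the jump |z - x| >= |z|, so the
    trivial bound k is at most k |z - x|/|z|. *)
Let h_lip z x : z != 0 -> `|h x - h z| <= k * (k + `|z|^-1) * `|z - x|.
Proof.
move=> z0; have z0' : 0 < `|z| by rewrite normr_gt0.
have half : `|h x - h z| <= k.
  by have := h_ge0 x; have := h_ge0 z; have := h_le x; have := h_le z; rewrite ler_norml; lra.
have far : `|z| <= `|z - x| -> `|h x - h z| <= k * (k + `|z|^-1) * `|z - x|.
  move=> zx; apply: le_trans half _; rewrite -mulrA ler_peMr ?(ltW k0) //.
  rewrite mulrDl; apply: (@le_trans _ _ (`|z|^-1 * `|z - x|)).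
    by rewrite ler_pdivlMl // mulr1.
  by rewrite lerDr mulr_ge0 // ltW.
have lip (a b : R) : 0 <= a -> 0 <= b -> a <= b ->
    `|k * expR (- (k * a)) - k * expR (- (k * b))| <= k * k * (b - a).
  move=> a0 b0 ab; rewrite -mulrBr normrM (ger0_norm (ltW k0)) -mulrA ler_wpM2l ?(ltW k0) //.
  have -> : expR (- (k * b)) = expR (- (k * a)) * expR (- (k * (b - a))).
    by rewrite -expRD; congr expR; ring.
  rewrite -[X in X - _]mulr1 -mulrBr normrM (ger0_norm (expR_ge0 _)).
  have kab : 0 <= k * (b - a) by rewrite mulr_ge0 ?(ltW k0) // subr_ge0.
  have e1 : expR (- (k * (b - a))) <= 1 by rewrite -expR0 ler_expR oppr_le0.
  have e2 := expR_ge1Dx (- (k * (b - a))).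
  have e3 : expR (- (k * a)) <= 1 by rewrite -expR0 ler_expR oppr_le0 mulr_ge0 // ltW.
  apply: (@le_trans _ _ (1 * `|1 - expR (- (k * (b - a)))|)); first by rewrite ler_wpM2r.
  rewrite mul1r ger0_norm; lra.
have near : `|k * expR (- (k * x)) - k * expR (- (k * z))| <= k * k * `|z - x| ->
    `|k * expR (- (k * x)) - k * expR (- (k * z))| <= k * (k + `|z|^-1) * `|z - x|.
  move=> /le_trans; apply; rewrite ler_wpM2r // ler_wpM2l ?(ltW k0) // lerDl invr_ge0 //.
have [zp|zn] := lerP 0 z; have [xp|xn] := lerP 0 x.
- rewrite !hE zp xp; apply: near; have [xz|zx] := lerP x z.
    by rewrite lip.
  by rewrite distrC lip // ltW.
- by apply: far; rewrite !ger0_norm; lra.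
- by apply: far; rewrite !ltr0_norm; lra.
- by rewrite !hE (lt_geF zn) (lt_geF xn) subrr normr0 mulr_ge0 // mulr_ge0 ?addr_ge0 ?invr_ge0 // ltW.
Qed.

Let H v z := \int[mu]_x (h x * gauss_pdf v (z - x)).

Let ihnd v z : 0 < v -> mu.-integrable setT (EFin \o (fun x => h x * gauss_pdf v (z - x))).
Proof.
move=> v0; have [ind _] := integral_gauss_pdf z v0.
apply: integrable_bound (integrable_scale k ind) _ => [|x].
  by apply: measurable_funM => //; have /measurable_int/measurable_EFinP := ind.
by rewrite normrM (ger0_norm (h_ge0 x)) (ger0_norm (gauss_pdf_ge0 _ _)) ler_wpM2r ?gauss_pdf_ge0.
Qed.

(** Within [u] of the jump only the trivial bound k is available; elsewhere [h_lip] applies with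
    1/|z| <= 1/u, and the normal law has first absolute moment O(sqrt v). *)
Let H_close v z u : 0 < v -> 0 < u ->
  `|H v z - h z| <= k * (if `|z| <= u then 1 else 0) + 2 * Num.sqrt v * (k * (k + u^-1)).
Proof.
move=> v0 u0; have [ind nd1] := integral_gauss_pdf z v0.
have Hk : 0 <= H v z <= k.
  apply/andP; split; first by apply: Rintegral_ge0 => x _; rewrite mulr_ge0 ?gauss_pdf_ge0.
  rewrite -[leRHS]mulr1 -nd1 -RintegralZl //; apply: le_Rintegral => //.
  - exact: ihnd.
  - exact: integrable_scale.
  - by move=> x _; rewrite ler_wpM2r ?gauss_pdf_ge0.
have q0 : 0 <= 2 * Num.sqrt v * (k * (k + u^-1)).
  by rewrite mulr_ge0 ?mulr_ge0 ?sqrtr_ge0 ?addr_ge0 ?invr_ge0 // ltW.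
case: ifP => [_|/negbT zu].
  rewrite mulr1; have := h_ge0 z; have := h_le z; have /andP[? ?] := Hk => ??.
  by apply: (@le_trans _ _ k); [rewrite ler_norml; lra | rewrite lerDl].
rewrite -ltNge in zu; rewrite mulr0 add0r.
have z0 : z != 0 by rewrite -normr_gt0; apply: lt_trans zu.
have -> : H v z - h z = \int[mu]_x ((h x - h z) * gauss_pdf v (z - x)).
  rewrite -[X in _ - X]mulr1 -nd1 -RintegralZl // -RintegralB //.
  - by apply: eq_Rintegral => x _; rewrite mulrBl.
  - exact: ihnd.
  - exact: integrable_scale.
have v20 : 0 < 2 * v by rewrite mulr_gt0.
have [ind2 nd2] := integral_gauss_pdf z v20.
rewrite [leRHS](_ : _ = \int[mu]_x (2 * Num.sqrt v * (k * (k + u^-1)) * gauss_pdf (2 * v) (z - x))); last first.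
  by rewrite RintegralZl // nd2 mulr1.
apply: abs_Rintegral_le; [|exact: integrable_scale|].
  apply: eq_integrable (integrable_sub (ihnd z v0) (integrable_scale (h z) ind)) => // x _ /=.
  by rewrite mulrBl.
move=> x; rewrite normrM (ger0_norm (gauss_pdf_ge0 _ _)).
apply: le_trans (ler_wpM2r (gauss_pdf_ge0 _ _) (h_lip x z0)) _.
have c0 : 0 <= k * (k + `|z|^-1) by rewrite mulr_ge0 ?addr_ge0 ?invr_ge0 // ltW.
rewrite -[leLHS]mulrA; apply: le_trans (ler_wpM2l c0 (abs_gauss_pdf_le (z - x) v0)) _.
have cu : k * (k + `|z|^-1) <= k * (k + u^-1).
  rewrite ler_wpM2l ?(ltW k0) // lerD2l lef_pV2 ?posrE //; first exact: ltW.
  exact: lt_trans zu.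
have b0 : 0 <= 2 * Num.sqrt v * gauss_pdf (2 * v) (z - x) by rewrite mulr_ge0 ?gauss_pdf_ge0 // mulr_ge0 ?sqrtr_ge0.
apply: le_trans (ler_wpM2r b0 cu) _; rewrite le_eqVlt; apply/orP; left; apply/eqP; ring.
Qed.

Let Nv v : R := (Num.sqrt (2 * pi * v))^-1.

Let Nv_le v : 0 < v -> N * (1 - v / s2) <= Nv (s2 + v) <= N.
Proof.
move=> v0; have p0 : 0 < 2 * pi :> R by rewrite mulr_gt0 ?pi_gt0.
have sv0 : 0 < s2 + v by rewrite addr_gt0.
have a0 : 0 < 2 * pi * s2 by rewrite mulr_gt0.
have b0 : 0 < 2 * pi * (s2 + v) by rewrite mulr_gt0.
have ab : 2 * pi * s2 <= 2 * pi * (s2 + v) by rewrite ler_pM2l // lerDl ltW.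
set a := 2 * pi * s2 in a0 ab *; set b := 2 * pi * (s2 + v) in b0 ab *.
have sa : 0 < Num.sqrt a by rewrite sqrtr_gt0.
have sb : 0 < Num.sqrt b by rewrite sqrtr_gt0.
have sab : Num.sqrt a <= Num.sqrt b by rewrite ler_sqrt // ltW.
apply/andP; split; last by rewrite /Nv /N lef_pV2 ?posrE.
have vs : 1 - v / s2 <= a / b.
  have -> : a / b = s2 / (s2 + v) by rewrite /a /b -mulf_div divff ?gt_eqF // mul1r.
  rewrite ler_pdivlMr // mulrDr mulrBl mul1r divfK ?gt_eqF // mulrBl mul1r.
  have : 0 <= v / s2 * v by rewrite mulr_ge0 ?divr_ge0 // ltW.
  lra.
apply: (@le_trans _ _ (N * (a / b))); first by rewrite ler_wpM2l // invr_ge0 ltW.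
rewrite /N /Nv -/a -/b -{2}(sqr_sqrtr (ltW a0)) -{1}(sqr_sqrtr (ltW b0)).
have -> : (Num.sqrt a)^-1 * (Num.sqrt a ^+ 2 / Num.sqrt b ^+ 2) =
   (Num.sqrt b)^-1 * (Num.sqrt a / Num.sqrt b) by field; rewrite !gt_eqF.
by rewrite ler_piMr ?invr_ge0 ?(ltW sb) // ler_pdivrMr // mul1r.
Qed.

(** The exponential lives at scale 1/k, where the normal density is nearly its value at 0. From gs
    >= 1 - x^2/(2V), the loss is handled by x^2 exp(-kx/2) <= 8/k^2, leaving an exponential of rate
    k/2. *)
Let int_hnd V : s2 <= V ->
  Nv V - 8 * N / (k ^+ 2 * s2) <= \int[mu]_x (h x * gauss_pdf V x) <= Nv V.
Proof.
move=> sV; have V0 : 0 < V by apply: lt_le_trans sV.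
have p0 : 0 < 2 * pi :> R by rewrite mulr_gt0 ?pi_gt0.
have nv0 : 0 <= Nv V by rewrite invr_ge0 sqrtr_ge0.
have nvN : Nv V <= N.
  rewrite /Nv /N lef_pV2 ?posrE ?sqrtr_gt0 ?(mulr_gt0 p0) //.
  by apply: ler_wsqrtr; rewrite ler_pM2l.
have i1 : mu.-integrable setT (EFin \o (fun x => h x * gauss_pdf V x)).
  apply: (@integrable_bound _ _ _ mu _ (fun x => Nv V * h x)).
  - by apply: measurable_funM => //; exact: measurable_gauss_pdf.
  - exact: integrable_scale.
  - move=> x; rewrite normrM (ger0_norm (h_ge0 x)) (ger0_norm (gauss_pdf_ge0 _ _)) mulrC.
    by rewrite ler_wpM2r // gauss_pdf_le.
have i2 : mu.-integrable setT (EFin \o (fun x => Nv V * h x)) by exact: integrable_scale.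
apply/andP; split; last first.
  rewrite -[leRHS]mulr1 -int_h -RintegralZl //; apply: le_Rintegral => // x _.
  by rewrite mulrC ler_wpM2r // gauss_pdf_le.
have k20 : 0 < k / 2 by rewrite divr_gt0.
set h2 := exponential_pdf (k / 2).
have ih2 : mu.-integrable setT (EFin \o h2) by exact: integrable_exponential_pdf.
set c := N / s2 * (8 / k ^+ 2).
have i3 : mu.-integrable setT (EFin \o (fun x => c * h2 x)) by exact: integrable_scale.
have -> : Nv V - 8 * N / (k ^+ 2 * s2) = \int[mu]_x (Nv V * h x - c * h2 x).
  rewrite RintegralB // !RintegralZl // int_h.
  rewrite [X in _ = _ - _ * X](_ : _ = 1); last by rewrite /Rintegral integral_exponential_pdf.
  by rewrite /c; field; rewrite !gt_eqF.
apply: le_Rintegral => //; first exact: integrable_sub.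
move=> x _; rewrite hE /h2 /exponential_pdf patchE mem_setE in_itv /= andbT.
case: ifP => x0; last by rewrite mulr0 mul0r mulr0 subrr.
have e2 : expR (- (k * x)) = expR (- (k / 2) * x) * expR (- (k / 2) * x).
  by rewrite -expRD; congr expR; field.
set E := expR (- (k / 2) * x) in e2 *; have E0 : 0 < E by exact: expR_gt0.
have xE : x ^+ 2 * E <= 8 / k ^+ 2.
  rewrite /E mulNr expRN ler_pdivrMr ?expR_gt0 //.
  have kx : 0 <= k / 2 * x by rewrite mulr_ge0 // ltW.
  have := @expR_ge1Dxn R _ 1 kx; rewrite (_ : 2`!%:R = 2 :> R) // => hh.
  rewrite -ler_pdivrMl ?divr_gt0 ?exprn_gt0 //.
  have -> : (8 / k ^+ 2)^-1 * x ^+ 2 = (k / 2 * x) ^+ 2 / 2 by field; rewrite gt_eqF.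
  lra.
have gl : 1 - x ^+ 2 / (2 * V) <= gs V^-1 x.
  rewrite /gs; apply: le_trans (expR_ge1Dx _); rewrite le_eqVlt; apply/orP; left.
  by apply/eqP; field; rewrite gt_eqF.
rewrite /gauss_pdf -/(Nv V).
apply: (@le_trans _ _ (k * expR (- (k * x)) * (Nv V * (1 - x ^+ 2 / (2 * V))))); last first.
  by apply: ler_wpM2l; [rewrite mulr_ge0 ?expR_ge0 // ltW | exact: ler_wpM2l].
have : k * expR (- (k * x)) * (Nv V * (x ^+ 2 / (2 * V))) <= c * (k / 2 * E).
  have -> : k * expR (- (k * x)) * (Nv V * (x ^+ 2 / (2 * V))) =
     (Nv V / V * (x ^+ 2 * E)) * (k / 2 * E) by rewrite e2; field; rewrite gt_eqF.
  apply: ler_wpM2r; first by rewrite mulr_ge0 // ltW.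
  apply: ler_pM => //.
  - by rewrite divr_ge0 // ltW.
  - by rewrite mulr_ge0 ?sqr_ge0 // ltW.
  - by rewrite ler_pM ?invr_ge0 ?(ltW V0) // lef_pV2 ?posrE.
rewrite mulrBr mulr1 [k * _ * (_ - _)]mulrBr; lra.
Qed.

(* The exponential density [h] is convolved with a normal density of variance
   [v], which costs O(sqrt v) away from the discontinuity at 0; near 0
   [interval_mass] applies; then [v] tends to 0. *)
Lemma laplace_estimate :
  `|\int[P]_w (W w * h (Z w)) - N| <= eps + 8 * N / (k ^+ 2 * s2).
Proof.
have e0 := eps_ge0; have N0 : 0 <= N by rewrite invr_ge0 sqrtr_ge0.
have mhZ : measurable_fun setT (h \o Z) by exact: measurableT_comp.
set E1 := \int[P]_w _.
have iE1 : P.-integrable setT (EFin \o (fun w => W w * h (Z w))).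
  by apply: (@integrable_W _ k) => // w; rewrite ger0_norm.
(* The three terms are the costs of widening s2 to s2 + v, of the mass within u of the jump, and of
   smoothing away from it. *)
set K := N / s2 + 6 * k * (N + eps) + 2 * k * (k + 1).
have K0 : 0 <= K.
  by rewrite !addr_ge0 ?divr_ge0 ?mulr_ge0 ?addr_ge0 ?(ltW s20) ?(ltW k0).
suff main u : 0 < u -> u <= 1 ->
    `|E1 - N| <= eps + 8 * N / (k ^+ 2 * s2) + K * u.
  apply/ler_addgt0Pr => e e00; have K1 : 0 < K + 1 by lra.
  have m0 : 0 < Num.min 1 (e / (K + 1)) by rewrite lt_min ltr01 divr_gt0.
  apply: le_trans (main _ m0 _) _; first by rewrite ge_min lexx.
  rewrite lerD2l; apply: (@le_trans _ _ (K * (e / (K + 1)))).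
    by rewrite ler_wpM2l // ge_min lexx orbT.
  by rewrite mulrA ler_pdivrMr // mulrC ler_wpM2l ?(ltW e00) // lerDl.
(* With v = u^4 one has sqrt v = u^2, so that sqrt v (k + 1/u) is still O(u). *)
move=> u0 u1; set v := (u ^+ 2) ^+ 2; have v0 : 0 < v by rewrite !exprn_gt0.
have sv : Num.sqrt v = u ^+ 2 by rewrite sqrtr_sqr ger0_norm ?sqr_ge0.
have vu : v <= u by rewrite /v -exprM exprS ler_piMr ?(ltW u0) // exprn_ile1 // ltW.
pose f w x := W w * (h x * gauss_pdf v (Z w - x)).
have mf : measurable_fun setT (fun z : T * R => f z.1 z.2).
  apply: measurable_funM; first exact: measurableT_comp.
  apply: measurable_funM; first exact: measurableT_comp.
  apply: measurableT_comp; first exact: measurable_gauss_pdf.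
  by apply: measurable_funB => //; exact: measurableT_comp.
have fb w x : `|f w x| <= W w * (Nv v * h x).
  rewrite /f normrM (ger0_norm (W0 w)) ler_wpM2l // normrM (ger0_norm (h_ge0 x)).
  by rewrite (ger0_norm (gauss_pdf_ge0 _ _)) mulrC ler_wpM2r // gauss_pdf_le.
have [i1 i2 E] := fubini_dominated mf iW (integrable_scale (Nv v) ih) fb.
have fH w : \int[mu]_x f w x = W w * H v (Z w).
  by rewrite /f RintegralZl //; exact: ihnd.
have fA x : \int[P]_w f w x = h x * \int[P]_w (W w * gauss_pdf v (Z w - x)).
  rewrite -RintegralZl //; first by apply: eq_Rintegral => w _; rewrite /f; ring.
  apply: (@integrable_W _ (Nv v)) => [|w]; last by rewrite ger0_norm ?gauss_pdf_ge0 // gauss_pdf_le.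
  by apply: measurableT_comp; [exact: measurable_gauss_pdf | exact: measurable_funB].
set V := s2 + v; have sV : s2 <= V by rewrite lerDl ltW.
have V0 : 0 < V by apply: lt_le_trans sV.
have i3 : mu.-integrable setT (EFin \o (fun x => h x * gauss_pdf V x)).
  apply: (@integrable_bound _ _ _ mu _ (fun x => Nv V * h x)).
  - by apply: measurable_funM => //; exact: measurable_gauss_pdf.
  - exact: integrable_scale.
  - move=> x; rewrite normrM (ger0_norm (h_ge0 x)) (ger0_norm (gauss_pdf_ge0 _ _)) mulrC.
    by rewrite ler_wpM2r // gauss_pdf_le.
have step1 : `|\int[mu]_x (\int[P]_w f w x) - \int[mu]_x (h x * gauss_pdf V x)| <= eps.
  rewrite -RintegralB // -[leRHS]mulr1 -int_h -RintegralZl //.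
  apply: abs_Rintegral_le; [exact: integrable_sub | exact: integrable_scale |].
  move=> x; rewrite fA -mulrBr normrM (ger0_norm (h_ge0 x)) mulrC ler_wpM2r //.
  exact: smoothed_density.
pose I w : R := if `|Z w| <= u then 1 else 0.
have mI : measurable_fun setT I.
  apply: measurable_fun_ifT => //; apply: measurable_fun_ler => //.
  by apply: measurableT_comp => //; apply: continuous_measurable_fun; exact: norm_continuous.
have I01 w : 0 <= I w <= 1 by rewrite /I; case: ifP; rewrite ?lexx ?ler01.
have mass : \int[P]_w (W w * I w) <= 6 * u * (N + eps).
  apply: (@interval_mass 0 u I) => // w; rewrite /I subr0.
  by case: ifP => //; rewrite eqxx.
set q := 2 * Num.sqrt v * (k * (k + u^-1)).
have iI : P.-integrable setT (EFin \o (fun w => W w * I w)).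
  by apply: (@integrable_W _ 1) => // w; have /andP[? ?] := I01 w; rewrite ger0_norm.
have step2 : `|E1 - \int[P]_w (\int[mu]_x f w x)| <= k * \int[P]_w (W w * I w) + q.
  rewrite /E1 -RintegralB // -[q in leRHS]mulr1 -W1 -!RintegralZl //.
  rewrite -RintegralD //; [|exact: integrable_scale..].
  apply: abs_Rintegral_le; [exact: integrable_sub | by apply: integrable_add; exact: integrable_scale |].
  move=> w; rewrite fH -mulrBr normrM (ger0_norm (W0 w)) distrC.
  have := ler_wpM2l (W0 w) (H_close (Z w) v0 u0); rewrite -/(I w) -/q; lra.
have /andP[n1 n2] := Nv_le v0; rewrite -/V in n1 n2.
have /andP[m1 m2] := int_hnd sV.
have qK : q <= 2 * k * (k + 1) * u.
  rewrite /q sv (_ : 2 * u ^+ 2 * (k * (k + u^-1)) = 2 * k * (k * u + 1) * u); last first.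
    by field; rewrite gt_eqF.
  rewrite ler_wpM2r ?(ltW u0) // ler_wpM2l ?mulr_ge0 ?(ltW k0) // lerD2r.
  by rewrite ler_piMr // ltW.
have km := ler_wpM2l (ltW k0) mass.
have nv : N * (v / s2) <= N / s2 * u.
  rewrite (_ : N * (v / s2) = N / s2 * v); last by ring.
  by rewrite ler_wpM2l ?divr_ge0 // ltW.
rewrite E in step2; move: step1 step2; rewrite !ler_norml.
set A := \int[mu]_x \int[P]_w f w x; set B0 := \int[mu]_x (h x * gauss_pdf V x) in m1 m2 *.
rewrite mulrBr mulr1 in n1.
have KE : K * u = N / s2 * u + k * (6 * u * (N + eps)) + 2 * k * (k + 1) * u by rewrite /K; ring.
have r0 : 0 <= 8 * N / (k ^+ 2 * s2) by rewrite divr_ge0 ?mulr_ge0 ?exprn_ge0 // ltW.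
rewrite KE => /andP[a1 a2] /andP[b1 b2]; apply/andP; split; lra.
Qed.

End Laplace.
End LocalLimit.

(** * Independence and almost sure convergence *)

Section Model.
Context {R : realType} {d : measure_display} {T : measurableType d}.
Variables (P : probability T R) (X : nat -> {RV P >-> R}).
Hypothesis HX : random_model X.
Implicit Types (p n N : nat) (s : seq nat) (w : T) (g : R -> R).

Definition log_factor p w : R := - ln (1 - X p w / p%:R).
Definition log_sum s w : R := \sum_(p <- s) log_factor p w.
Definition cyl (J : {fset nat}) (A : nat -> set R) : set T :=
  \bigcap_(i in [set` J]) (X i @^-1` A i).

Lemma measurable_X p : measurable_fun setT (X p).
Proof. exact: measurable_funP. Qed.

Lemma measurable_Xpre p (B : set R) : measurable B -> measurable (X p @^-1` B).
Proof. by move=> mB; rewrite -[X in measurable X]setTI; exact: measurable_X. Qed.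

Lemma measurable_ln_inv (f : T -> R) : measurable_fun setT f ->
  measurable_fun setT (fun w => ln (f w)).
Proof. by move=> mf; apply: measurableT_comp => //; exact: measurable_ln. Qed.

Lemma measurable_log_factor p : measurable_fun setT (log_factor p).
Proof.
apply: measurableT_comp => //; apply: measurable_ln_inv.
apply: measurable_funB => //; apply: measurable_funM => //; exact: measurable_X.
Qed.

Lemma measurable_log_sum s : measurable_fun setT (log_sum s).
Proof.
elim: s => [|p s IH]; first by rewrite /log_sum; under eq_fun do rewrite big_nil; exact: measurable_cst.
rewrite /log_sum; under eq_fun do rewrite big_cons.
by apply: measurable_funD => //; exact: measurable_log_factor.
Qed.

Lemma measurable_cyl J A : (forall i, measurable (A i)) -> measurable (cyl J A).
Proof.
move=> mA; apply: fin_bigcap_measurable => // i _; exact: measurable_Xpre.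
Qed.

Definition in_support (p : nat) : set T := X p @^-1` ([set 1] `|` [set -1] `|` [set 0]).

Lemma in_support_null p : prime p -> P (~` in_support p) = 0%E.
Proof.
move=> pp; have [h1 h2 h3] := HX.2 p pp.
have m1 v : measurable (X p @^-1` [set v]) by exact: measurable_Xpre.
rewrite probability_setC; last by apply: measurable_Xpre; do 2 apply: measurableU => //.
have -> : P (in_support p) = 1%E; last by rewrite subee.
rewrite /in_support !preimage_setU measureU //; first last.
- apply/seteqP; split => // w /= [[->|->] /eqP]; rewrite ?oppr_eq0 ?oner_eq0 //.
- exact: measurableU.
rewrite measureU //; first last.
- apply/seteqP; split => // w /= [-> /eqP]; rewrite -subr_eq0 opprK -mulr2n pnatr_eq0 => /eqP; discriminate.
transitivity ((alphap p)%:E + (betap p)%:E + (gammap p)%:E : \bar R)%E.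
  by congr (_ + _ + _)%E.
by rewrite -!EFinD /gammap; congr EFin; ring.
Qed.

(** Independence is given as a product formula for events, so the induction carries a cylinder event
    on indices outside [s]: conditioning on the value of X p adds one index to it. As g >= 0, the
    integral splits over events before any integrability is known. *)
Lemma integral_walk s : uniq s -> all prime s -> forall (J : {fset nat}) (A : nat -> set R) g,
  (forall i, i \in J -> prime i) -> (forall i, i \in J -> i \notin s) ->
  (forall i, measurable (A i)) -> measurable_fun setT g -> (forall y, 0 <= g y) ->
  (\int[P]_(w in cyl J A) (g (log_sum s w))%:E =
   ((\prod_(i <- J) fine (P (X i @^-1` A i))) * EN euler_law s g)%:E)%E.
Proof.
elim: s => [|p s IH] /= us ap J A g pJ Js mA mg g0.
  rewrite (eq_integral (cst (g 0)%:E)) => [|w _]; last by rewrite /log_sum big_nil.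
  rewrite integral_cst; last exact: measurable_cyl.
  rewrite mulrC EFinM; congr (_ * _)%E.
  by apply: HX.1 => // i /= /pJ.
move: us ap => /andP[ps us] /andP[pp ap].
have mgS : measurable_fun setT (fun w => (g (log_sum (p :: s) w))%:E).
  by apply/measurable_EFinP; apply: measurableT_comp => //; exact: measurable_log_sum.
have mgS' (B : set T) : measurable_fun B (fun w => (g (log_sum (p :: s) w))%:E).
  exact: measurable_funTS mgS.
have pnJ : p \notin J by apply/negP => /Js; rewrite mem_head.
(* The enlarged cylinder also prescribes X p = v, where the summand of index p is a constant. *)
pose Av v i : set R := if i == p then [set v] else A i.
have mAv v i : measurable (Av v i) by rewrite /Av; case: ifP.
pose D v := cyl (p |` J)%fset (Av v).
have mD v : measurable (D v) by exact: measurable_cyl.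
have DE v : D v = cyl J A `&` X p @^-1` [set v].
  rewrite /D /cyl; apply/seteqP; split => w /=.
    move=> H; split.
      move=> i /= iJ; have := H i (fset1Ur p iJ).
      by rewrite /preimage /Av /=; case: eqP => // ip; move: pnJ; rewrite -ip iJ.
    by have := H p (fset1U1 p J); rewrite /preimage /Av /= eqxx.
  move=> [H1 H2] i /=; rewrite !inE /Av => /orP[/eqP ->|iJ]; first by rewrite eqxx.
  by case: eqP => [-> //|_]; apply: H1.
have IHv v y : (forall w, D v w -> log_factor p w = y) ->
    (\int[P]_(w in D v) (g (log_sum (p :: s) w))%:E =
     (fine (P (X p @^-1` [set v])) * (\prod_(i <- J) fine (P (X i @^-1` A i))) *
      EN euler_law s (fun z => g (z + y)))%:E)%E.
  move=> Dy; rewrite (eq_integral (fun w => (g (log_sum s w + y))%:E)); last first.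
    move=> w; rewrite inE => /Dy Hy.
    by rewrite /log_sum big_cons Hy addrC.
  have := IH us ap (p |` J)%fset (Av v) (fun z => g (z + y)).
  rewrite -/(D v) => ->.
  - rewrite big_fsetU1 //=; congr ((_ * _ * _)%:E).
      by rewrite /Av eqxx.
    apply: eq_big_seq => i iJ; rewrite /Av; case: eqP => // ip.
    by move: pnJ; rewrite -ip iJ.
  - by move=> i; rewrite !inE => /orP[/eqP -> //|/pJ].
  - move=> i; rewrite !inE => /orP[/eqP -> //|/Js]; rewrite inE negb_or => /andP[] //.
  - exact: mAv.
  - by apply: measurableT_comp => //; exact: measurable_funD.
  - by move=> y'.
have [h1 h2 h3] := HX.2 p pp.
(* The model fixes only the probabilities of the three values, so the three events cover the
   cylinder up to this null set. *)
pose N := cyl J A `&` ~` in_support p.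
have mthree : measurable (in_support p) by apply: measurable_Xpre; do 2 apply: measurableU => //.
have mN : measurable N by apply: measurableI; [exact: measurable_cyl | exact: measurableC].
have N0 : P N = 0%E.
  by apply/eqP; rewrite -measure_le0 -(in_support_null pp) le_measure ?inE //; [exact: measurableC | exact: subIsetr].
have split4 : cyl J A = D 1 `|` D (-1) `|` D 0 `|` N.
  rewrite !DE; apply/seteqP; split => [w Jw|w [[[[]|[]]|[]]|[]] //].
  have [[[x1|x1]|x1]|n3] := pselect (in_support p w).
  - by left; left; left.
  - by left; left; right.
  - by left; right.
  - by right.
have m12 : measurable (D 1 `|` D (-1)) by exact: measurableU.
have m123 : measurable (D 1 `|` D (-1) `|` D 0) by exact: measurableU.
have ge0 (B : set T) (w : T) : B w -> (0 <= (g (log_sum (p :: s) w))%:E)%E by rewrite lee_fin.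
have d1 : [disjoint D 1 `|` D (-1) `|` D 0 & N].
  apply/disj_setPS => w /= [[[|]|]]; rewrite DE => -[_ /= xv] [_] /=; apply; rewrite /in_support /= xv; tauto.
have d2 : [disjoint D 1 `|` D (-1) & D 0].
  apply/disj_setPS => w /= [[|]]; rewrite !DE => -[_ /= ->] [_ /= /eqP]; rewrite ?oppr_eq0 ?oner_eq0 //.
have d3 : [disjoint D 1 & D (-1)].
  apply/disj_setPS => w /= []; rewrite !DE => -[_ /= ->] [_ /= /eqP].
  by rewrite -subr_eq0 opprK -mulr2n pnatr_eq0 => /eqP; discriminate.
rewrite [in LHS]split4 (ge0_integral_setU _ m123 mN (mgS' _) (ge0 _) d1).
rewrite (null_set_integral mN (mgS' _) N0) adde0.
rewrite (ge0_integral_setU _ m12 (mD _) (mgS' _) (ge0 _) d2).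
rewrite (ge0_integral_setU _ (mD _) (mD _) (mgS' _) (ge0 _) d3).
rewrite (IHv 1 (- ln (1 - p%:R^-1))); last first.
  by move=> w; rewrite DE => -[_ /= e]; rewrite /log_factor e mul1r.
rewrite (IHv (-1) (- ln (1 + p%:R^-1))); last first.
  by move=> w; rewrite DE => -[_ /= e]; rewrite /log_factor e mulN1r opprK.
rewrite (IHv 0 0); last first.
  by move=> w; rewrite DE => -[_ /= e]; rewrite /log_factor e mul0r subr0 ln1 oppr0.
rewrite h1 h2 h3 /= -!EFinD /avg /= pp; congr EFin; ring.
Qed.

Lemma integral_walk_ge0 s g : uniq s -> all prime s -> measurable_fun setT g ->
  (forall y, 0 <= g y) -> (\int[P]_w (g (log_sum s w))%:E = (EN euler_law s g)%:E)%E.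
Proof.
move=> us ap mg g0.
have H := @integral_walk s us ap fset0 (fun=> setT) g.
have -> : EN euler_law s g = (\prod_(i <- fset0) fine (P (X i @^-1` setT))) * EN euler_law s g.
  by rewrite big_seq_fset0 mul1r.
rewrite -H //.
by congr (integral _ _ _); apply/seteqP; split.
Qed.

Lemma integral_log_sum s g : uniq s -> all prime s -> measurable_fun setT g ->
  P.-integrable setT (EFin \o (fun w => g (log_sum s w))) /\
  \int[P]_w g (log_sum s w) = EN euler_law s g.
Proof.
move=> us ap mg.
pose gp y := (`|g y| + g y) / 2; pose gm y := (`|g y| - g y) / 2.
have mn : measurable_fun setT (fun y => `|g y|).
  by apply: measurableT_comp => //; apply: continuous_measurable_fun; exact: norm_continuous.
have mgp : measurable_fun setT gp by apply: measurable_funM => //; exact: measurable_funD.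
have mgm : measurable_fun setT gm by apply: measurable_funM => //; exact: measurable_funB.
have gp0 y : 0 <= gp y by rewrite divr_ge0 // -lerBlDr sub0r -normrN ler_norm.
have gm0 y : 0 <= gm y by rewrite divr_ge0 // subr_ge0 ler_norm.
have intp := integral_walk_ge0 us ap mgp gp0.
have intm := integral_walk_ge0 us ap mgm gm0.
have ige (h : R -> R) : measurable_fun setT h -> (forall y, 0 <= h y) ->
    P.-integrable setT (EFin \o (fun w => h (log_sum s w))).
  move=> mh h0; apply/integrableP; split.
    by apply/measurable_EFinP; apply: measurableT_comp => //; exact: measurable_log_sum.
  rewrite (eq_integral (fun w => (h (log_sum s w))%:E)) => [|w _]; last by rewrite /= ger0_norm.
  by rewrite integral_walk_ge0 // ltry.
have ip := ige _ mgp gp0; have im := ige _ mgm gm0.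
have E : (fun w => g (log_sum s w)) = (fun w => gp (log_sum s w) - gm (log_sum s w)).
  by apply/funext => w; rewrite /gp /gm; field.
rewrite E; split; first exact: integrable_sub.
rewrite RintegralB // /Rintegral intp intm /=.
have := EN_lin euler_law s (-1) gm gp; rewrite mulN1r addrC => <-.
by apply: eq_EN => y; rewrite /gp /gm; field.
Qed.

End Model.

(** * Almost sure convergence of the logarithmic sum *)

Section RealLemmas.
Context {R : realType}.
Implicit Types (y : R).

Lemma sqr_le_cosh y : y ^+ 2 <= 4 * (expR y + expR (- y) - 2).
Proof.
have E (z : R) : 0 <= z -> z ^+ 2 <= 4 * (expR z + expR (- z) - 2).
  move=> z0; set a := expR (z / 2); set b := expR (- (z / 2)).
  have h1 : 1 + z / 2 <= a by exact: expR_ge1Dx.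
  have h2 : b <= 1 by rewrite -[leRHS]expR0 ler_expR; lra.
  have -> : expR z = a ^+ 2 by rewrite -expRM_natl; congr expR; field.
  have -> : expR (- z) = b ^+ 2 by rewrite -expRM_natl; congr expR; field.
  have h3 : a * b = 1 by rewrite -expRD subrr expR0.
  have h4 : (z / 2) ^+ 2 <= (a - b) ^+ 2 by rewrite lerXn2r ?nnegrE; lra.
  rewrite sqrrB h3 in h4; lra.
case: (leP 0 y) => y0; first exact: E.
by have := E (- y); rewrite sqrrN opprK [expR _ + _]addrC; apply; lra.
Qed.

Lemma sum_inv_sq n : \sum_(0 <= m < n) (m.+1%:R ^- 2 : R) <= 2 - n%:R^-1.
Proof.
elim: n => [|n IH]; first by rewrite big_nil invr0; lra.
rewrite big_nat_recr //=; move: IH; case: n => [|n] IH.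
  by rewrite big_nil expr1n invr1; lra.
have n0 : (0 : R) < n.+1%:R by rewrite ltr0n.
have n1 : (0 : R) < n.+2%:R by rewrite ltr0n.
suff : n.+2%:R ^- 2 <= n.+1%:R^-1 - n.+2%:R^-1 :> R.
  by move: IH; move: (n.+2%:R ^- 2 : R) (n.+2%:R^-1 : R) (n.+1%:R^-1 : R) => ? ? ?; lra.
have -> : n.+2%:R = n.+1%:R + 1 :> R by rewrite -natr1.
move: n0; move: (n.+1%:R : R) => x x0.
have -> : x^-1 - (x + 1)^-1 = (x * (x + 1))^-1 by field; lra.
rewrite lef_pV2 ?posrE; nra.
Qed.

(* Blocks of indices [m^4 <= n < (m+1)^4]: the variance of a block sum is O(m^-4),
   and inside a block the oscillation is trivially O(1/m). *)
Lemma cvg_of_blocks (u : nat -> R) (z : nat -> R) (B K : R) :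
  (forall m, `|u (m.+2 ^ 4)%N - u (m.+1 ^ 4)%N| <= z m) ->
  (forall n, \sum_(0 <= m < n) z m <= B) ->
  (forall m n, (m.+1 ^ 4 <= n)%N -> (n < m.+2 ^ 4)%N ->
     `|u n - u (m.+1 ^ 4)%N| <= K * m.+1%:R^-1) ->
  cvgn u.
Proof.
move=> uz zB osc.
pose v m := u (m.+1 ^ 4)%N.
have cv : cvgn v.
  have sc : cvgn (series (telescope v)).
    apply: normed_cvg; apply: nondecreasing_is_cvgn.
      apply/nondecreasing_seqP => n; rewrite /series /=.
      by rewrite [X in _ <= X]big_nat_recr //= lerDl.
    exists B => _ [n _ <-]; rewrite /series /=; apply: le_trans (zB n).
    by apply: ler_sum => i _; exact: uz.
  have -> : v = series (telescope v) \+ cst (v 0).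
    by apply/funext => n; rewrite telescopeK /= subrK.
  by apply: is_cvgD => //; exact: is_cvg_cst.
have K0 : 0 <= K.
  by have := osc 0%N 1%N isT isT; rewrite invr1 mulr1; apply: le_trans.
apply/cvg_ex; exists (limn v); apply/cvgrPdist_le => e e0.
have e2 : 0 < e / 2 by rewrite divr_gt0.
move/cvgrPdist_le : cv => /(_ _ e2)[M _ HM].
have [M' HM'] : exists M', forall m, (M' <= m)%N -> K * m.+1%:R^-1 <= e / 2.
  exists (Num.bound (K / (e / 2))) => m Mm.
  rewrite ler_pdivrMr ?ltr0n // mulrC -ler_pdivrMr //.
  have := archi_boundP (divr_ge0 K0 (ltW e2)) => /ltW; move=> /le_trans; apply.
  by rewrite ler_nat; apply: leqW.
exists ((maxn M M').+1 ^ 4)%N => // n /= nM.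
have [m [Mm nm nm']] : exists m, [/\ (maxn M M' <= m)%N, (m.+1 ^ 4 <= n)%N & (n < m.+2 ^ 4)%N].
  have ex : exists m, (m.+1 ^ 4 <= n)%N by exists (maxn M M').
  have bd m : (m.+1 ^ 4 <= n)%N -> (m <= n)%N.
    by apply: leq_trans; apply: (@leq_trans m.+1) => //; rewrite -[leqLHS]expn1 leq_pexp2l.
  case: (ex_maxnP ex bd) => m nm mmax; exists m; split => //; first exact: mmax.
  by rewrite ltnNge; apply/negP => /mmax; rewrite ltnn.
have h1 := HM m (leq_trans (leq_maxl _ _) Mm).
have h2 := HM' m (leq_trans (leq_maxr _ _) Mm).
have h3 := osc m n nm nm'.
rewrite (_ : limn v - u n = (limn v - v m) + (v m - u n)); last by ring.
apply: (le_trans (ler_normD _ _)); rewrite [e]splitr lerD //.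
by rewrite distrC; apply: le_trans h3 h2.
Qed.

End RealLemmas.

Section AlmostSure.
Context {R : realType} {d : measure_display} {T : measurableType d}.
Variables (P : probability T R) (X : nat -> {RV P >-> R}).
Hypothesis HX : random_model X.

Definition sqr_cst : R := 16 * mgf_cst 1 * expR (2 * mgf_cst 1).

Lemma sqr_cst_ge0 : 0 <= sqr_cst.
Proof.
by rewrite /sqr_cst; apply: mulr_ge0 (expR_ge0 _); apply: mulr_ge0 => //; exact: mgf_cst_ge0.
Qed.

(** No mean or variance is computed: [sqr_le_cosh] bounds y^2 by the exponentials at r = 1 and r =
    -1, whose expectations are both 1 + O(1/a), and the constant 2 cancels. *)
Lemma EN_sqr_le a n : (0 < a)%N ->
  EN (euler_law (R := R)) (primes_in a n) (fun y => y ^+ 2) <= sqr_cst * a%:R^-1.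
Proof.
move=> a0.
have L := @euler_is_law R.
set s := primes_in a n; set c := mgf_cst (R := R) 1.
have c0 : 0 <= c by exact: mgf_cst_ge0.
have mg r : `|r| = 1 -> \prod_(p <- s) mgf euler_law p r <= 1 + 2 * c * expR (2 * c) * a%:R^-1.
  move=> r1; apply: (le_trans (prod_mgf_le _ _)).
  have -> : mgf_cst r = c by rewrite /c /mgf_cst -[r ^+ 2]real_normK ?num_real // r1 normr1 !expr1n.
  have h := @sum_inv_sq_le R a n a0.
  set q := a%:R^-1 in h *.
  have q1 : q <= 1 by rewrite invf_le1 ?ltr0n // ler1n.
  have q0 : 0 <= q by rewrite invr_ge0.
  apply: (@le_trans _ _ (expR (2 * c * q))).
    by rewrite ler_expR -mulrA mulrCA ler_wpM2l // -/s; exact: h.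
  have x0 : 0 <= 2 * c * q by rewrite !mulr_ge0.
  have e1 : expR (2 * c * q) <= expR (2 * c) by rewrite ler_expR; nra.
  have := expR_ge1Dx (- (2 * c * q)); set x := 2 * c * q in x0 e1 *.
  move=> h1; have h2 : expR x * expR (- x) = 1 by rewrite -expRD subrr expR0.
  have h3 := expR_gt0 x.
  have : expR x <= 1 + x * expR x by nra.
  move=> /le_trans; apply; rewrite lerD2l [leRHS]mulrAC -/x; exact: ler_wpM2l.
apply: (@le_trans _ _ (EN euler_law s (fun y => 4 * (expR (1 * y) + expR (-1 * y) - 2)))).
  by apply: le_EN => // y; rewrite mul1r mulN1r; exact: sqr_le_cosh.
have -> : EN euler_law s (fun y : R => 4 * (expR (1 * y) + expR (-1 * y) - 2)) =
   4 * (\prod_(p <- s) mgf euler_law p 1 + \prod_(p <- s) mgf euler_law p (-1) - 2).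
  rewrite -!EN_exp.
  rewrite (@eq_EN _ _ _ _ (fun y => 4 * expR (1 * y) + (4 * expR (-1 * y) + (-8)))); last by move=> y; ring.
  rewrite EN_lin EN_lin EN_cst //; ring.
have h1 := mg 1 (normr1 _); have h2 := mg (-1) (normrN1 _).
by rewrite /sqr_cst -/c; lra.
Qed.

Lemma ae_in_support : {ae P, forall w, forall p, prime p -> in_support X p w}.
Proof.
apply: ae_foralln => p; case: (boolP (prime p)) => pp; last exact: nearW.
exists (~` in_support X p); split.
- by apply: measurableC; apply: measurable_Xpre; do 2 apply: measurableU => //.
- exact: in_support_null.
- by move=> w /= h w3; apply: h => _.
Qed.

Lemma log_factor_bound p w : prime p -> in_support X p w -> `|log_factor X p w| <= 2 * p%:R^-1.
Proof.
move=> pp; rewrite /in_support /log_factor /preimage /=.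
have [h1 h2 h3 h4 _] := @values_bounds R p pp.
have u0 : 0 <= p%:R^-1 :> R by rewrite invr_ge0.
case=> [[->|->]|->]; rewrite ?mul1r ?mulN1r ?mul0r ?opprK ?subr0 ?ln1 ?oppr0 ?normr0 ?mulr_ge0 //.
  by rewrite ler_norml; apply/andP; split; lra.
by rewrite ler_norml; apply/andP; split; lra.
Qed.

Lemma sum_log_factor_block m n w : (forall p, prime p -> in_support X p w) ->
  (m.+1 ^ 4 <= n)%N -> (n < m.+2 ^ 4)%N ->
  `|log_sum X (primes_in 0 n) w - log_sum X (primes_in 0 (m.+1 ^ 4)) w| <= 30 * m.+1%:R^-1.
Proof.
move=> w3 mn nm.
have -> : primes_in 0 n = primes_in 0 (m.+1 ^ 4) ++ primes_in (m.+1 ^ 4) n.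
  by apply: primes_in_cat; rewrite leq0n.
rewrite /log_sum big_cat /= addrAC subrr add0r.
apply: (le_trans (ler_norm_sum _ _ _)).
have q0 : (0 : R) < m.+1%:R by rewrite ltr0n.
apply: (@le_trans _ _ (\sum_(p <- primes_in (m.+1 ^ 4) n) (2 * m.+1%:R ^- 4 : R))).
  rewrite big_seq [leRHS]big_seq; apply: ler_sum => p; rewrite mem_primes_in => /and3P[pp mp pn].
  apply: (le_trans (log_factor_bound pp (w3 _ pp))); rewrite ler_wpM2l //.
  have p0 := prime_gt0 pp.
  by rewrite -natrX lef_pV2 ?posrE ?ltr0n ?expn_gt0 // ler_nat.
rewrite big_const_seq count_predT iter_addr addr0.
(* With q = m + 1 the block has (q+1)^4 - q^4 <= 15 q^3 integers, each contributing at most 2/q^4;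
   hence 30/q. *)
apply: (@le_trans _ _ ((2 * m.+1%:R ^- 4 : R) *+ (15 * m.+1 ^ 3))).
  have : (size (primes_in (m.+1 ^ 4) n) <= 15 * m.+1 ^ 3)%N.
    rewrite size_filter; apply: leq_trans (count_size _ _) _; rewrite size_iota.
    by rewrite !expnS expn0 in nm *; nia.
  move=> h; apply: ler_wpMn2l => //; rewrite mulr_ge0 // invr_ge0 exprn_ge0 // ltW.
rewrite -[leLHS]mulr_natr natrM natrX le_eqVlt; apply/orP; left; apply/eqP.
by field; lra.
Qed.

Definition block m := log_sum X (primes_in (m.+1 ^ 4) (m.+2 ^ 4)).

(** With q = m + 1, the expectation of q^2 block^2 is O(q^-2), so the nonnegative series has finite
    expectation and is almost surely finite. The summand dominates |block|, as needed for
    [cvg_of_blocks]. *)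
Lemma ae_block_sum : {ae P, forall w, exists B : R, forall n,
  \sum_(0 <= m < n) (m.+1%:R ^- 2 + m.+1%:R ^+ 2 * block m w ^+ 2) <= B}.
Proof.
pose f m w : \bar R := (m.+1%:R ^+ 2 * block m w ^+ 2)%:E.
have mf m : measurable_fun setT (fun w => m.+1%:R ^+ 2 * block m w ^+ 2).
  apply: measurable_funM => //; apply: measurable_funX; exact: measurable_log_sum.
have mf' m : measurable_fun setT (f m) by apply/measurable_EFinP; exact: mf.
have f0 m w : (0 <= f m w)%E by rewrite lee_fin mulr_ge0 // sqr_ge0.
have If m : (\int[P]_w f m w <= (sqr_cst * m.+1%:R ^- 2)%:E)%E.
  have mg : measurable_fun setT (fun y : R => m.+1%:R ^+ 2 * y ^+ 2).
    by apply: measurable_funM => //; apply: measurable_funX; exact: measurable_id.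
  have := integral_walk_ge0 HX (s := primes_in (m.+1 ^ 4) (m.+2 ^ 4))
    (primes_in_uniq _ _) _ mg (fun y => mulr_ge0 (sqr_ge0 _) (sqr_ge0 _)).
  move=> ->; last by apply/allP => p; rewrite mem_primes_in => /andP[].
  rewrite EN_scale lee_fin.
  have q0 : (0 : R) < m.+1%:R by rewrite ltr0n.
  apply: (@le_trans _ _ (m.+1%:R ^+ 2 * (sqr_cst * (m.+1 ^ 4)%:R^-1))).
    by rewrite ler_wpM2l ?sqr_ge0 // EN_sqr_le // expn_gt0.
  by rewrite natrX le_eqVlt; apply/orP; left; apply/eqP; field; lra.
have S : (\int[P]_w (\sum_(0 <= m <oo) f m w) <= (2 * sqr_cst)%:E)%E.
  rewrite integral_nneseries //; apply: lime_le.
    by apply: is_cvg_nneseries => n _ _; apply: integral_ge0 => w _.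
  apply: nearW => n; apply: le_trans (lee_sum _ (fun m _ => If m)) _.
  rewrite sumEFin lee_fin -mulr_sumr mulrC ler_wpM2r ?sqr_cst_ge0 //.
  apply: le_trans (sum_inv_sq n) _; rewrite lerBlDr lerDl //.
have If' : P.-integrable setT (fun w => \sum_(0 <= m <oo) f m w)%E.
  apply/integrableP; split.
    by apply: ge0_emeasurable_sum => // n w _ _.
  rewrite (eq_integral (fun w => \sum_(0 <= m <oo) f m w)%E).
    by apply: le_lt_trans S _; rewrite ltry.
  by move=> w _; rewrite gee0_abs //; apply: nneseries_ge0 => n _ _.
have := integrable_ae measurableT If'; apply: filterS => w /(_ I) fin.
exists (2 + fine (\sum_(0 <= m <oo) f m w)%E) => n.
rewrite big_split /= lerD //.
  by apply: le_trans (sum_inv_sq n) _; rewrite lerBlDr lerDl.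
rewrite -lee_fin fineK // -sumEFin; exact: (nneseries_lim_ge n (fun m _ _ => f0 m w)).
Qed.

Lemma ae_cvg_log_sum : {ae P, forall w, cvgn (fun N => log_sum X (primes_in 0 N) w)}.
Proof.
move: ae_in_support ae_block_sum; apply: filterS2 => w w3 [B HB].
apply: (@cvg_of_blocks R _ (fun m => m.+1%:R ^- 2 + m.+1%:R ^+ 2 * block m w ^+ 2) B 30) => //; last first.
  by move=> m n; exact: sum_log_factor_block.
move=> m; set a := (m.+1 ^ 4)%N; set b := (m.+2 ^ 4)%N.
have -> : primes_in 0 b = primes_in 0 a ++ primes_in a b.
  by apply: primes_in_cat; rewrite leq0n /= leq_exp2r.
rewrite {1}/log_sum big_cat /= [X in `|X - _|]addrC addrK -/(log_sum _ _ _).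
have -> : log_sum X (primes_in a b) w = block m w by [].
have q0 : (0 : R) < m.+1%:R by rewrite ltr0n.
set z := block m w; set q := m.+1%:R in q0 *.
(* The arithmetic-geometric inequality |z| <= q^-2 + q^2 z^2 turns second moments into absolute
   summability. *)
have h : 0 <= (q^-1 - q * `|z|) ^+ 2 by exact: sqr_ge0.
have z2 : z ^+ 2 = `|z| ^+ 2 by rewrite real_normK ?num_real.
have h3 : 0 <= `|z| by [].
rewrite z2 -exprVn; rewrite sqrrB exprMn mulrA mulVf ?mul1r in h; [|by rewrite gt_eqF].
rewrite -[_ *+ 2]mulr_natr in h.
by move: h h3; rewrite -?z2; move: (q^-1 ^+ 2) (q ^+ 2 * _) => A B0 h h3; clear -h h3; lra.
Qed.

End AlmostSure.

(** * Passage to the limit *)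

Section MeasurableLimits.
Context {R : realType} {d : measure_display} {T : measurableType d}.

(** Cauchy's criterion with tolerances 1/(k+1) expresses convergence by countable unions and
    intersections. *)
Lemma measurable_cvg_set (g : nat -> T -> R) :
  (forall n, measurable_fun setT (g n)) ->
  measurable [set w | cvgn (g ^~ w)].
Proof.
move=> mg.
have -> : [set w | cvgn (g ^~ w)] =
    \bigcap_(k in setT) \bigcup_(M in setT) \bigcap_(n in setT)
      [set w | `|g (M + n)%N w - g M w| <= k.+1%:R^-1].
  apply/seteqP; split => w /=.
    move=> /cvgrPdist_le cg k _.
    have k0 : 0 < k.+1%:R^-1 / 2 :> R by rewrite divr_gt0 ?invr_gt0 ?ltr0n.
    have [M _ HM] := cg _ k0; exists M => // n _ /=.
    have h1 := HM (M + n)%N (leq_addr _ _); have h2 := HM M (leqnn M).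
    rewrite (_ : g (M + n)%N w - g M w = (limn (g^~ w) - g M w) - (limn (g^~ w) - g (M + n)%N w)); last by ring.
    by apply: (le_trans (ler_normB _ _)); rewrite [leRHS]splitr lerD.
  move=> H; apply/cauchy_cvgP/cauchy_exP => e e0.
  pose k := Num.bound e^-1.
  have ke : k.+1%:R^-1 < e.
    rewrite -[e]invrK ltf_pV2 ?posrE ?invr_gt0 ?ltr0n //.
    apply: (lt_trans (archi_boundP _)); first by rewrite invr_ge0 ltW.
    by rewrite ltr_nat.
  have [M _ HM] := H k I; exists (g M w); exists M => // n /= Mn.
  have := HM (n - M)%N I; rewrite /= subnKC // => h.
  by rewrite /ball /= distrC; apply: le_lt_trans ke.
apply: bigcap_measurableType => k _; apply: bigcup_measurable => M _.
apply: bigcap_measurableType => n _.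
have mf : measurable_fun setT (fun w => `|g (M + n)%N w - g M w|).
  by apply: measurableT_comp => //; exact: measurable_funB.
rewrite (_ : [set _ | _] = (fun w => `|g (M + n)%N w - g M w|) @^-1` `]-oo, k.+1%:R^-1]); last first.
  by apply/seteqP; split => w /=; rewrite in_itv.
by rewrite -[X in measurable X]setTI; exact: mf.
Qed.

(** Off the convergence set [limn] takes the default value [point]; replacing g by that constant
    there gives a sequence converging everywhere to the same function. *)
Lemma measurable_limn (g : nat -> T -> R) :
  (forall n, measurable_fun setT (g n)) ->
  measurable_fun setT (fun w => limn (g ^~ w)).
Proof.
move=> mg; pose D := [set w | cvgn (g ^~ w)].
have mD : measurable D by exact: measurable_cvg_set.
pose c : R := point.
apply: (@measurable_realfun.measurable_fun_cvg d T R setT (fun n w => g n w * \1_D w + c * \1_(~` D) w) (fun w => limn (g ^~ w))).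
  move=> n; apply: measurable_funD; apply: measurable_funM => //.
  by apply: measurable_indic; exact: measurableC.
move=> w _; rewrite !indicE in_setC; case: (boolP (w \in D)); rewrite ?inE /= => Dw.
  rewrite mulr0; under eq_fun do rewrite mulr1 addr0.
  exact: Dw.
rewrite mulr1; under eq_fun do rewrite mulr0 add0r.
rewrite notin_setE in Dw; rewrite dvgP //; exact: cvg_cst.
Qed.

Definition trunc (K x : R) : R := Num.max (- K) (Num.min K x).

Lemma trunc_bound (K x : R) : 0 <= K -> `|trunc K x| <= K.
Proof.
move=> K0; rewrite /trunc ler_norml le_max lexx /= ge_max ge_min lexx /= andbT; lra.
Qed.

Lemma trunc_dist (K x : R) : 0 < K -> `|x - trunc K x| <= x ^+ 2 / K.
Proof.
move=> K0; rewrite ler_pdivlMr // /trunc.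
have [xK|Kx] := leP K x; first by rewrite max_r ?ger0_norm; nra.
have [Nx|xN] := leP (- K) x; first by rewrite subrr normr0 mul0r sqr_ge0.
by rewrite ltr0_norm; nra.
Qed.

Lemma continuous_trunc (K : R) : continuous (trunc K).
Proof.
move=> x; rewrite /trunc; apply: (@continuous_max _ _ (fun=> - K) (fun x => Num.min K x)).
  exact: cvg_cst.
by apply: (@continuous_min _ _ (fun=> K) id); [exact: cvg_cst | exact: cvg_id].
Qed.

Variable P : probability T R.

Lemma integrable_bounded (f : T -> R) (K : R) : measurable_fun setT f ->
  (forall w, `|f w| <= K) -> P.-integrable setT (EFin \o f).
Proof.
move=> mf fK; apply: (@le_integrable _ _ _ P setT _ _ (EFin \o cst K)) => //.
- exact/measurable_EFinP.
- by move=> w _ /=; rewrite lee_fin (le_trans (fK w)) // ler_norm.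
- by apply: finite_measure_integrable_cst.
Qed.

(** Bounded second moments give uniform integrability: truncation at K costs at most B/K, uniformly
    in n, and dominated convergence treats the truncations. Fatou's lemma passes the bound to the
    limit. *)
Lemma cvg_Rintegral_sqr_bounded (f : nat -> T -> R) (g : T -> R) (B : R) :
  (forall n, measurable_fun setT (f n)) -> measurable_fun setT g ->
  {ae P, forall w, f ^~ w @ \oo --> g w} ->
  (forall n, \int[P]_w ((f n w) ^+ 2)%:E <= B%:E)%E ->
  P.-integrable setT (EFin \o g) /\ \int[P]_w f n w @[n --> \oo] --> \int[P]_w g w.
Proof.
move=> mf mg fg fB.
have mf2 n : measurable_fun setT (fun w => ((f n w) ^+ 2)%:E).
  by apply/measurable_EFinP; exact: measurable_funX.
have f2ge n w : setT w -> (0 <= (f n w ^+ 2)%:E)%E by rewrite lee_fin sqr_ge0.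
have gB : (\int[P]_w ((g w) ^+ 2)%:E <= B%:E)%E.
  have := fatou P measurableT mf2 f2ge.
  rewrite (@ae_eq_integral _ _ _ P setT (fun w => (g w ^+ 2)%:E)) //; last 3 first.
  - under eq_fun do rewrite -[limn_einf _]oppeK -limn_esupN.
    apply: measurableT_comp => //; apply: measurable_fun_limn_esup => n.
    exact: measurableT_comp.
  - by apply/measurable_EFinP; exact: measurable_funX.
  - apply: filterS fg => w fgw _.
    apply: (cvg_limn_einf_sup _).1.
    by apply: cvg_EFin; [exact: nearW | apply: cvgM].
  move=> /le_trans; apply.
  have [h _] := @cvg_limn_einf_sup _ (fun=> B%:E) B%:E (cvg_cst _).
  rewrite -[leRHS]h !limn_einf_lim.
  apply: lee_lim; [exact: is_cvg_einfs|exact: is_cvg_einfs|].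
  apply: nearW => n; apply: le_ereal_inf_tmp => _ [m /= nm <-].
  by apply: le_trans (fB m); apply: ereal_inf_lbound; exists m.
have int_of_sqr (h : T -> R) : measurable_fun setT h -> (\int[P]_w ((h w) ^+ 2)%:E <= B%:E)%E ->
    P.-integrable setT (EFin \o (fun w => h w ^+ 2)) /\ P.-integrable setT (EFin \o h).
  move=> mh hB.
  have i2 : P.-integrable setT (EFin \o (fun w => h w ^+ 2)).
    apply/integrableP; split; first by apply/measurable_EFinP; exact: measurable_funX.
    rewrite (eq_integral (fun w => (h w ^+ 2)%:E)) => [|w _]; last by rewrite /= ger0_norm ?sqr_ge0.
    by apply: le_lt_trans hB _; rewrite ltry.
  split => //.
  apply: (@le_integrable _ _ _ P setT _ _ (EFin \o (fun w => 1 + h w ^+ 2))) => //.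
  - exact/measurable_EFinP.
  - move=> w _ /=; rewrite lee_fin [leRHS]ger0_norm ?addr_ge0 ?sqr_ge0 //.
    have := sqr_ge0 (1 - `|h w|); rewrite sqrrB real_normK ?num_real // expr1n mul1r.
    have := normr_ge0 (h w); rewrite -[_ *+ 2]mulr_natr; lra.
  - rewrite (_ : _ \o _ = (EFin \o cst 1) \+ (EFin \o (fun w => h w ^+ 2))) //.
    by apply: integrableD => //; exact: finite_measure_integrable_cst.
have [ig2 ig] := int_of_sqr g mg gB.
have if2 n := (int_of_sqr _ (mf n) (fB n)).1; have if1 n := (int_of_sqr _ (mf n) (fB n)).2.
split => //.
have mt (h : T -> R) K : measurable_fun setT h -> measurable_fun setT (fun w => trunc K (h w)).
  by move=> mh; apply: measurableT_comp => //; apply: continuous_measurable_fun; exact: continuous_trunc.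
have it (h : T -> R) K : 0 < K -> measurable_fun setT h -> P.-integrable setT (EFin \o (fun w => trunc K (h w))).
  by move=> K0 mh; apply: (@integrable_bounded _ K) (mt _ _ mh) _ => w; apply: trunc_bound; exact: ltW.
have B0 : 0 <= B.
  by rewrite -lee_fin (le_trans _ (fB 0%N)) //; apply: integral_ge0 => w _; exact: f2ge.
have tr (h : T -> R) K : 0 < K -> measurable_fun setT h -> (\int[P]_w ((h w) ^+ 2)%:E <= B%:E)%E ->
    `|\int[P]_w h w - \int[P]_w trunc K (h w)| <= B / K.
  move=> K0 mh hB; have [i2 i1] := int_of_sqr h mh hB.
  rewrite -RintegralB //; last exact: it.
  apply: (@le_trans _ _ (\int[P]_w (h w ^+ 2 * K^-1))).
    apply: abs_Rintegral_le.
    - exact: integrable_sub i1 (it _ _ K0 mh).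
    - rewrite (_ : (fun w => _) = (fun w => K^-1 * h w ^+ 2)); last by apply/funext => w; rewrite mulrC.
      exact: integrable_scale.
    - by move=> w; exact: trunc_dist.
  rewrite RintegralZr // ler_wpM2r ?invr_ge0 ?(ltW K0) //.
  by rewrite -lee_fin -RintE.
have dct K : 0 < K -> \int[P]_w trunc K (f n w) @[n --> \oo] --> \int[P]_w trunc K (g w).
  move=> K0.
  have m1 n : measurable_fun setT (fun w => (trunc K (f n w))%:E).
    by apply/measurable_EFinP; apply: mt.
  have m2 : measurable_fun setT (fun w => (trunc K (g w))%:E).
    by apply/measurable_EFinP; apply: mt.
  have c1 : {ae P, forall w, setT w -> (trunc K (f n w))%:E @[n --> \oo] --> (trunc K (g w))%:E}.
    apply: filterS fg => w fgw _; apply: cvg_EFin; first exact: nearW.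
    by apply: continuous_cvg => //; exact: continuous_trunc.
  have c2 : {ae P, forall w, forall n, setT w -> (`|(trunc K (f n w))%:E| <= cst K%:E w)%E}.
    by apply: nearW => w n _; rewrite lee_fin trunc_bound // ltW.
  have iK : P.-integrable setT (cst K%:E) by exact: (finite_measure_integrable_cst P K).
  have [_ _] := dominated_convergence measurableT m1 m2 c1 iK c2.
  rewrite (RintE (it _ _ K0 mg)) => /fine_cvgP[_]; apply: cvg_trans; apply: near_eq_cvg; apply: nearW => n /=.
  by rewrite /Rintegral.
apply/cvgrPdist_le => e e0.
(* Each of the two truncations then costs at most e/4, leaving e/2 for dominated convergence. *)
pose K := 4 * (B + 1) / e.
have K0 : 0 < K by rewrite /K divr_gt0 // mulr_gt0 //; lra.
have e2 : 0 < e / 2 by rewrite divr_gt0.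
move/cvgrPdist_le : (dct K K0) => /(_ _ e2) [M _ HM].
exists M => // n /= Mn; have h1 := HM n Mn.
have h2 := tr _ K K0 (mf n) (fB n); have h3 := tr _ K K0 mg gB.
have h4 : B / K <= e / 4.
  rewrite /K invf_div mulrA ler_pdivrMr; last by rewrite mulr_gt0 //; lra.
  nra.
clear -h1 h2 h3 h4; move: h1 h2 h3; rewrite !ler_norml => /andP[? ?] /andP[? ?] /andP[? ?]; apply/andP; split; lra.
Qed.

End MeasurableLimits.

Section EulerProduct.
Context {R : realType} {d : measure_display} {T : measurableType d}.
Variables (P : probability T R) (X : nat -> {RV P >-> R}).
Hypothesis HX : random_model X.

Definition Y w : R := ln (L1 X w).

Lemma prod_expR_log_sum w N : (forall p, prime p -> in_support X p w) ->
  \prod_(0 <= p < N | prime p) (1 - X p w / p%:R)^-1 = expR (log_sum X (primes_in 0 N) w).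
Proof.
move=> w3; rewrite /log_sum expR_sum /primes_in big_filter; apply: eq_bigr => p pp.
rewrite /log_factor expRN lnK // posrE subr_gt0.
have := w3 p pp; rewrite /in_support /preimage /=.
have p1 : (1 : R) < p%:R by rewrite ltr1n prime_gt1.
rewrite ltr_pdivrMr; last lra.
by case=> [[->|->]|->]; lra.
Qed.

Lemma ae_L1 : {ae P, forall w, 0 < L1 X w /\ (log_sum X (primes_in 0 n) w @[n --> \oo] --> Y w)}.
Proof.
move: (ae_in_support HX) (ae_cvg_log_sum HX); apply: filterS2 => w w3 cw.
have E : L1 X w = expR (limn (fun N => log_sum X (primes_in 0 N) w)).
  rewrite /L1; under eq_fun do rewrite prod_expR_log_sum //.
  apply/cvg_lim => //; apply: continuous_cvg => //; exact: continuous_expR.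
by rewrite /Y E expR_gt0 expRK.
Qed.

Lemma measurable_L1 : measurable_fun setT (L1 X).
Proof.
apply: measurable_limn => N; rewrite (_ : (fun w => _) =
  (fun w => \prod_(p <- primes_in 0 N) (fun w => (1 - X p w / p%:R)^-1) w)); last first.
  by apply/funext => w; rewrite big_filter.
elim: (primes_in 0 N) => [|p s IH].
  by under eq_fun do rewrite big_nil; exact: measurable_cst.
under eq_fun do rewrite big_cons.
apply: measurable_funM => //.
(* The inverse is written through a power of the square, an identity that also holds at x = 0. *)
have E (x : R) : x^-1 = x * (x ^+ 2) `^ (-1).
  have [->|x0] := eqVneq x 0; first by rewrite invr0 mul0r.
  by rewrite powR_inv1 ?sqr_ge0 // expr2 invfM mulrA mulfV // mul1r.
under eq_fun do rewrite E.
suff m1 : measurable_fun setT (fun w => 1 - X p w / p%:R : R).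
  apply: measurable_funM => //; apply: (measurableT_comp (measurable_powR (-1))).
  exact: measurable_funX.
apply: measurable_funB => //; apply: measurable_funM => //; exact: measurable_X.
Qed.

Lemma measurable_Y : measurable_fun setT Y.
Proof. exact: measurable_ln_inv measurable_L1. Qed.

Lemma prod_mgf_bound N (r : R) :
  \prod_(p <- primes_in 0 N) mgf euler_law p r <= expR (2 * mgf_cst r).
Proof.
have -> : primes_in 0 N = primes_in 1 N.
  case: N => [//|N]; rewrite (@primes_in_cat 0 1 N.+1) //.
apply: (le_trans (prod_mgf_le _ _)); rewrite ler_expR mulrC ler_wpM2r ?mgf_cst_ge0 //.
by have := @sum_inv_sq_le R 1 N isT; rewrite invr1 mulr1.
Qed.

(** The square of F is at most exp(2by) + exp(-2by), whose expectations are bounded uniformly in N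
    by [prod_mgf_bound]; convergence then follows from bounded second moments. *)
Lemma limit_EN (F : R -> R) (b : R) : continuous F -> 0 <= b ->
  (forall y, `|F y| <= expR (b * `|y|)) ->
  P.-integrable setT (EFin \o (fun w => F (Y w))) /\
  EN euler_law (primes_in 0 N) F @[N --> \oo] --> \int[P]_w F (Y w).
Proof.
move=> cF b0 Fb.
have mF : measurable_fun setT F by exact: continuous_measurable_fun.
have us N := primes_in_uniq 0 N.
have ap N : all prime (primes_in 0 N) by apply/allP => p; rewrite mem_primes_in => /andP[].
have F2 y : F y ^+ 2 <= 1 * expR (2 * b * y) + expR (- (2 * b) * y).
  have h1 : F y ^+ 2 <= expR (2 * b * `|y|).
    by rewrite -mulrA expRM_natl -[F y ^+ 2]real_normK ?num_real // lerXn2r ?nnegrE ?expR_ge0.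
  apply: (le_trans h1); rewrite mul1r; have [y0|y0] := leP 0 y.
    by rewrite ger0_norm // lerDl expR_ge0.
  by rewrite ltr0_norm // mulrN mulNr lerDr expR_ge0.
have [||||i lim] := @cvg_Rintegral_sqr_bounded _ _ _ P (fun N w => F (log_sum X (primes_in 0 N) w))
   (fun w => F (Y w)) (expR (2 * mgf_cst (2 * b)) + expR (2 * mgf_cst (- (2 * b)))).
- by move=> N; apply: measurableT_comp => //; exact: measurable_log_sum.
- by apply: measurableT_comp => //; exact: measurable_Y.
- by apply: filterS ae_L1 => w [_ cw]; apply: continuous_cvg => //; exact: cF.
- move=> N; rewrite (@integral_walk_ge0 _ _ _ P X HX _ (fun y => F y ^+ 2)) //; last 2 first.
  + exact: measurable_funX.
  + by move=> y; exact: sqr_ge0.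
  rewrite lee_fin; apply: (@le_trans _ _ (EN euler_law (primes_in 0 N)
      (fun y => 1 * expR (2 * b * y) + expR (- (2 * b) * y)))).
    by apply: le_EN => //; exact: euler_is_law.
  by rewrite EN_lin !EN_exp mul1r lerD // prod_mgf_bound.
split => //; apply: cvg_trans lim; apply: near_eq_cvg; apply: nearW => N /=.
by have [_ ->] := integral_log_sum HX (us N) (ap N) mF.
Qed.

End EulerProduct.

(** * Exponential moments of the limit and their derivatives *)

Section Moments.
Context {R : realType} {d : measure_display} {T : measurableType d}.
Variables (P : probability T R) (X : nat -> {RV P >-> R}).
Hypothesis HX : random_model X.
Implicit Types (k t th r y : R) (j : nat).

Let L := euler_law (R := R).

Definition Mom j k : R := \int[P]_w (Y X w ^+ j * expR (k * Y X w)).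

Lemma pow_expR_bound j k y : `|y ^+ j * expR (k * y)| <= expR ((`|k| + j%:R) * `|y|).
Proof.
rewrite normrM normrX (ger0_norm (expR_ge0 _)) addrC mulrDl expRD.
apply: ler_pM => //; rewrite ?expR_ge0 ?exprn_ge0 //.
  rewrite expRM_natl lerXn2r ?nnegrE ?expR_ge0 //.
  by apply: le_trans (expR_ge1Dx _); rewrite lerDr.
by rewrite ler_expR (le_trans (ler_norm _)) // normrM.
Qed.

Lemma continuous_pow_expR j k : continuous (fun y => y ^+ j * expR (k * y)).
Proof.
move=> y; apply: cvgM; first exact: exprn_continuous.
apply: continuous_cvg; first exact: continuous_expR.
by apply: cvgM; [exact: cvg_cst | exact: cvg_id].
Qed.

Lemma Mom_limit j k :
  P.-integrable setT (EFin \o (fun w => Y X w ^+ j * expR (k * Y X w))) /\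
  EN L (primes_in 0 N) (fun y => y ^+ j * expR (k * y)) @[N --> \oo] --> Mom j k.
Proof.
apply: (limit_EN HX (@continuous_pow_expR j k) _ (pow_expR_bound j k)).
by rewrite addr_ge0.
Qed.

Lemma Mom0E k : Mom 0 k = \int[P]_w expR (k * Y X w).
Proof. by apply: eq_Rintegral => w _; rewrite expr0 mul1r. Qed.

Lemma integrable_expR k : P.-integrable setT (EFin \o (fun w => expR (k * Y X w))).
Proof.
by apply: eq_integrable (Mom_limit 0 k).1 => // w _ /=; rewrite expr0 mul1r.
Qed.

Lemma prod_mgf_limit k : \prod_(p <- primes_in 0 N) mgf L p k @[N --> \oo] --> Mom 0 k.
Proof.
have := (Mom_limit 0 k).2; under eq_fun do under eq_EN do rewrite expr0 mul1r.
by under eq_fun do rewrite EN_exp.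
Qed.

Lemma Mom0_le k : Mom 0 k <= expR (2 * mgf_cst k).
Proof.
rewrite -(cvg_lim _ (prod_mgf_limit (k := k))) //; apply: limr_le.
  by apply/cvg_ex; eexists; exact: prod_mgf_limit.
by apply: nearW => N; exact: prod_mgf_bound.
Qed.

Lemma Rint_cst (c : R) : \int[P]_w c = c.
Proof. rewrite /Rintegral integral_cst //; transitivity (fine (c%:E * 1)%E).
  congr (fine (_ * _)%E); exact: probability_setT.
by rewrite mule1. Qed.

Lemma integrable_cst (c : R) : P.-integrable setT (EFin \o (fun=> c)).
Proof. exact: (finite_measure_integrable_cst P c). Qed.

Lemma integrable_Y : P.-integrable setT (EFin \o Y X).
Proof.
apply: eq_integrable (Mom_limit 1 0).1 => // w _ /=.
by rewrite mul0r expR0 mulr1 expr1.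
Qed.

(** Jensen's inequality, by integrating the tangent line of exp at the point [c]. *)
Lemma Mom0_ge k : expR (k * \int[P]_w Y X w) <= Mom 0 k.
Proof.
set c := k * _; rewrite Mom0E.
have iY := integrable_Y; have ie := integrable_expR k.
suff : \int[P]_w (expR c + (expR c * k) * Y X w - expR c * c) <= \int[P]_w expR (k * Y X w).
  apply: le_trans; rewrite RintegralB //; first last.
  - exact: integrable_cst.
  - by apply: integrable_add; [exact: integrable_cst | exact: integrable_scale].
  rewrite RintegralD //; first last.
  - exact: integrable_scale.
  - exact: integrable_cst.
  by rewrite RintegralZl // !Rint_cst -mulrA -/c addrK.
apply: le_Rintegral => //.
- apply: integrable_sub; last exact: integrable_cst.
  by apply: integrable_add; [exact: integrable_cst | exact: integrable_scale].
- move=> w _; have := expR_ge1Dx (k * Y X w - c).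
  rewrite expRB ler_pdivlMr ?expR_gt0 // => h.
  by apply: le_trans h; rewrite le_eqVlt; apply/orP; left; apply/eqP; ring.
Qed.

Lemma Mom0_gt0 k : 0 < Mom 0 k.
Proof. by apply: lt_le_trans (Mom0_ge k); exact: expR_gt0. Qed.

(** Jensen at k and at -k gives Mom 0 k * Mom 0 (-k) >= 1; the resulting bound does not depend on
    the probability space. *)
Lemma Mom0_inv_le k : (Mom 0 k)^-1 <= expR (2 * mgf_cst (- k)).
Proof.
apply: (@le_trans _ _ (Mom 0 (- k))); last exact: Mom0_le.
apply: le_trans (Mom0_ge (- k)); rewrite mulNr expRN lef_pV2 ?posrE ?expR_gt0 ?Mom0_gt0 //.
exact: Mom0_ge.
Qed.

Lemma is_derive_expR_scal y k : is_derive k (1:R) (fun k => expR (k * y)) (y * expR (k * y)).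
Proof.
have h := is_derive1_comp (is_derive_expR _) (is_deriveM
  (is_derive_id (k : R^o) (1:R)) (is_derive_cst (y : R^o) k (1:R))).
apply: (is_derive_eq h).
by rewrite /GRing.scale /= ?fctE /=; ring.
Qed.

Lemma is_derive_Mom j k : is_derive k (1:R) (Mom j) (Mom j.+1 k).
Proof.
pose f k w := Y X w ^+ j * expR (k * Y X w).
have df r w : is_derive r (1:R) (f ^~ w) (Y X w ^+ j.+1 * expR (r * Y X w)).
  have h := is_deriveM (is_derive_cst (Y X w ^+ j : R^o) r (1:R)) (is_derive_expR_scal (Y X w) r).
  by apply: (is_derive_eq h); rewrite /GRing.scale /= ?fctE /= exprS; ring.
have kI : `]k - 1, k + 1[%classic k by rewrite /= in_itv /= ltrBlDr ltrDl ltr01.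
(* On the interval of radius 1 about k this bounds |r|, and the power of order j + 1 is absorbed
   into exp((j+1)|y|). *)
pose b := `|k| + 1 + j.+1%:R.
pose G w := expR (b * `|Y X w|).
have b0 : 0 <= b by rewrite !addr_ge0.
have iG : P.-integrable setT (EFin \o G).
  apply: (limit_EN HX (F := fun y => expR (b * `|y|)) (b := b) _ b0 _).1.
    move=> y; apply: continuous_cvg; first exact: continuous_expR.
    by apply: cvgM; [exact: cvg_cst | exact: norm_continuous].
  by move=> y; rewrite ger0_norm ?expR_ge0.
have Gub r w : `]k - 1, k + 1[%classic r -> setT w -> `|partial1of2 f r w| <= G w.
  move=> rI _; rewrite partial1of2E; have [_ ->] := df r w.
  apply: (le_trans (pow_expR_bound _ _ _)); rewrite ler_expR ler_wpM2r // lerD2r.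
  move: rI; rewrite /= in_itv /= => /andP[h1 h2].
  rewrite -lerBlDl; apply: le_trans (lerB_dist _ _) _.
  by rewrite ler_norml; apply/andP; split; lra.
have D1 := @derivable_under_integral R _ _ P f setT measurableT k (k - 1) (k + 1) kI
  (fun r _ => (Mom_limit j r).1) (fun r w _ _ => let: DeriveDef d _ := df r w in d)
  _ (fun w => expR_ge0 _) iG Gub.
have D2 := @differentiation_under_integral R _ _ P f setT measurableT k (k - 1) (k + 1) kI
  (fun r _ => (Mom_limit j r).1) (fun r w _ _ => let: DeriveDef d _ := df r w in d)
  _ (fun w => expR_ge0 _) iG Gub.
apply: DeriveDef; first exact: D1.
rewrite -derive1E D2; apply: eq_Rintegral => w _; rewrite partial1of2E.
by have [_ ->] := df k w.
Qed.

Lemma momentL1E r : momentL1 X r = Mom 0 r.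
Proof.
rewrite Mom0E /momentL1 unlock /expectation /Rintegral; congr fine.
apply: ae_eq_integral => //.
- apply/measurable_EFinP; apply: (measurableT_comp (measurable_powR r)); exact: measurable_L1.
- apply/measurable_EFinP; apply: measurableT_comp => //.
  by apply: measurable_funM => //; exact: measurable_Y.
- apply: filterS (ae_L1 HX) => w [Lp _] _.
  by rewrite /powR gt_eqF.
Qed.

Definition limit_mean k := Mom 1 k / Mom 0 k.
Definition limit_var k := Mom 2 k / Mom 0 k - limit_mean k ^+ 2.

Lemma calLE : calL X = (fun r => ln (Mom 0 r)).
Proof. by apply/funext => r; rewrite /calL momentL1E. Qed.

Lemma is_derive_calL k : is_derive k (1:R) (calL X) (limit_mean k).
Proof.
rewrite calLE.
have h := is_derive1_comp (is_derive1_ln (Mom0_gt0 k)) (is_derive_Mom 0 k).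
by apply: (is_derive_eq h); rewrite /limit_mean mulrC.
Qed.

Lemma derive1_calL : derive1 (calL X) = limit_mean.
Proof. by apply/funext => k; rewrite derive1E; have [_ ->] := is_derive_calL k. Qed.

Lemma is_derive_limit_mean k : is_derive k (1:R) limit_mean (limit_var k).
Proof.
have M0 : Mom 0 k != 0 by rewrite gt_eqF // Mom0_gt0.
have h := is_deriveM (is_derive_Mom 1 k) (is_deriveV M0 (is_derive_Mom 0 k)).
apply: (is_derive_eq h); rewrite /limit_var /limit_mean /GRing.scale /= ?fctE.
by field.
Qed.

Lemma derive2_calL k : derive1n 2 (calL X) k = limit_var k.
Proof. by rewrite /= derive1_calL derive1E; have [_ ->] := is_derive_limit_mean k. Qed.

Lemma limit_var_ge0 k : 0 <= limit_var k.
Proof.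
have M0 := Mom0_gt0 k; set m := limit_mean k.
have i0 := integrable_expR k; have i1 := (Mom_limit 1 k).1; have i2 := (Mom_limit 2 k).1.
have : 0 <= \int[P]_w ((Y X w - m) ^+ 2 * expR (k * Y X w)).
  by apply: Rintegral_ge0 => w _; apply: mulr_ge0 (sqr_ge0 _) (expR_ge0 _).
have -> : (fun w => (Y X w - m) ^+ 2 * expR (k * Y X w)) =
   (fun w => Y X w ^+ 2 * expR (k * Y X w) + (- 2 * m * (Y X w ^+ 1 * expR (k * Y X w))
      + m ^+ 2 * expR (k * Y X w))) by apply/funext => w; ring.
rewrite RintegralD //; last first.
  by apply: integrable_add; exact: integrable_scale.
rewrite RintegralD //; [|exact: integrable_scale..].
rewrite !RintegralZl // -Mom0E -/(Mom 1 k) -/(Mom 2 k).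
have -> : Mom 2 k + (- 2 * m * Mom 1 k + m ^+ 2 * Mom 0 k) = Mom 0 k * limit_var k.
  by rewrite /limit_var /m /limit_mean; field; rewrite gt_eqF.
by rewrite pmulr_rge0.
Qed.

Lemma limit_mean_ndecr k r : k <= r -> limit_mean k <= limit_mean r.
Proof.
move=> kr; have [E|lt] := eqVneq k r; first by rewrite E.
have {}kr : k < r by rewrite lt_neqAle lt.
apply: (@ger0_derive1_ndecr _ limit_mean (k - 1) (r + 1)) => //; try lra.
- by move=> x _; have [] := is_derive_limit_mean x.
- by move=> x _; rewrite derive1E; have [_ ->] := is_derive_limit_mean x; exact: limit_var_ge0.
- apply: continuous_subspaceT; exact: continuous_is_derive is_derive_limit_mean.
Qed.

(** From y <= exp(y), the first moment at k is at most the zeroth at k + 1. This explicit bound, the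
    same for every model, is what fixes the threshold on tau. *)
Lemma limit_mean_le k : limit_mean k <= expR (2 * mgf_cst (k + 1) + 2 * mgf_cst (- k)).
Proof.
have M0 := Mom0_gt0 k; rewrite /limit_mean expRD.
apply: (@le_trans _ _ (Mom 0 (k + 1) / Mom 0 k)).
  apply: ler_wpM2r; first by rewrite invr_ge0 ltW.
  rewrite Mom0E.
  apply: le_Rintegral => //; [exact: (Mom_limit 1 k).1|exact: integrable_expR|].
  move=> w _; rewrite mulrDl expRD mul1r mulrC ler_wpM2l ?expR_ge0 // expr1.
  by apply: le_trans (expR_ge1Dx _); rewrite lerDr.
apply: ler_pM (Mom0_le _) (Mom0_inv_le _); [exact/ltW/Mom0_gt0 | by rewrite invr_ge0 ltW].
Qed.

Lemma tilt_limit k (F : R -> R) a : continuous F ->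
  (forall y, `|F y| <= expR (a * `|y|)) -> 0 <= a ->
  EN (tilt L k) (primes_in 0 N) F @[N --> \oo] -->
    (\int[P]_w (expR (k * Y X w) * F (Y X w))) / Mom 0 k.
Proof.
move=> cF Fa a0.
have H : (fun N => EN (tilt L k) (primes_in 0 N) F) =
   (fun N => EN L (primes_in 0 N) (fun y => expR (k * y) * F y) / \prod_(p <- primes_in 0 N) mgf L p k).
  apply/funext => N; rewrite EN_tilt; last exact: euler_is_law.
  rewrite mulrAC mulfV ?mul1r // gt_eqF //.
  by apply: prodr_gt0 => p _; apply: mgf_gt0; exact: euler_is_law.
rewrite H; apply: cvgM; last first.
  by apply: cvgV; [rewrite gt_eqF // Mom0_gt0 | exact: prod_mgf_limit].
apply: (limit_EN HX (F := fun y => expR (k * y) * F y) (b := `|k| + a) _ _ _).2.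
- move=> y; apply: cvgM; last exact: cF.
  apply: continuous_cvg; first exact: continuous_expR.
  by apply: cvgM; [exact: cvg_cst | exact: cvg_id].
- by rewrite addr_ge0.
- move=> y; rewrite normrM ger0_norm ?expR_ge0 // mulrDl expRD.
  apply: ler_pM => //; rewrite ?expR_ge0 //.
  by rewrite ler_expR (le_trans (ler_norm _)) // normrM.
Qed.

Lemma tilt_limit_pow j k :
  EN (tilt L k) (primes_in 0 N) (fun y => y ^+ j) @[N --> \oo] --> Mom j k / Mom 0 k.
Proof.
have -> : Mom j k = \int[P]_w (expR (k * Y X w) * Y X w ^+ j).
  by apply: eq_Rintegral => w _; rewrite mulrC.
apply: (@tilt_limit k (fun y => y ^+ j) j%:R) => //; first exact: exprn_continuous.
move=> y; have := pow_expR_bound j 0 y.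
by rewrite mul0r expR0 mulr1 normr0 add0r.
Qed.

Lemma meanN_limit k : meanN k N @[N --> \oo] --> limit_mean k.
Proof.
have Lk := is_law_tilt k (@euler_is_law R).
rewrite (_ : (fun N => _) = (fun N => EN (tilt L k) (primes_in 0 N) (fun y => y ^+ 1))).
  exact: tilt_limit_pow.
apply/funext => N; rewrite (@eq_EN _ _ _ _ (fun y => y + 0)) => [|y]; last by rewrite addr0.
by rewrite EN_id // addr0.
Qed.

Lemma varN_limit k : varN k N @[N --> \oo] --> limit_var k.
Proof.
have Lk := is_law_tilt k (@euler_is_law R).
rewrite (_ : (fun N => _) = (fun N => EN (tilt L k) (primes_in 0 N) (fun y => y ^+ 2) - meanN k N ^+ 2)).
  apply: cvgB; first exact: tilt_limit_pow.
  by apply: cvgM; exact: meanN_limit.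
apply/funext => N; rewrite (@eq_EN _ _ _ _ (fun y => (y + 0) ^+ 2)) => [|y]; last by rewrite addr0.
by rewrite EN_sqr // addr0 addrK.
Qed.

Lemma limit_var_le k : 48 <= k -> limit_var k <= var_cst * (74 / (k * ln k)).
Proof.
move=> k48; rewrite -(cvg_lim _ (varN_limit (k := k))) //; apply: limr_le.
  by apply/cvg_ex; eexists; exact: varN_limit.
by apply: nearW => N; exact: varN_le.
Qed.

Lemma limit_var_ge k : 48 <= k -> ab_cst / (96 ^+ 2 * 16) / (k * ln k) <= limit_var k.
Proof.
move=> k48; rewrite -(cvg_lim _ (varN_limit (k := k))) //; apply: limr_ge.
  by apply/cvg_ex; eexists; exact: varN_limit.
have [N0 HN] := varN_ge k48; by exists N0 => // N /= /HN.
Qed.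

Lemma cos_limit k t th : EN (tilt L k) (primes_in 0 N) (fun y => cos (t * y + th)) @[N --> \oo] -->
  \int[P]_w (expR (k * Y X w) / Mom 0 k * cos (t * Y X w + th)).
Proof.
have -> : \int[P]_w (expR (k * Y X w) / Mom 0 k * cos (t * Y X w + th)) =
   \int[P]_w (expR (k * Y X w) * cos (t * Y X w + th)) / Mom 0 k.
  rewrite -RintegralZr //; first by apply: eq_Rintegral => w _; ring.
  apply: integrable_bound (integrable_expR k) _.
    apply: measurable_funM.
      by have /measurable_int/measurable_EFinP := integrable_expR k.
    apply: measurableT_comp; first by apply: continuous_measurable_fun; exact: continuous_cos.
    apply: measurable_funD => //; apply: measurable_funM => //; exact: measurable_Y.
  by move=> w; rewrite normrM ger0_norm ?expR_ge0 // ler_piMr ?expR_ge0 // cos_max.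
apply: (@tilt_limit k (fun y => cos (t * y + th)) 0) => //.
- move=> y; apply: (@continuous_comp _ _ _ (fun y => t * y + th) cos); last exact: continuous_cos.
  apply: cvgD; last exact: cvg_cst.
  by apply: cvgM; [exact: cvg_cst | exact: cvg_id].
- by move=> y; rewrite mul0r expR0 cos_max.
Qed.

Lemma tilted_charfun_bound (C : R) :
  (forall k t, 48 <= k -> exists N0, forall N, (N0 <= N)%N -> forall th,
    `|EN (tilt L k) (primes_in 0 N) (fun y => cos (t * y + th)) -
      expR (- (t ^+ 2 * varN k N / 2)) * cos (t * meanN k N + th)|
    <= C * (scale k / k) / (1 + (t / scale k) ^+ 2)) ->
  forall k t th, 48 <= k ->
  `|\int[P]_w (expR (k * Y X w) / Mom 0 k * cos (t * (Y X w - limit_mean k) + th)) -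
    expR (- (t ^+ 2 * limit_var k / 2)) * cos th| <= C * (scale k / k) / (1 + (t / scale k) ^+ 2).
Proof.
move=> HC k t th k48; have [N0 HN] := HC k t k48.
under eq_Rintegral do rewrite mulrBr -addrA [- _ + th]addrC.
(* The shifted phase removes the centering, so that the finite-N bound, valid for every phase, can
   be passed to the limit. *)
set th' := th - t * limit_mean k.
have -> : cos th = cos (t * limit_mean k + th') by rewrite /th' addrC subrK.
set B := _ / (1 + _).
have c : `|EN (tilt L k) (primes_in 0 N) (fun y => cos (t * y + th')) -
    expR (- (t ^+ 2 * varN k N / 2)) * cos (t * meanN k N + th')| @[N --> \oo] -->
   `|\int[P]_w (expR (k * Y X w) / Mom 0 k * cos (t * Y X w + th')) -
    expR (- (t ^+ 2 * limit_var k / 2)) * cos (t * limit_mean k + th')|.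
  apply: cvg_norm; apply: cvgB; first exact: cos_limit.
  apply: cvgM.
    apply: continuous_cvg; first exact: continuous_expR.
    apply: cvgN; apply: cvgM; last exact: cvg_cst.
    by apply: cvgM; [exact: cvg_cst | exact: varN_limit].
  apply: continuous_cvg; first exact: continuous_cos.
  apply: cvgD; last exact: cvg_cst.
  by apply: cvgM; [exact: cvg_cst | exact: meanN_limit].
rewrite -(cvg_lim _ c) //; apply: limr_le; first by apply/cvg_ex; eexists; exact: c.
by exists N0 => // N /= /HN /(_ th').
Qed.

End Moments.

(** * The tail estimate *)

Section Cauchy.
Context {R : realType}.
Notation mu := (@lebesgue_measure R).

Lemma integral_cauchy (D S : R) : 0 <= D -> 0 < S ->
  mu.-integrable setT (EFin \o (fun t => D / (1 + (t / S) ^+ 2))) /\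
  \int[mu]_t (D / (1 + (t / S) ^+ 2)) = D * S * pi.
Proof.
move=> D0 S0; pose f t := D / (1 + (t / S) ^+ 2).
have den t : 0 < 1 + (t / S) ^+ 2 :> R by rewrite ltr_pwDl // sqr_ge0.
have f0 t : 0 <= f t by rewrite divr_ge0 // ltW.
have cf : continuous f.
  move=> t; apply: cvgM; first exact: cvg_cst.
  apply: cvgV; first by rewrite gt_eqF.
  apply: cvgD; first exact: cvg_cst.
  by apply: cvgM; apply: cvgM; [exact: cvg_id | exact: cvg_cst | exact: cvg_id | exact: cvg_cst].
have dF t : is_derive t (1:R) (fun t => D * S * atan (t / S)) (f t).
  have h := is_deriveM (is_derive_cst (D * S : R^o) t (1:R)) (is_derive1_comp (f := atan) (g := fun t => t / S) (is_derive1_atan (t / S))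
    (is_deriveM (is_derive_id (t : R^o) (1:R)) (is_derive_cst (S^-1 : R^o) t (1:R)))).
  apply: (is_derive_eq h); rewrite /f /GRing.scale /= ?fctE /=.
  by move: (den t); move: (1 + _) => q q0; field; rewrite !gt_eqF.
have If : (\int[mu]_t (f t)%:E = (D * S * pi)%:E)%E.
  rewrite ge0_symfun_integralT //; last first.
    by move=> t; rewrite /f /= mulNr sqrrN.
  rewrite (_ : [set x | (0 <= x)%R] = `[0%R, +oo[%classic); last first.
    by apply/seteqP; split => x /=; rewrite in_itv /= andbT.
  rewrite (@ge0_continuous_FTC2y _ f (fun t => D * S * atan (t / S)) 0 (D * S * (pi / 2))) //.
  - by rewrite mul0r atan0 mulr0 sube0 -EFinM; congr EFin; field.
  - exact: continuous_subspaceT.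
  - apply: cvgM; first exact: cvg_cst.
    apply: (@cvg_comp _ _ _ (fun t => t / S) atan _ +oo%R); last exact: cvgy_atan.
    by apply: gt0_cvgMly; [rewrite invr_gt0 | exact: cvg_id].
  - apply: cvg_at_right_filter; exact: (continuous_is_derive dF).
  - by move=> x _; rewrite derive1E; have [_ ->] := dF x.
split; last by rewrite /Rintegral If.
apply/integrableP; split.
  by apply/measurable_EFinP; exact: continuous_measurable_fun.
have E : (fun t => `|(EFin \o f) t|%E) = EFin \o f.
  by apply/funext => t /=; rewrite ger0_norm.
change (\int[mu]_x `|(EFin \o f) x| < +oo)%E.
by rewrite E If ltry.
Qed.

Lemma ln_le_2sqrt (k : R) : 0 < k -> ln k <= 2 * Num.sqrt k.
Proof.
move=> k0; have s0 : 0 < Num.sqrt k by rewrite sqrtr_gt0.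
rewrite -{1}(sqr_sqrtr (ltW k0)) lnXn // mulr_natl lerMn2r /=.
by have := expR_ge1Dx (ln (Num.sqrt k)); rewrite lnK ?posrE //; lra.
Qed.

(** As ln k <= 2 sqrt k, the square of the left side is at most 2 q^2/sqrt k, which is at most 1/4
    once sqrt k >= 8 q^2. *)
Lemma sqrt_ln_div_small (q k : R) : 0 <= q -> 0 < k -> (8 * q ^+ 2) ^+ 2 <= k ->
  q * Num.sqrt (ln k / k) <= 1 / 2.
Proof.
move=> q0 k0 qk; have s0 : 0 < Num.sqrt k by rewrite sqrtr_gt0.
have h : 8 * q ^+ 2 <= Num.sqrt k.
  by rewrite -(ler_pXn2r (n := 2)) ?nnegrE ?sqrtr_ge0 ?mulr_ge0 ?sqr_ge0 // sqr_sqrtr // ltW.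
have e : ln k / k <= 2 / Num.sqrt k.
  rewrite -{2}(sqr_sqrtr (ltW k0)) ler_pdivrMr ?exprn_gt0 //.
  rewrite (_ : 2 / _ * _ = 2 * Num.sqrt k); first exact: ln_le_2sqrt.
  by field; rewrite gt_eqF.
case: (leP 0 (ln k / k)) => [l0|/ltW l0]; last first.
  by rewrite ler0_sqrtr // mulr0 divr_ge0.
rewrite -(ler_pXn2r (n := 2)) ?nnegrE ?mulr_ge0 ?sqrtr_ge0 ?divr_ge0 //.
rewrite exprMn sqr_sqrtr //.
apply: (@le_trans _ _ (q ^+ 2 * (2 / Num.sqrt k))); first by rewrite ler_wpM2l ?sqr_ge0.
rewrite mulrA ler_pdivrMr //; move: h; move: (Num.sqrt k) (q ^+ 2) => s x; lra.
Qed.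

Lemma le0_of_scal (a c : R) : (forall l, 0 < l -> a <= l * c) -> a <= 0.
Proof.
move=> H; rewrite leNgt; apply/negP => a0.
have c0 : 0 < c by have := H 1 ltr01; rewrite mul1r; apply: lt_le_trans.
have := H (a / (2 * c)) (divr_gt0 a0 (mulr_gt0 _ c0)).
rewrite (_ : a / (2 * c) * c = a / 2); last by field; rewrite gt_eqF.
by move=> /(_ ltac:(lra)); lra.
Qed.

End Cauchy.

Section TailEstimate.
Context {R : realType} {d : measure_display} {T : measurableType d}.
Variables (P : probability T R) (X : nat -> {RV P >-> R}).
Hypothesis HX : random_model X.

Lemma in_set_bool (b : T -> bool) w : (w \in [set w | b w]) = b w.
Proof. by apply/idP/idP; rewrite inE. Qed.

Definition above (c : R) w : R := (c < Y X w)%R%:R.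

Lemma measurable_lt_Y (c : R) : measurable_fun setT (above c).
Proof.
rewrite (_ : above c = \1_[set w | c < Y X w]); last first.
  by apply/funext => w; rewrite indicE in_set_bool.
apply: measurable_indic; rewrite (_ : [set w | _] = Y X @^-1` `]c, +oo[%classic).
  by rewrite -[X in measurable X]setTI; exact: measurable_Y.
by apply/seteqP; split => w /=; rewrite in_itv /= andbT.
Qed.

Lemma integrable_bool (b : T -> bool) : measurable_fun setT (fun w => (b w)%:R : R) ->
  P.-integrable setT (EFin \o (fun w => (b w)%:R : R)).
Proof.
move=> mb; apply: (@integrable_bounded _ _ _ P _ 1) => // w.
by case: (b w); rewrite ?normr1 ?normr0.
Qed.

Lemma PhiXE (tau : R) : 0 < tau ->
  PhiX X tau = \int[P]_w above (ln tau + euler_gamma) w.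
Proof.
move=> t0; have mL : measurable [set w | expR euler_gamma * tau < L1 X w].
  rewrite (_ : [set w | _] = L1 X @^-1` `]expR euler_gamma * tau, +oo[%classic); last first.
    by apply/seteqP; split => w /=; rewrite in_itv /= andbT.
  by rewrite -[X in measurable X]setTI; exact: measurable_L1.
rewrite /PhiX /Rintegral; congr fine.
transitivity (\int[P]_w (\1_[set w | expR euler_gamma * tau < L1 X w] w)%:E)%E.
  by rewrite integral_indic // setIT.
apply: ae_eq_integral => //.
- by apply/measurable_EFinP; exact: measurable_indic.
- by apply/measurable_EFinP; exact: measurable_lt_Y.
apply: filterS (ae_L1 HX) => w [Lp _] _; rewrite indicE; congr ((nat_of_bool _)%:R%:E).
have e0 : 0 < expR euler_gamma * tau by rewrite mulr_gt0 ?expR_gt0.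
rewrite in_set_bool /Y addrC -{2}[euler_gamma]expRK -lnM ?posrE ?expR_gt0 // ltr_ln ?posrE //.
Qed.

Variables (C k : R).
Hypothesis C0 : 0 < C.
Hypothesis k48 : 48 <= k.
Hypothesis HC : forall t th,
  `|\int[P]_w (expR (k * Y X w) / Mom X 0 k * cos (t * (Y X w - limit_mean X k) + th)) -
    expR (- (t ^+ 2 * limit_var X k / 2)) * cos th| <= C * (scale k / k) / (1 + (t / scale k) ^+ 2).

Let k0 : 0 < k. Proof. by have := k48; lra. Qed.
Let M := Mom X 0 k.
Let m := limit_mean X k.
Let s2 := limit_var X k.
Let W w := expR (k * Y X w) / M.
Let Z w := Y X w - m.
Let S := scale k.
Let D := C * (S / k).
(** The integral of [B] is D S pi, and D S = C S^2/k = C ln k; dividing by 2 pi gives this value. *)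
Let eps := C / 2 * ln k.
Let N := (Num.sqrt (2 * pi * s2))^-1.
Let B t := D / (1 + (t / S) ^+ 2).

Let M0 : 0 < M. Proof. exact: Mom0_gt0. Qed.
Let lk : 1 <= ln k. Proof. exact: ln_gt0_ge48. Qed.
Let kl0 : 0 < k * ln k. Proof. by rewrite mulr_gt0 // (lt_le_trans ltr01). Qed.
Let S0 : 0 < S. Proof. by rewrite sqrtr_gt0. Qed.
Let S2 : S ^+ 2 = k * ln k. Proof. by rewrite sqr_sqrtr // ltW. Qed.
Let D0 : 0 <= D. Proof. by apply: mulr_ge0 (ltW C0) _; rewrite divr_ge0 // ltW. Qed.

Let s20 : 0 < s2.
Proof.
apply: lt_le_trans (limit_var_ge HX k48).
by rewrite divr_gt0 // divr_gt0 ?ab_cst_gt0 // mulr_gt0 // exprn_gt0.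
Qed.

Let N0 : 0 < N. Proof. by rewrite invr_gt0 sqrtr_gt0 !mulr_gt0 ?pi_gt0. Qed.

Let mZ : measurable_fun setT Z.
Proof. by apply: measurable_funB => //; exact: measurable_Y. Qed.

Let W0 w : 0 <= W w. Proof. by rewrite divr_ge0 ?expR_ge0 // ltW. Qed.

Let iW : P.-integrable setT (EFin \o W).
Proof.
apply: eq_integrable (integrable_scale M^-1 (integrable_expR HX k)) => // w _ /=.
by rewrite mulrC.
Qed.

Let W1 : \int[P]_w W w = 1.
Proof.
by rewrite RintegralZr //; [rewrite -Mom0E mulfV // gt_eqF | exact: integrable_expR].
Qed.

Let iB : (@lebesgue_measure R).-integrable setT (EFin \o B).
Proof. by have [] := integral_cauchy D0 S0. Qed.

Let Beps : \int[@lebesgue_measure R]_t B t <= 2 * pi * eps.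
Proof.
have [_ ->] := integral_cauchy D0 S0.
have E : D * S = C * ln k.
  have -> : D * S = C * (S ^+ 2 / k) by rewrite /D; field; rewrite gt_eqF.
  by rewrite S2; field; rewrite gt_eqF.
by rewrite E /eps le_eqVlt; apply/orP; left; apply/eqP; field.
Qed.

Let char_close t th :
  `|\int[P]_w (W w * cos (t * Z w + th)) - gs s2 t * cos th| <= B t.
Proof.
rewrite /gs (_ : - (s2 / 2 * t ^+ 2) = - (t ^+ 2 * s2 / 2)); last by field.
exact: HC.
Qed.

Let imass (x l : R) (I : T -> R) : 0 < l -> measurable_fun setT I ->
  (forall w, 0 <= I w <= 1) -> (forall w, I w != 0 -> `|Z w - x| <= l) ->
  \int[P]_w (W w * I w) <= 6 * l * (N + eps).
Proof. exact: (interval_mass mZ W0 iW s20 iB Beps char_close). Qed.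

Let measurable_atom : measurable_fun setT (fun w => (Y X w == m)%:R : R).
Proof.
rewrite (_ : (fun w => _) = \1_[set w | Y X w == m]); last first.
  by apply/funext => w; rewrite indicE in_set_bool.
apply: measurable_indic; rewrite (_ : [set w | _] = Y X @^-1` [set m]).
  by rewrite -[X in measurable X]setTI; exact: measurable_Y.
by apply/seteqP; split => w /=; move/eqP.
Qed.

(* [exponential_pdf k] does not vanish at 0, whereas the tail event is strict. *)
Let mass_atom : \int[P]_w (W w * (Y X w == m)%:R) = 0.
Proof.
apply/eqP; rewrite eq_le; apply/andP; split; last first.
  by apply: Rintegral_ge0 => w _; rewrite mulr_ge0.
apply: (@le0_of_scal _ _ (6 * (N + eps))) => l l0.
rewrite mulrCA mulrA; apply: (@imass 0 l) => //.
- by move=> w; case: (_ == _); rewrite ?lexx ler01.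
- move=> w; rewrite /Z; have [->|] := eqVneq (Y X w) m; last by rewrite eqxx.
  by move=> _; rewrite subrr subr0 normr0 ltW.
Qed.

Let A := \int[P]_w (W w * exponential_pdf k (Z w)).

Let expW w c : expR (k * c) / M = W w * expR (- (k * (Y X w - c))).
Proof. by rewrite /W mulrAC -expRD; congr (expR _ / _); ring. Qed.

(** On Y > m the factor exp(kY) of the tilt cancels the decay of the exponential density, leaving a
    constant multiple of the indicator. *)
Lemma tail_eq : \int[P]_w above m w = M * expR (- (k * m)) / k * A.
Proof.
have pw w : W w * exponential_pdf k (Z w) =
    k * (expR (k * m) / M) * above m w + k * (W w * (Y X w == m)%:R).
  rewrite (expW w m) /above /exponential_pdf patchE mem_setE in_itv /= andbT subr_ge0 /Z.
  case: (ltgtP m (Y X w)) => [h|h|<-].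
  - by rewrite mulr1 mulr0 mulr0 addr0 mulNr; ring.
  - by rewrite !mulr0 addr0.
  - by rewrite subrr (mulr0 k) (mulr0 (- k)) oppr0 expR0 /=; ring.
have i1 : P.-integrable setT (EFin \o above m).
  by apply: integrable_bool; exact: measurable_lt_Y.
have i2 : P.-integrable setT (EFin \o (fun w => W w * (Y X w == m)%:R)).
  apply: integrable_bound iW _.
    apply: measurable_funM; last exact: measurable_atom.
    by have /measurable_int/measurable_EFinP := iW.
  by move=> w; rewrite normrM (ger0_norm (W0 w)) ler_piMr //; case: (_ == _); rewrite ?normr1 ?normr0.
have -> : A = k * (expR (k * m) / M) * \int[P]_w above m w.
  rewrite /A; under eq_Rintegral do rewrite pw.
  rewrite RintegralD //; [|exact: integrable_scale|exact: integrable_scale].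
  by rewrite !RintegralZl // mass_atom mulr0 addr0.
have e0 : expR (- (k * m)) * expR (k * m) = 1 by rewrite -expRD addNr expR0.
rewrite (_ : M * _ / k * _ = (expR (- (k * m)) * expR (k * m)) * \int[P]_w above m w).
  by rewrite e0 mul1r.
by field; rewrite !gt_eqF.
Qed.

(** The first term bounds [eps] relative to N, through the upper bound for the variance; the second
    bounds 8/(k^2 s2), through its lower bound. *)
Definition rel_cst : R :=
  C / 2 * Num.sqrt (2 * pi * (var_cst * 74)) + 8 / (ab_cst / (96 ^+ 2 * 16)).

Lemma ln_div_le1 : 0 <= ln k / k <= 1.
Proof.
rewrite divr_ge0 ?(ltW k0) ?(le_trans ler01) //= ler_pdivrMr // mul1r.
by have := expR_ge1Dx (ln k); rewrite lnK ?posrE //; lra.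
Qed.

Lemma tail_rel : `|A - N| <= N * (rel_cst * Num.sqrt (ln k / k)) /\ eps <= N * (rel_cst * Num.sqrt (ln k / k)).
Proof.
have H := laplace_estimate mZ W0 iW W1 s20 iB Beps char_close k0.
have /andP[q0 q1] := ln_div_le1; have sq0 := sqrtr_ge0 (ln k / k).
have c20 : 0 < ab_cst / (96 ^+ 2 * 16) :> R.
  by rewrite divr_gt0 ?ab_cst_gt0 // mulr_gt0 // exprn_gt0.
have e1 : eps <= N * (C / 2 * Num.sqrt (2 * pi * (var_cst * 74)) * Num.sqrt (ln k / k)).
  rewrite /N mulrC ler_pdivlMr ?sqrtr_gt0 ?mulr_gt0 ?pi_gt0 //.
  rewrite /eps -!mulrA ler_wpM2l ?(ltW C0) // ler_wpM2l ?invr_ge0 //.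
  rewrite [leRHS]mulrC -sqrtrM //.
  have -> : ln k * Num.sqrt (2 * (pi * s2)) = Num.sqrt (ln k ^+ 2 * (2 * (pi * s2))).
    by rewrite [RHS]sqrtrM ?sqr_ge0 // sqrtr_sqr ger0_norm // (le_trans ler01).
  rewrite ler_wsqrtr // (_ : ln k / k * _ = ln k ^+ 2 * (2 * (pi * (var_cst * (74 / (k * ln k)))))); last first.
    by field; rewrite !gt_eqF // (lt_le_trans ltr01).
  rewrite ler_wpM2l ?sqr_ge0 // ler_wpM2l // ler_wpM2l ?pi_ge0 //; exact: limit_var_le.
have e2 (c : R) : 0 < c -> c / (k * ln k) <= s2 ->
    8 * N / (k ^+ 2 * s2) <= N * (8 / c * Num.sqrt (ln k / k)).
  move=> cp h2; apply: (@le_trans _ _ (N * (8 / c * (ln k / k)))); last first.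
    rewrite ler_wpM2l ?(ltW N0) // ler_wpM2l //; first by rewrite divr_ge0 // ltW.
    rewrite -{1}(sqr_sqrtr q0) expr2 ler_piMr // -[leRHS]sqrtr1 ler_wsqrtr //.
  have -> : 8 / c * (ln k / k) = 8 / (k ^+ 2 * (c / (k * ln k))).
    by field; rewrite !gt_eqF // (lt_le_trans ltr01).
  rewrite [8 * N]mulrC -mulrA ler_wpM2l ?(ltW N0) // ler_wpM2l //.
  have k2 : 0 < k ^+ 2 by rewrite exprn_gt0.
  have c3 : 0 < c / (k * ln k) by rewrite divr_gt0.
  by rewrite lef_pV2 ?posrE ?(mulr_gt0 k2) // ler_wpM2l // ltW.
have {}e2 := e2 _ c20 (limit_var_ge HX k48).
have c0 : 0 <= 8 / (ab_cst / (96 ^+ 2 * 16)) :> R by rewrite divr_ge0 // ltW.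
rewrite /rel_cst mulrDl mulrDr; split.
  by apply: (le_trans H); exact: lerD.
by apply: (le_trans e1); rewrite lerDl mulr_ge0 ?(ltW N0) // mulr_ge0.
Qed.

(** On m - l < Y <= m one has k (m - Y) <= k l <= 1, so the original measure is at most M exp(-km) e
    times the tilted one, and the tilted mass of the interval is known. *)
Lemma tail_shift l : 0 <= l <= k^-1 ->
  0 <= \int[P]_w above (m - l) w - \int[P]_w above m w
    <= M * expR (- (k * m)) * (6 * expR 1 * l * (N + eps)).
Proof.
move=> /andP[l0 lk1].
have i1 : P.-integrable setT (EFin \o above m).
  by apply: integrable_bool; exact: measurable_lt_Y.
have i2 : P.-integrable setT (EFin \o above (m - l)).
  by apply: integrable_bool; exact: measurable_lt_Y.
rewrite -RintegralB //; set I := fun w => _.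
have I01 w : 0 <= I w <= 1.
  rewrite /I /above; have : (m < Y X w) ==> (m - l < Y X w) by apply/implyP => h; lra.
  by case: (m < _); case: (m - l < _); rewrite //= ?subrr ?subr0 ?lexx ?ler01.
have iI : P.-integrable setT (EFin \o I) by exact: integrable_sub.
apply/andP; split; first by apply: Rintegral_ge0 => w _; have /andP[] := I01 w.
have [l00|ln0] := eqVneq l 0.
  rewrite l00 (_ : I = fun=> 0); last by apply/funext => w; rewrite /I l00 subr0 subrr.
  by rewrite Rint_cst !mulr0 mul0r mulr0.
have {}l0 : 0 < l by rewrite lt_neqAle eq_sym ln0.
have mI : measurable_fun setT I by have /measurable_int/measurable_EFinP := iI.
have Isupp w : I w != 0 -> (m - l < Y X w) && (Y X w <= m).
  rewrite /I /above leNgt; case h : (m - l < _); case h' : (m < _); rewrite ?subrr ?eqxx //.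
  by move: h h'; lra.
have iWI : P.-integrable setT (EFin \o (fun w => W w * I w)).
  apply: integrable_bound iW _.
    by apply: measurable_funM => //; have /measurable_int/measurable_EFinP := iW.
  move=> w; have /andP[h1 h2] := I01 w.
  by rewrite normrM (ger0_norm (W0 w)) (ger0_norm h1) ler_piMr.
apply: (@le_trans _ _ (\int[P]_w (M * expR (- (k * m)) * expR 1 * (W w * I w)))).
  apply: le_Rintegral => //; first exact: integrable_scale.
  move=> w _; rewrite -/(I w); have [->|/Isupp /andP[h1 h2]] := eqVneq (I w) 0; first by rewrite !mulr0.
  have /andP[I0 _] := I01 w; rewrite mulrA ler_peMl //.
  have -> : M * expR (- (k * m)) * expR 1 * W w = expR (- (k * m) + 1 + k * Y X w).
    by rewrite /W !expRD; field; rewrite gt_eqF.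
  rewrite -[leLHS]expR0 ler_expR.
  have : k * l <= 1 by rewrite mulrC -ler_pdivlMr // mul1r.
  nra.
rewrite RintegralZl // -mulrA ler_wpM2l ?mulr_ge0 ?expR_ge0 ?(ltW M0) //.
rewrite (_ : 6 * expR 1 * l * (N + eps) = expR 1 * (6 * l * (N + eps))); last by ring.
rewrite ler_wpM2l ?expR_ge0 //; apply: (@imass 0 l) => // w /Isupp; rewrite /Z subr0 => /andP[h1 h2].
by rewrite ler_norml; apply/andP; split; lra.
Qed.

Let r := rel_cst * Num.sqrt (ln k / k).

Lemma tail_asymptotic (tau : R) : 0 < tau -> m = ln tau + euler_gamma -> r <= 1 / 2 ->
  (exists e : R, `|e| <= r /\
     PhiX X tau = M * expR (- (k * m)) / (k * Num.sqrt (2 * pi * s2)) * (1 + e)) /\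
  (forall l : R, 0 <= l <= k^-1 -> exists e : R, `|e| <= 18 * expR 1 * (l * k) /\
     PhiX X (expR (- l) * tau) = PhiX X tau * (1 + e)).
Proof.
move=> t0 mE r2; have [h1 h2] := tail_rel; rewrite -/r in h1 h2.
have Phi : PhiX X tau = M * expR (- (k * m)) / k * A by rewrite PhiXE // -mE tail_eq.
have NE : (Num.sqrt (2 * pi * s2))^-1 = N by [].
have A2 : N / 2 <= A.
  have : N * r <= N * (1 / 2) by rewrite ler_wpM2l // ltW.
  move: h1; rewrite ler_norml => /andP[? ?]; lra.
have A0 : 0 < A by apply: lt_le_trans A2; rewrite divr_gt0.
have Me : 0 < M * expR (- (k * m)) by rewrite mulr_gt0 ?expR_gt0.
split.
  exists (A / N - 1); split.
    rewrite (_ : A / N - 1 = (A - N) / N); last by field; rewrite gt_eqF.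
    by rewrite normrM normfV (gtr0_norm N0) ler_pdivrMr // mulrC.
  by rewrite Phi invfM NE; field; rewrite !gt_eqF.
move=> l lk1; have /andP[d0 d1] := tail_shift lk1.
exists ((PhiX X (expR (- l) * tau) - PhiX X tau) / PhiX X tau).
have Phi0 : 0 < PhiX X tau by rewrite Phi mulr_gt0 // divr_gt0.
split; last by field; rewrite gt_eqF.
have -> : PhiX X (expR (- l) * tau) - PhiX X tau =
    \int[P]_w above (m - l) w - \int[P]_w above m w.
  rewrite !PhiXE ?mulr_gt0 ?expR_gt0 // lnM ?posrE ?expR_gt0 // expRK -mE.
  by rewrite (_ : - l + ln tau + euler_gamma = m - l) // mE; ring.
rewrite ger0_norm; last by rewrite divr_ge0 // ltW.
rewrite ler_pdivrMr //; apply: (le_trans d1).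
have /andP[l0 _] := lk1.
(* From r <= 1/2, eps <= N/2 and N <= 2A; with the 6 of [tail_shift] this makes 18. *)
have e1 : N + eps <= 3 * A.
  have : N * r <= N * (1 / 2) by rewrite ler_wpM2l // ltW.
  lra.
rewrite Phi (_ : 18 * expR 1 * (l * k) * (M * expR (- (k * m)) / k * A) =
  M * expR (- (k * m)) * (6 * expR 1 * l * (3 * A))); last by field; rewrite gt_eqF.
by rewrite ler_wpM2l ?(ltW Me) // ler_wpM2l // !mulr_ge0 // expR_ge0.
Qed.

End TailEstimate.

Lemma rel_cst_ge0 (R : realType) (C : R) : 0 < C -> 0 <= rel_cst C.
Proof.
move=> C0; apply: addr_ge0; first by rewrite mulr_ge0 ?sqrtr_ge0 // divr_ge0 // ltW.
by rewrite divr_ge0 // divr_ge0 ?(ltW (@ab_cst_gt0 R)) // mulr_ge0 // exprn_ge0.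
Qed.

Theorem theorem4p1 (R : realType) :
  exists C tau0 : R,
    forall (d : measure_display) (T : measurableType d) (P : probability T R)
      (X : nat -> {RV P >-> R}), random_model X ->
    forall tau kappa : R, tau0 <= tau ->
      derive1 (calL X) kappa = ln tau + euler_gamma ->
      (exists eps : R,
         `|eps| <= C * Num.sqrt (ln kappa / kappa) /\
         PhiX X tau =
           momentL1 X kappa * (expR euler_gamma * tau) `^ (- kappa)
           / (kappa * Num.sqrt (2 * pi * derive1n 2 (calL X) kappa))
           * (1 + eps)) /\
      (forall lambda : R, 0 <= lambda <= kappa^-1 ->
         exists eps : R,
           `|eps| <= C * (lambda * kappa) /\
           PhiX X (expR (- lambda) * tau) = PhiX X tau * (1 + eps)).
Proof.
have [C0 C0pos HC0] := @charfun_bound R.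
have q0 := rel_cst_ge0 C0pos; set q := rel_cst C0 in q0.
(* Large enough for the characteristic function estimates, which need 48, and for
   [sqrt_ln_div_small], which makes the relative error at most 1/2. *)
pose k1 : R := 48 + (8 * q ^+ 2) ^+ 2.
(* The bound of [limit_mean_le] at k1. The chosen threshold gives ln tau + gamma >= Q + 1, so by
   monotonicity kappa cannot lie below k1. *)
pose Q := expR (2 * mgf_cst (k1 + 1) + 2 * mgf_cst (- k1)).
exists (q + 18 * expR 1), (expR (Q - euler_gamma + 1)).
move=> d T P X HX tau kappa tau_ge; rewrite derive2_calL // derive1_calL // momentL1E // => kE.
have tau0 : 0 < tau by apply: lt_le_trans tau_ge; exact: expR_gt0.
have k1k : k1 <= kappa.
  rewrite leNgt; apply/negP => /ltW /(limit_mean_ndecr HX); rewrite kE => h.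
  have := le_trans h (limit_mean_le HX k1); rewrite -/Q.
  move: tau_ge; rewrite -ler_ln ?posrE ?expR_gt0 // expRK; lra.
have k48 : 48 <= kappa by apply: le_trans k1k; rewrite lerDl sqr_ge0.
have k0 : 0 < kappa by lra.
have r2 : q * Num.sqrt (ln kappa / kappa) <= 1 / 2.
  by apply: sqrt_ln_div_small => //; apply: le_trans k1k; rewrite lerDr.
have [[e [e1 e2]] H2] := tail_asymptotic HX C0pos k48
  (fun t th => tilted_charfun_bound HX HC0 t th k48) tau0 kE r2.
have E1 : 0 <= expR 1 :> R by exact: expR_ge0.
split.
  exists e; split.
    apply: (le_trans e1); rewrite ler_wpM2r ?sqrtr_ge0 // lerDl mulr_ge0 //.
  rewrite e2 kE; do 3 congr (_ * _).
  rewrite /powR gt_eqF ?mulr_gt0 ?expR_gt0 // lnM ?posrE ?expR_gt0 // expRK.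
  by congr expR; ring.
move=> l lk; have [e' [e1' e2']] := H2 l lk; exists e'; split => //.
have /andP[l0 _] := lk.
by apply: (le_trans e1'); rewrite ler_wpM2r ?mulr_ge0 ?(ltW k0) // lerDr.
Qed.
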